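(* Let $\nu'$ be a Borel probability measure on $G'$ supported on a compact set $E'$ such that every $e\in E'$ satisfies $$e^{-1}=\begin{pmatrix}\rho_eO_e&0\\0&\rho_e^{-m/n}O_e'\end{pmatrix}$$ for some $0<\rho_e<1$, $O_e\in O(m)$ and $O'_e\in O(n)$. Then a point $x\in\mathcal{X}'$ is Birkhoff generic if and only if for $(\nu')^{\otimes\mathbb{N}}$-almost every $(b_p)_{p\in\mathbb{N}}\in (G')^{\mathbb{N}}$, $$\frac1N\sum_{p=1}^N\delta_{b_p\cdots b_1x}\longrightarrow\mu_{\mathcal{X}'}\quad\text{as }N\to\infty .$$
   Context: Fix integers $m,n\ge1$. $G'=\mathrm{SL}^{\pm}_{m+n}(\mathbb{R})$ is the group of real $(m+n)\times(m+n)$ matrices of determinant $\pm1$, $\Gamma'=\mathrm{SL}^{\pm}_{m+n}(\mathbb{Z})$, $\mathcal{X}'=G'/\Gamma'$, and $\mu_{\mathcal{X}'}$ is the unique $G'$-invariant Borel probability measure on $\mathcal{X}'$. $O(m)$, $O(n)$ are the orthogonal groups with respect to some fixed norms on $\mathbb{R}^m$, $\mathbb{R}^n$. For $t\in\mathbb{R}$ let $a_t=\begin{pmatrix}e^tI_m&0\\0&e^{-mt/n}I_n\end{pmatrix}$. A point $x\in\mathcal{X}'$ is Birkhoff generic if $\lim_{T\to\infty}\frac1T\int_0^T\delta_{a_tx}\,dt=\mu_{\mathcal{X}'}$. Convergence of measures is weak-* convergence (tested against continuous compactly supported functions). *)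

(* Defs.v *)
From HB Require Import structures.
From mathcomp Require Import all_boot all_order all_algebra.
From mathcomp Require Import all_classical all_reals all_analysis.

Set Implicit Arguments.
Unset Strict Implicit.
Unset Printing Implicit Defensive.

Import Order.TTheory GRing.Theory Num.Theory.
Import numFieldNormedType.Exports.

Local Open Scope classical_set_scope.
Local Open Scope quotient_scope.
Local Open Scope ring_scope.

(* SLpm A k is SL^{\pm}_k(A), the group of k x k matrices of determinant +-1. *)
Definition det_pm1 (A : comUnitRingType) (k : nat) (M : 'M[A]_k) : bool :=
  (\det M == 1) || (\det M == -1).

Record SLpm (A : comUnitRingType) (k : nat) := MkSLpm {
  SLpm_mx :> 'M[A]_k;
  SLpm_det : det_pm1 SLpm_mx }.

HB.instance Definition _ A k := [isSub for @SLpm_mx A k].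
HB.instance Definition _ A k := [Choice of SLpm A k by <:].

Section SLpm_group.
Context (A : comUnitRingType) (k : nat).
Implicit Types g h : SLpm A k.

Lemma det_pm1_1 : det_pm1 (1%:M : 'M[A]_k).
Proof. by rewrite /det_pm1 det1 eqxx. Qed.

Lemma det_pm1_M g h : det_pm1 (g *m h).
Proof.
rewrite /det_pm1 det_mulmx; case: g h => [g /= Hg] [h /= Hh].
case/orP: Hg => /eqP ->; case/orP: Hh => /eqP ->;
  by rewrite ?mulrNN ?mul1r ?mulr1 ?eqxx ?orbT.
Qed.

Lemma SLpm_unit g : (g : 'M[A]_k) \in unitmx.
Proof. by case: g => g /= /orP[]/eqP gE; rewrite unitmxE gE ?unitrN unitr1. Qed.

Lemma det_pm1_V g : det_pm1 (invmx g).
Proof.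
rewrite /det_pm1 det_inv; case: g => [g /= /orP[]/eqP->].
  by rewrite invr1 eqxx.
by rewrite invrN invr1 eqxx orbT.
Qed.

Definition SLpm_one : SLpm A k := MkSLpm det_pm1_1.
Definition SLpm_mul g h : SLpm A k := MkSLpm (det_pm1_M g h).
Definition SLpm_inv g : SLpm A k := MkSLpm (det_pm1_V g).

Lemma SLpm_mulA : associative SLpm_mul.
Proof. by move=> x y z; apply/val_inj; rewrite /= mulmxA. Qed.
Lemma SLpm_mul1 : left_id SLpm_one SLpm_mul.
Proof. by move=> x; apply/val_inj; rewrite /= mul1mx. Qed.
Lemma SLpm_mulx1 : right_id SLpm_one SLpm_mul.
Proof. by move=> x; apply/val_inj; rewrite /= mulmx1. Qed.
Lemma SLpm_mulV : left_inverse SLpm_one SLpm_inv SLpm_mul.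
Proof. by move=> x; apply/val_inj; rewrite /= mulVmx// SLpm_unit. Qed.
Lemma SLpm_mulxV : right_inverse SLpm_one SLpm_inv SLpm_mul.
Proof. by move=> x; apply/val_inj; rewrite /= mulmxV// SLpm_unit. Qed.

HB.instance Definition _ := isGroup.Build (SLpm A k)
  SLpm_mulA SLpm_mul1 SLpm_mulx1 SLpm_mulV SLpm_mulxV.
HB.instance Definition _ := isPointed.Build (SLpm A k) 1%g.

End SLpm_group.

Section space_of_lattices.
Context (R : realType) (k : nat).
Implicit Types g h : SLpm R k.

HB.instance Definition _ :=
  Topological.copy (SLpm R k) (initial_topology (@SLpm_mx R k)).

Lemma det_pm1_int (c : SLpm int k) : det_pm1 (map_mx intr c : 'M[R]_k).
Proof.
rewrite /det_pm1 det_map_mx; case: c => [c /= /orP[]/eqP->].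
  by rewrite eqxx.
by rewrite rmorphN1 eqxx orbT.
Qed.

Definition SLpm_of_int (c : SLpm int k) : SLpm R k := MkSLpm (det_pm1_int c).

(* SL^{\pm}_k(Z) as a subgroup of SL^{\pm}_k(R). *)
Definition SLpmZ : set (SLpm R k) := range SLpm_of_int.

(* g SL^{\pm}_k(Z) = h SL^{\pm}_k(Z) *)
Definition coset_rel : rel (SLpm R k) := fun g h => `[< SLpmZ (g^-1 * h)%g >].

Lemma SLpm_of_intM : {morph SLpm_of_int : c d / (c * d)%g}.
Proof. by move=> c d; apply/val_inj; rewrite /= map_mxM. Qed.

Lemma SLpm_of_int1 : SLpm_of_int 1%g = 1%g.
Proof. by apply/val_inj; rewrite /= map_mx1. Qed.

Lemma SLpm_of_intV c : SLpm_of_int c^-1%g = (SLpm_of_int c)^-1%g.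
Proof.
apply: (@mulIg _ (SLpm_of_int c)).
by rewrite -SLpm_of_intM !mulVg SLpm_of_int1.
Qed.

Lemma coset_rel_refl : reflexive coset_rel.
Proof.
by move=> g; apply/asboolP; rewrite mulVg; exists 1%g => //; exact: SLpm_of_int1.
Qed.

Lemma coset_rel_sym : symmetric coset_rel.
Proof.
suff H g h : coset_rel g h -> coset_rel h g by move=> g h; apply/idP/idP; exact: H.
move=> /asboolP[c _ cE]; apply/asboolP; exists c^-1%g => //.
by rewrite SLpm_of_intV cE invgM invgK.
Qed.

Lemma coset_rel_trans : transitive coset_rel.
Proof.
move=> h g i /asboolP[c _ cE] /asboolP[d _ dE]; apply/asboolP; exists (c * d)%g => //.
by rewrite SLpm_of_intM cE dE mulgA mulgK.
Qed.

Canonical coset_equiv := EquivRel coset_rel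
  coset_rel_refl coset_rel_sym coset_rel_trans.

Definition SLquo := quotient_topology {eq_quot coset_equiv}.

HB.instance Definition _ := Quotient.on SLquo.
HB.instance Definition _ := PointedTopological.on SLquo.

(* Left translation; repr only picks a representative, see act_pi. *)
Definition act g (x : SLquo) : SLquo := \pi_SLquo (g * repr x)%g.

Lemma act_pi g h : act g (\pi_SLquo h) = \pi_SLquo (g * h)%g.
Proof.
apply/eqmodP => /=; rewrite /coset_rel invgM -mulgA mulKg.
by have /eqmodP := reprK (\pi_SLquo h).
Qed.

End space_of_lattices.

Notation borel T := (g_sigma_algebraType (@open T)).

Section weak_star_convergence.
Context (R : realType) (T : ptopologicalType).

Definition weak_star_cvg (I : Type) (F : set_system I)
    (mu_ : I -> {measure set (borel T) -> \bar R})
    (mu : {measure set (borel T) -> \bar R}) : Prop :=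
  forall f : T -> R, continuous f -> compact (closure [set x | f x != 0]) ->
    \int[mu_ i]_x f x @[i --> F] --> \int[mu]_x f x.

End weak_star_convergence.

Section invariant_probability.
Context (R : realType) (k : nat).

Definition act_invariant (mu : probability (borel (SLquo R k)) R) : Prop :=
  forall (g : SLpm R k) (B : set (borel (SLquo R k))), measurable B ->
    mu (act g @^-1` B) = mu B.

(* "The unique invariant probability": mu is invariant, and it is the only one. *)
Definition is_haar_probability (mu : probability (borel (SLquo R k)) R) : Prop :=
  act_invariant mu /\
  forall mu' : probability (borel (SLquo R k)) R, act_invariant mu' ->
    forall B, measurable B -> mu' B = mu B.

End invariant_probability.

Section flow.
Context (R : realType) (m n : nat) (n_gt0 : (0 < n)%N).

Definition flow_mx (t : R) : 'M[R]_(m + n) :=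
  block_mx (expR t)%:M 0 0 (expR (- (m%:R * t / n%:R)))%:M.

Lemma det_flow_mx t : det_pm1 (flow_mx t).
Proof.
rewrite /det_pm1 det_ublock !det_scalar -!expRM_natl -expRD.
rewrite mulrN [n%:R * _]mulrC divfK ?pnatr_eq0 -?lt0n//.
by rewrite subrr expR0 eqxx.
Qed.

Definition flow (t : R) : SLpm R (m + n) := MkSLpm (det_flow_mx t).

Definition orbit_map (x : SLquo R (m + n)) (t : R) : borel (SLquo R (m + n)) :=
  act (flow t) x.

Lemma measurable_orbit_map x :
  measurable_fun [set: measurableTypeR R] (orbit_map x).
Proof.
have mxC (f : R -> 'M[R]_(m + n)) :
    (forall i j, continuous (fun t => f t i j)) -> continuous f.
  move=> fC t A [P fP PA].
  have : \forall u \near t, forall i, forall j, P i j (f u i j).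
    do 2![apply: (@filter_forall _ _ _ (nbhs t)) => ?]; exact: fC (fP _ _).
  by apply: filterS => u; exact: PA.
have entryC i j : continuous (fun t => flow_mx t i j).
  rewrite /flow_mx; case: (split_ordP i) => i' ->; case: (split_ordP j) => j' ->.
  - rewrite (_ : (fun _ => _) = (fun t => expR t * (i' == j')%:R)); last first.
      by apply/funext => t; rewrite block_mxEul mxE mulr_natr.
    by move=> t; apply: cvgM; [exact: continuous_expR|exact: cvg_cst].
  - under eq_fun do rewrite block_mxEur; exact: cst_continuous.
  - under eq_fun do rewrite block_mxEdl; exact: cst_continuous.
  - rewrite (_ : (fun _ => _) =
      (fun t => expR (t * - (m%:R / n%:R)) * (i' == j')%:R)); last first.
      by apply/funext => t; rewrite block_mxEdr mxE mulr_natr mulrN mulrA [t * _]mulrC.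
    have gC : continuous (fun t : R => t * - (m%:R / n%:R)).
      by move=> t; apply: cvgM; [exact: cvg_id|exact: cvg_cst].
    move=> t; apply: cvgM; last exact: cvg_cst.
    exact: (continuous_comp (gC t) (@continuous_expR R _)).
have flowC i j : continuous (fun t => (flow_mx t *m repr x) i j).
  rewrite (_ : (fun _ => _) =
    (fun t => \sum_l flow_mx t i l * (repr x : 'M[R]_(m + n)) l j)); last first.
    by apply/funext => t; rewrite mxE.
  apply: continuous_big => [|l _]; first exact: add_continuous.
  by move=> t; apply: cvgM; [exact: entryC|exact: cvg_cst].
apply: (@measurability _ _ (measurableTypeR R) (borel (SLquo R (m + n))) setT _
  (@open (SLquo R (m + n)))) => // _ [B oB <-].
rewrite setTI; apply: measurable_realfun.open_measurable.
have : open (\pi_(SLquo R (m + n)) @^-1` B) by exact: oB.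
move=> [V oV VB].
have -> : orbit_map x @^-1` B = (fun t => flow_mx t *m repr x) @^-1` V.
  by rewrite -[RHS]/((fun t => flow t * repr x)%g @^-1` (@SLpm_mx _ _ @^-1` V)) VB.
by move/continuousP: (mxC _ flowC); exact.
Qed.

Definition orbit_measure (x : SLquo R (m + n)) (T : R) :
    set (borel (SLquo R (m + n))) -> \bar R :=
  pushforward (mrestr (@lebesgue_measure R) (measurable_itv `[0, T]))
    (orbit_map x).

HB.instance Definition _ x T := Measure.copy (orbit_measure x T)
  (measure_function_pushforward__canonical__measure_function_Measure
    (mrestr (@lebesgue_measure R) (measurable_itv `[0, T]))
    (measurable_orbit_map x)).

(* 1/T \int_0^T \d_(a_t x) dt, as the image of the normalized Lebesgue measure
   on [0, T] under t |-> a_t x; the absolute value only serves to have a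
   nonnegative scalar for T < 0, and is irrelevant as T --> +oo. *)
Definition time_average (x : SLquo R (m + n)) (T : R) :
    {measure set (borel (SLquo R (m + n))) -> \bar R} :=
  mscale (`|T|^-1)%:nng (orbit_measure x T).

Definition birkhoff_generic (mu : probability (borel (SLquo R (m + n))) R)
    (x : SLquo R (m + n)) : Prop :=
  weak_star_cvg +oo (time_average x) mu.

End flow.

Section random_walk.
Context (R : realType) (k : nat).

(* b_p ... b_1; the sequence (b_1, b_2, ...) is stored as (b 0, b 1, ...). *)
Fixpoint walk (b : nat -> SLpm R k) (p : nat) : SLpm R k :=
  if p is q.+1 then (b q * walk b q)%g else 1%g.

Definition walk_average (b : nat -> SLpm R k) (x : SLquo R k) (N : nat) :
    {measure set (borel (SLquo R k)) -> \bar R} :=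
  mscale (N%:R^-1)%:nng
    (msum (fun p => dirac (act (walk b p.+1) x : borel (SLquo R k))) N).

End random_walk.

Section infinite_product.
Context d (T : measurableType d) (R : realType).

Definition coordinate_sets : set (set (nat -> T)) :=
  [set C | exists p (A : set T), measurable A /\ C = [set b | A (b p)]].

(* T^N with the product sigma-algebra. *)
Definition seq_space := g_sigma_algebraType coordinate_sets.
HB.instance Definition _ := Measurable.on seq_space.

(* P is nu^{\otimes N}: the cylinder identities determine P uniquely. *)
Definition is_infinite_product (nu : probability T R)
    (P : probability seq_space R) : Prop :=
  forall (l : nat) (A : nat -> set T), (forall p, measurable (A p)) ->
    P [set b | forall p, (p < l)%N -> A p (b p)] = (\prod_(p < l) nu (A p))%E.

End infinite_product.

Section norms.
Context (R : realType) (k : nat).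

Definition is_norm (N : 'cV[R]_k -> R) : Prop :=
  [/\ forall u v, N (u + v) <= N u + N v,
      forall (c : R) u, N (c *: u) = `|c| * N u
    & forall u, N u = 0 -> u = 0].

(* The linear isometries of an arbitrary norm; N need not be Euclidean. *)
Definition orthogonal_group (N : 'cV[R]_k -> R) : set 'M[R]_k :=
  [set A | forall v, N (A *m v) = N v].

End norms.

(* Main.v *)
From HB Require Import structures.
Require Import Defs.
From mathcomp Require Import all_boot all_order all_algebra.
From mathcomp Require Import finmap.
From mathcomp Require Import all_classical all_reals all_analysis.
From mathcomp Require Import measurable_realfun.
From mathcomp Require Import ring lra zify.

(** Modulo isometries of the two norms an element of [E] is a flow element
    [a_t] with [tmin <= t <= tmax] and [tmin > 0]; a product [b_p ... b_1] is thus
    [k_p a_(S_p)], where [k_p] lies in a compact group commuting with the flow and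
    the gaps of [S_p] lie in [[tmin, tmax]].  The walk shadows the flow orbit of
    [x], but through the uncontrolled rotations [k_p] and at uneven times, so
    averages of a test function [f] along the two cannot be compared directly.
    Nonnegative quantities can be compared up to a constant factor, and this is
    enough for a function that is nearly constant.

    Let [c] be the mean of [f].  The proof replaces [f] by a function [F] in the
    convex hull of its iterated averages [F(y) = \int f(b y) d nu(b)] such that
    [\int (F - c)^2 d mu] is small ([mean_ergodic], packaged in [smoothing]).
    Passing to such averages changes nothing in the limit: along the walk,
    the values of [F] minus their conditional means given the previous steps are
    bounded and orthogonal ([martingale_average]); along the flow, the
    averaging measure is chosen to be the point mass at [a_1] and time averages
    are asymptotically shift invariant ([time_average_flow1]).  It then remains to
    see that one kind of average of [(F - c)^2] is dominated, up to a constant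
    factor and an error [eps^2], by finitely many averages of the other kind of
    translates of the same function ([walk_dominated], [time_dominated]); the
    assumed equidistribution says that the latter are about [\int (F - c)^2 d mu]
    ([transfer_step]).

    Two points make this work.  First, the finite set of translates and [eps] have
    to be fixed before [F] is: they come from the compactness of the conformal
    blocks of bounded time ([conformal_net]), and are valid for all averages of
    [f] at once because these averages oscillate along conformal directions no
    more than [f] does ([osc_dominated]).  Second, [mean_ergodic] needs no prior
    ergodicity of the flow.  An L^2-minimizing sequence in the convex set is Cauchy
    in L^1 and asymptotically invariant under suitable elements of [E]; by
    contraction along the expanded and contracted unipotent directions it is
    asymptotically invariant under all of SL ([mautner]), and since SL acts
    transitively it is asymptotically constant ([almost_invariant_const]).

    The exceptional set of sequences [(b_p)] depends on [f]; it is made uniform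
    by a countable uniformly dense family of test functions
    ([testf_separable]).  In the converse direction one good sequence suffices. *)

Import Order.TTheory GRing.Theory Num.Theory.
Import numFieldNormedType.Exports.

Local Open Scope classical_set_scope.
Local Open Scope quotient_scope.
Local Open Scope ring_scope.

Set Implicit Arguments.
Unset Strict Implicit.
Unset Printing Implicit Defensive.

(** * Bounded measurable functions and their integrals *)

Section bounded_measurable.
Context d (T : measurableType d) (R : realType).
Implicit Types (f g : T -> R) (m : {measure set T -> \bar R}).

(** The functions averaged below are bounded and the averaging measures are finite; there the
    real-valued integral is linear and monotone without integrability conditions. *)
Definition bmeas f := measurable_fun setT f /\ exists M, forall x, `|f x| <= M.

Lemma bmeas_cst c : bmeas (fun=> c).
Proof. by split; [exact: measurable_cst|exists `|c|]. Qed.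

Lemma bmeasD f g : bmeas f -> bmeas g -> bmeas (fun x => f x + g x).
Proof.
move=> [mf [M fM]] [mg [M' gM']]; split; first exact: measurable_funD.
by exists (M + M') => x; rewrite (le_trans (ler_normD _ _))// lerD.
Qed.

Lemma bmeasN f : bmeas f -> bmeas (fun x => - f x).
Proof.
move=> [mf [M fM]]; split; first exact: measurableT_comp.
by exists M => x; rewrite normrN.
Qed.

Lemma bmeasB f g : bmeas f -> bmeas g -> bmeas (fun x => f x - g x).
Proof. by move=> bf bg; apply: bmeasD => //; exact: bmeasN. Qed.

Lemma bmeasM f g : bmeas f -> bmeas g -> bmeas (fun x => f x * g x).
Proof.
move=> [mf [M fM]] [mg [M' gM']]; split; first exact: measurable_funM.
by exists (M * M') => x; rewrite normrM ler_pM.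
Qed.

Lemma bmeasX2 f : bmeas f -> bmeas (fun x => f x ^+ 2).
Proof. by move=> bf; apply: bmeasM. Qed.

Lemma bmeas_norm f : bmeas f -> bmeas (fun x => `|f x|).
Proof.
move=> [mf [M fM]]; split; first exact: measurableT_comp.
by exists M => x; rewrite normr_id.
Qed.

Lemma bmeas_sum (I : Type) (s : seq I) (F : I -> T -> R) :
  (forall i, bmeas (F i)) -> bmeas (fun x => \sum_(i <- s) F i x).
Proof.
move=> bF; elim: s => [|i s IH].
  by under eq_fun do rewrite big_nil; exact: bmeas_cst.
by under eq_fun do rewrite big_cons; exact: bmeasD.
Qed.

Lemma bmeas_int m f : (m setT < +oo)%E -> bmeas f -> m.-integrable setT (EFin \o f).
Proof.
move=> mT [mf [M fM]]; apply: measurable_bounded_integrable => //.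
by exists M; split; [exact: num_real|move=> K MK x _; rewrite /= (le_trans (fM x))// ltW].
Qed.

Section Rint.
Variables (m : {measure set T -> \bar R}) (mT : (m setT < +oo)%E).

Lemma RintD f g : bmeas f -> bmeas g ->
  \int[m]_x (f x + g x) = \int[m]_x f x + \int[m]_x g x.
Proof. by move=> bf bg; rewrite RintegralD//; exact: bmeas_int. Qed.

Lemma RintB f g : bmeas f -> bmeas g ->
  \int[m]_x (f x - g x) = \int[m]_x f x - \int[m]_x g x.
Proof. by move=> bf bg; rewrite RintegralB//; exact: bmeas_int. Qed.

Lemma RintZ c f : bmeas f -> \int[m]_x (c * f x) = c * \int[m]_x f x.
Proof. by move=> bf; rewrite RintegralZl//; exact: bmeas_int. Qed.

Lemma Rint_sum (I : Type) (s : seq I) (F : I -> T -> R) :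
  (forall i, bmeas (F i)) ->
  \int[m]_x (\sum_(i <- s) F i x) = \sum_(i <- s) \int[m]_x F i x.
Proof.
move=> bF; elim: s => [|i s IH].
  by under eq_Rintegral do rewrite big_nil; rewrite big_nil Rintegral_cst// mul0r.
under eq_Rintegral do rewrite big_cons.
by rewrite RintD// ?IH ?big_cons//; exact: bmeas_sum.
Qed.

Lemma le_Rint f g : bmeas f -> bmeas g -> (forall x, f x <= g x) ->
  \int[m]_x f x <= \int[m]_x g x.
Proof. by move=> bf bg fg; apply: le_Rintegral => //; exact: bmeas_int. Qed.

Lemma le_norm_Rint f : bmeas f -> `|\int[m]_x f x| <= \int[m]_x `|f x|.
Proof. by move=> bf; apply: le_normr_Rintegral => //; exact: bmeas_int. Qed.

Lemma Rint_ge0 f : (forall x, 0 <= f x) -> 0 <= \int[m]_x f x.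
Proof. by move=> f0; apply: Rintegral_ge0. Qed.

Lemma EFin_Rint f : bmeas f -> (\int[m]_x f x)%:E = (\int[m]_x (f x)%:E)%E.
Proof.
move=> bf; rewrite /Rintegral fineK//.
by apply: integrable_fin_num => //; exact: bmeas_int.
Qed.

End Rint.

Lemma Rint_cst m : m setT = 1%E -> forall c, \int[m]_x c = c.
Proof. by move=> m1 c; rewrite Rintegral_cst// m1/= mulr1. Qed.

Lemma Rint_cvg m : (m setT < +oo)%E -> forall (f_ : nat -> T -> R) f M,
  (forall n, measurable_fun setT (f_ n)) -> bmeas f ->
  (forall n x, `|f_ n x| <= M) ->
  {ae m, forall x, f_ n x @[n --> \oo] --> f x} ->
  \int[m]_x f_ n x @[n --> \oo] --> \int[m]_x f x.
Proof.
move=> mT f_ f M mf_ bf f_M fae.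
have [|||||_ _ H] := @dominated_convergence _ _ _ m setT measurableT
  (fun n x => (f_ n x)%:E) (fun x => (f x)%:E) (fun=> M%:E).
- by move=> n; apply/measurable_EFinP.
- by apply/measurable_EFinP; case: bf.
- by apply: filterS fae => x fx _; apply: cvg_EFin => //; apply: nearW.
- by apply: (@bmeas_int m (fun=> M)) => //; exact: bmeas_cst.
- by apply: nearW => x n _; rewrite lee_fin.
apply: fine_cvg; move: H; congr (_ --> _).
by rewrite -EFin_Rint.
Qed.

(** The sum of the series has finite integral by monotone convergence, hence is a.e. finite.  This
    replaces each use of Chebyshev's inequality followed by the Borel-Cantelli lemma. *)
Lemma ae_bounded_series m : (m setT < +oo)%E -> forall (u : nat -> T -> R) C,
  (forall n, bmeas (u n)) -> (forall n x, 0 <= u n x) ->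
  (forall n, \sum_(i < n) \int[m]_x u i x <= C) ->
  {ae m, forall x, exists K, forall n, \sum_(i < n) u i x <= K}.
Proof.
move=> mT u C bu u0 uC.
pose g x := (\sum_(n <oo) (u n x)%:E)%E.
have g0 x : (0 <= g x)%E by apply: nneseries_ge0 => n _ _; rewrite lee_fin.
have mg : measurable_fun setT g.
  apply: ge0_emeasurable_sum => [n x _ _|n _]; first by rewrite lee_fin.
  by apply/measurable_EFinP; case: (bu n).
have ig : m.-integrable setT g.
  apply/integrableP; split => //.
  under eq_integral do rewrite gee0_abs//.
  rewrite integral_nneseries//; last 2 first.
  - by move=> n; apply/measurable_EFinP; case: (bu n).
  - by move=> n x _; rewrite lee_fin.
  apply: (@le_lt_trans _ _ C%:E); last by rewrite ltry.
  apply: lime_le.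
    by apply: is_cvg_nneseries => n _ _; apply: integral_ge0 => x _; rewrite lee_fin.
  apply: nearW => n; rewrite big_mkord.
  under eq_bigr do rewrite -EFin_Rint//.
  by rewrite sumEFin lee_fin.
apply: filterS (integrable_ae measurableT ig) => x /(_ I) gx.
exists (fine (g x)) => n; rewrite -lee_fin fineK// -sumEFin.
rewrite -(big_mkord xpredT (fun i => (u i x)%:E)).
by apply: nneseries_lim_ge => i _ _; rewrite lee_fin.
Qed.

End bounded_measurable.

Lemma bmeas_comp d d' (T : measurableType d) (T' : measurableType d') (R : realType)
  (f : T' -> R) (h : T -> T') : measurable_fun setT h -> bmeas f -> bmeas (fun x => f (h x)).
Proof.
move=> mh [mf [M fM]]; split; first exact: measurableT_comp mf mh.
by exists M => x.
Qed.

Lemma Rint_image d d' (T : measurableType d) (T' : measurableType d')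
    (R : realType) (m : {measure set T -> \bar R}) (m' : {measure set T' -> \bar R})
    (h : T -> T') (f : T' -> R) :
  (m setT < +oo)%E -> measurable_fun setT h -> bmeas f ->
  (forall A, measurable A -> m' A = m (h @^-1` A)) ->
  \int[m']_y f y = \int[m]_x f (h x).
Proof.
move=> mT mh bf m'E.
pose hm := measure_function_pushforward__canonical__measure_function_Measure m mh.
rewrite /Rintegral; congr fine.
rewrite (eq_measure_integral hm); last by move=> A mA _; rewrite m'E.
rewrite integral_pushforward//; first by apply/measurable_EFinP; case: bf.
rewrite preimage_setT; apply: (@bmeas_int _ _ _ m (f \o h)) => //.
exact: bmeas_comp.
Qed.

Section fubini.
Context d d' (T : measurableType d) (T' : measurableType d') (R : realType).
Variables (m : probability T R) (m' : probability T' R).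

Lemma probT_lty d0 (T0 : measurableType d0) (p : probability T0 R) :
  (p setT < +oo)%E.
Proof. by rewrite probability_setT ltry. Qed.

Let prodT_lty : ((m \x m')%E setT < +oo)%E.
Proof.
rewrite -setXTT product_measure1E//.
by rewrite [X in (X * _)%E](@probability_setT _ _ _ m) [X in (_ * X)%E](@probability_setT _ _ _ m') mule1 ltry.
Qed.

Lemma bmeas_Rint (f : T * T' -> R) : bmeas f -> bmeas (fun x => \int[m']_y f (x, y)).
Proof.
move=> bf; have [mf [M fM]] := bf.
have bfx x : bmeas (fun y => f (x, y)).
  by split; [exact: (measurable_fun_pair2 x mf)|exists M].
split; last first.
  exists M => x; rewrite (le_trans (le_norm_Rint _ (bfx x)))//; first exact: probT_lty.
  rewrite -[leRHS](Rint_cst (probability_setT m')) le_Rint//; first exact: probT_lty.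
    exact: bmeas_norm.
  exact: bmeas_cst.
apply/measurable_EFinP.
rewrite (_ : _ \o _ = fun x => (\int[m']_y (EFin \o f) (x, y))%E); last first.
  by apply/funext => x; rewrite -EFin_Rint//; exact: probT_lty.
apply: (@measurable_fubini_F _ _ _ _ _ m m') => //.
apply: bmeas_int => //; exact: prodT_lty.
Qed.

Lemma Rint_prod (f : T * T' -> R) : bmeas f ->
  \int[(m \x m')%E]_z f z = \int[m]_x \int[m']_y f (x, y).
Proof.
move=> bf; have [mf [M fM]] := bf.
have iF : (m \x m')%E.-integrable setT (EFin \o f).
  by apply: bmeas_int => //; exact: prodT_lty.
have /(congr1 fine) := integral12_prod_meas1 iF.
rewrite /Rintegral => <-; congr fine; apply: eq_integral => x _.
have bx : bmeas (fun y => f (x, y)).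
  by split; [exact: (measurable_fun_pair2 x mf)|exists M].
by apply: esym; apply: (EFin_Rint _ bx); exact: probT_lty.
Qed.

Lemma Rint_fubini (f : T * T' -> R) : bmeas f ->
  \int[m]_x \int[m']_y f (x, y) = \int[m']_y \int[m]_x f (x, y).
Proof.
move=> bf; have [mf [M fM]] := bf.
have b1 x : bmeas (fun y => f (x, y)).
  by split; [exact: (measurable_fun_pair2 x mf)|exists M].
have b2 y : bmeas (fun x => f (x, y)).
  by split; [exact: (measurable_fun_pair1 y mf)|exists M].
have iF : (m \x m')%E.-integrable setT (EFin \o f).
  apply: bmeas_int => //; exact: prodT_lty.
have /(congr1 fine) := Fubini iF.
rewrite /Rintegral; congr (fine _ = fine _); apply: eq_integral => z _;
  by rewrite -EFin_Rint//; exact: probT_lty.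
Qed.
End fubini.

(** * An entrywise norm, and the topology of the group of determinant plus or minus one *)

Section entry_norm.
Context (R : realType).

(** The sum of the absolute values is submultiplicative for all rectangular shapes, with constant
    one and exact on block matrices; this keeps every estimate below free of dimension constants. *)
Definition nrm p q (A : 'M[R]_(p, q)) : R := \sum_i \sum_j `|A i j|.

Lemma nrm_ge0 p q (A : 'M[R]_(p, q)) : 0 <= nrm A.
Proof. by apply: sumr_ge0 => i _; apply: sumr_ge0. Qed.

Lemma nrm0 p q : nrm (0 : 'M[R]_(p, q)) = 0.
Proof. by rewrite /nrm big1// => i _; rewrite big1// => j _; rewrite mxE normr0. Qed.

Lemma nrm_entry p q (A : 'M[R]_(p, q)) i j : `|A i j| <= nrm A.
Proof.
rewrite /nrm (bigD1 i)//= (bigD1 j)//= -addrA lerDl addr_ge0//.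
  by apply: sumr_ge0.
by apply: sumr_ge0 => ? _; apply: sumr_ge0.
Qed.

Lemma nrmD p q (A B : 'M[R]_(p, q)) : nrm (A + B) <= nrm A + nrm B.
Proof.
rewrite /nrm -big_split/= ler_sum// => i _; rewrite -big_split/= ler_sum// => j _.
by rewrite mxE ler_normD.
Qed.

Lemma nrmN p q (A : 'M[R]_(p, q)) : nrm (- A) = nrm A.
Proof. by apply: eq_bigr => i _; apply: eq_bigr => j _; rewrite mxE normrN. Qed.

Lemma nrmBC p q (A B : 'M[R]_(p, q)) : nrm (A - B) = nrm (B - A).
Proof. by rewrite -nrmN opprB. Qed.

Lemma nrmB_tri p q (B A C : 'M[R]_(p, q)) : nrm (A - C) <= nrm (A - B) + nrm (B - C).
Proof. by rewrite (le_trans _ (nrmD _ _))// subrKA. Qed.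

Lemma nrm_eq0 p q (A : 'M[R]_(p, q)) : nrm A = 0 -> A = 0.
Proof.
move=> A0; apply/matrixP => i j; rewrite mxE; apply/eqP; rewrite -normr_le0 -A0.
exact: nrm_entry.
Qed.

Lemma nrmZ p q c (A : 'M[R]_(p, q)) : nrm (c *: A) = `|c| * nrm A.
Proof.
rewrite /nrm mulr_sumr; apply: eq_bigr => i _; rewrite mulr_sumr.
by apply: eq_bigr => j _; rewrite mxE normrM.
Qed.

Lemma nrmM p q r (A : 'M[R]_(p, q)) (B : 'M[R]_(q, r)) : nrm (A *m B) <= nrm A * nrm B.
Proof.
rewrite /nrm mulr_suml ler_sum// => i _.
apply: (@le_trans _ _ (\sum_j \sum_l `|A i l| * `|B l j|)).
  apply: ler_sum => j _; rewrite mxE (le_trans (ler_norm_sum _ _ _))//.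
  by apply: ler_sum => l _; rewrite normrM.
rewrite exchange_big mulr_suml ler_sum//= => l _; rewrite -mulr_sumr ler_wpM2l//.
by rewrite (bigD1 l)//= lerDl; apply: sumr_ge0 => ? _; apply: sumr_ge0.
Qed.

Lemma nrm_lt p q (A : 'M[R]_(p, q)) e : 0 < e ->
  (forall i j, `|A i j| <= e / (p * q).+1%:R) -> nrm A < e.
Proof.
move=> e0 Ae; apply: (@le_lt_trans _ _ (\sum_(i < p) \sum_(j < q) e / (p * q).+1%:R)).
  by apply: ler_sum => i _; apply: ler_sum.
rewrite sumr_const sumr_const !card_ord -mulrnA -[X in X < _]mulr_natr [(q * p)%N]mulnC mulrAC.
by rewrite ltr_pdivrMr ?ltr0n// ltr_pM2l// ltr_nat.
Qed.

Lemma nbhs_nrm p q (A : 'M[R]_(p, q)) (V : set 'M[R]_(p, q)) :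
  nbhs A V <-> exists2 e, 0 < e & forall B, nrm (B - A) < e -> V B.
Proof.
split=> [/nbhs_ballP[e /= e0 eV]|[e e0 eV]].
  exists e => // B BA; apply: eV; split => // i j.
  rewrite /ball/= distrC (le_lt_trans _ BA)//.
  by have := nrm_entry (B - A) i j; rewrite !mxE.
apply/nbhs_ballP; exists (e / (p * q).+1%:R); first by rewrite /= divr_gt0.
move=> B [_ AB]; apply: eV; apply: nrm_lt => // i j; have := AB i j.
by rewrite /ball/= !mxE distrC => /ltW.
Qed.

End entry_norm.

Section SLtop.
Context (R : realType) (k : nat).
Local Notation G := (SLpm R k).
Implicit Types g h v : G.

Definition sdist g h : R := nrm (SLpm_mx g - SLpm_mx h).

Lemma SLmulE g h : (g * h)%g = g *m h :> 'M[R]_k. Proof. by []. Qed.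
Lemma SL1E : (1%g : G) = 1%:M :> 'M[R]_k. Proof. by []. Qed.

Lemma continuous_SLmx : continuous (@SLpm_mx R k : G -> 'M[R]_k).
Proof. exact: initial_continuous. Qed.

Lemma nbhs_SL g (W : set G) :
  nbhs g W <-> exists2 e, 0 < e & forall h, sdist h g < e -> W h.
Proof.
split=> [[U [[V oV <-] Vg] UW]|[e e0 eW]].
  have /nbhs_nrm[e e0 eV] : nbhs (g : 'M[R]_k) V by exact: open_nbhs_nbhs.
  by exists e => // h hg; apply: UW; apply: eV.
have : nbhs (g : 'M[R]_k) [set B | nrm (B - SLpm_mx g) < e] by apply/nbhs_nrm; exists e.
move/(@continuous_SLmx g); rewrite nbhs_simpl/=; apply: filterS => h; exact: eW.
Qed.

(** Left translates of neighbourhoods of the identity form a base: continuity can be tested on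
    [v * g] for small [v], which is what left actions see. *)
Lemma nbhs_SL_mul g (W : set G) :
  nbhs g W <-> exists2 e, 0 < e & forall v, sdist v 1%g < e -> W (v * g)%g.
Proof.
rewrite nbhs_SL; split=> -[e e0 eW].
  exists (e / (nrm g + 1)); first by rewrite divr_gt0// ltr_wpDl// nrm_ge0.
  move=> v v1; apply: eW; rewrite /sdist SLmulE -[X in _ - X]mul1mx -mulmxBl.
  rewrite (le_lt_trans (nrmM _ _))//.
  rewrite (@le_lt_trans _ _ (sdist v 1%g * (nrm g + 1)))//.
    by rewrite ler_wpM2l ?nrm_ge0// lerDl.
  by rewrite -ltr_pdivlMr// ltr_wpDl// nrm_ge0.
exists (e / (nrm (g^-1)%g + 1)); first by rewrite divr_gt0// ltr_wpDl// nrm_ge0.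
move=> h hg; rewrite -[h](mulgVK g); apply: eW.
rewrite /sdist -(mulgV g) !SLmulE -mulmxBl.
rewrite (le_lt_trans (nrmM _ _))//.
rewrite (@le_lt_trans _ _ (sdist h g * (nrm (g^-1)%g + 1)))//.
  by rewrite ler_wpM2l ?nrm_ge0// lerDl.
by rewrite -ltr_pdivlMr// ltr_wpDl// nrm_ge0.
Qed.

Lemma SL_hausdorff : hausdorff_space G.
Proof.
move=> g h /= gh; apply/val_inj => /=; apply/eqP; rewrite -subr_eq0; apply/eqP.
apply: nrm_eq0; apply/eqP; rewrite eq_le nrm_ge0 andbT leNgt; apply/negP => d0.
rewrite -/(sdist g h) in d0; set d := sdist g h in d0.
have A1 : nbhs g [set x | sdist x g < d / 2].
  by apply/nbhs_SL; exists (d / 2) => //; rewrite divr_gt0.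
have A2 : nbhs h [set x | sdist x h < d / 2].
  by apply/nbhs_SL; exists (d / 2) => //; rewrite divr_gt0.
have [x /= [xg xh]] := gh _ _ A1 A2.
have : d < d.
  rewrite {1}/d (le_lt_trans (nrmB_tri (SLpm_mx x) _ _))// nrmBC [ltRHS](splitr d) ltrD//.
by rewrite ltxx.
Qed.

Lemma continuous_det : continuous (fun A : 'M[R]_k => \det A).
Proof.
rewrite /determinant; apply: continuous_big => [|s _]; first exact: add_continuous.
have cst A0 : continuous (fun _ : 'M[R]_k => A0 : R) by exact: cst_continuous.
move=> A; apply: (cvgM (cst _ A)); move: A.
apply: continuous_big => [|i _]; first exact: mul_continuous.
by move=> A; exact: coord_continuous.
Qed.

Lemma continuous_entry_norm p q i j : continuous (fun A : 'M[R]_(p, q) => `|A i j|).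
Proof.
by move=> A; apply: (@continuous_comp _ _ _ (fun A : 'M[R]_(p, q) => A i j) (@Num.norm R R));
  [exact: coord_continuous|exact: norm_continuous].
Qed.

Lemma continuous_nrm p q : continuous (@nrm R p q).
Proof.
rewrite /nrm; apply: continuous_big => [|i _]; first exact: add_continuous.
apply: continuous_big => [|j _]; first exact: add_continuous.
exact: continuous_entry_norm.
Qed.

Lemma compact_box p q (c : R) : compact [set A : 'M[R]_(p, q) | forall i j, `|A i j| <= c].
Proof.
have -> : [set A : 'M[R]_(p, q) | forall i j, `|A i j| <= c] =
    vec_mx @` [set v : 'rV_(p * q) | forall i, `[- c, c]%classic (v ord0 i)].
  apply/seteqP; split => [A Ac|_ [v vc <-] i j].
    exists (mxvec A); last exact: mxvecK.
    move=> i; case/mxvec_indexP: i => i j.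
    by rewrite mxvecE /= in_itv/= -ler_norml; exact: Ac.
  by rewrite mxE ler_norml; have := vc (mxvec_index i j); rewrite /= in_itv.
apply: continuous_compact; last by apply: (@rV_compact _ _ (fun=> `[- c, c]%classic)) => i; exact: segment_compact.
apply: continuous_subspaceT => v A /nbhs_nrm[e e0 eA].
have : nbhs v [set w | forall i, `|v ord0 i - w ord0 i| < e / (p * q).+1%:R].
  apply/nbhs_ballP; exists (e / (p * q).+1%:R); first by rewrite /= divr_gt0.
  by move=> w [_ vw] i; exact: vw.
apply: filterS => w vw; apply: eA; apply: nrm_lt => // i j.
by rewrite !mxE distrC ltW.
Qed.

(** The group is closed in the space of matrices, so a cluster point of a filter of matrices in [K]
    lifts to the group. *)
Lemma compact_SL (K : set 'M[R]_k) : compact K -> (forall A, K A -> det_pm1 A) ->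
  compact [set g : G | K g].
Proof.
move=> cK Kdet F PF FK.
have [A [KA clA]] := cK (@SLpm_mx R k @ F) _ FK.
exists (MkSLpm (Kdet _ KA)); split => // U V FU /nbhs_SL[e e0 eV].
have nA : nbhs A [set B | nrm (B - A) < e] by apply/nbhs_nrm; exists e.
have FU' : (@SLpm_mx R k @ F) (@SLpm_mx R k @` U).
  by rewrite nbhs_simpl/=; apply: filterS FU => g Ug; exists g.
have [B [[g Ug <-] gA]] := clA _ _ FU' nA.
by exists g; split => //; apply: eV.
Qed.

Lemma compact_SL_ball c : compact [set g : G | nrm g <= c].
Proof.
have cK : compact ([set A : 'M[R]_k | forall i j, `|A i j| <= c] `&`
   [set A | nrm A <= c /\ det_pm1 A]).
  apply: compact_closedI; first exact: compact_box.
  have -> : [set A : 'M[R]_k | nrm A <= c /\ det_pm1 A] =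
      (@nrm R k k @^-1` [set x | x <= c]) `&`
      ((fun A : 'M[R]_k => \det A) @^-1` ([set 1] `|` [set - 1])).
    apply/seteqP; split=> A [/= Ac]; rewrite /det_pm1; split => //.
      by case/orP: b => /eqP; tauto.
    by case: b => ->; rewrite eqxx ?orbT.
  apply: closedI.
    by apply: closed_comp; [move=> A _; exact: continuous_nrm|exact: closed_le].
  apply: closed_comp; first by move=> A _; exact: continuous_det.
  by apply: closedU; exact: closed_eq.
have := compact_SL cK; rewrite (_ : [set g : G | _] = [set g : G | nrm g <= c]).
  by apply=> A [_ []].
apply/seteqP; split=> [g [_ []]//|g gc]; split; last by split => //; case: g gc.
by move=> i j; rewrite (le_trans (nrm_entry _ _ _)).
Qed.

End SLtop.

(** * The space of lattices *)

Section sdist_theory.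
Context (R : realType) (k : nat).
Local Notation G := (SLpm R k).
Implicit Types g h v w : G.
Local Notation c1 := (nrm (1%:M : 'M[R]_k)).

Lemma sdist_ge0 g h : 0 <= sdist g h.
Proof. exact: nrm_ge0. Qed.

Lemma sdistxx g : sdist g g = 0.
Proof. by rewrite /sdist subrr nrm0. Qed.

Lemma sdistMl g h w : sdist (w * g)%g (w * h)%g <= nrm w * sdist g h.
Proof. by rewrite /sdist !SLmulE -mulmxBr nrmM. Qed.

Lemma sdistMr g h w : sdist (g * w)%g (h * w)%g <= sdist g h * nrm w.
Proof. by rewrite /sdist !SLmulE -mulmxBl nrmM. Qed.

Lemma sdist_tri w g h : sdist g h <= sdist g w + sdist w h.
Proof. exact: nrmB_tri. Qed.

Lemma sdistC g h : sdist g h = sdist h g.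
Proof. exact: nrmBC. Qed.

Lemma nrm_sdist g h : nrm g <= nrm h + sdist g h.
Proof. by rewrite -{1}[SLpm_mx g](subrK (SLpm_mx h)) addrC nrmD. Qed.

Lemma sdist_conj h v : sdist (h * v * h^-1)%g 1%g <= nrm h * nrm (h^-1)%g * sdist v 1%g.
Proof.
have -> : sdist (h * v * h^-1)%g 1%g = sdist (h * v * h^-1)%g (h * 1 * h^-1)%g.
  by rewrite mulg1 mulgV.
rewrite (le_trans (sdistMr _ _ _))//.
by rewrite mulrAC ler_wpM2r ?nrm_ge0// sdistMl.
Qed.

(** The norm of [v^-1] is at most [nrm 1] plus its distance to 1, and the latter is at most
    that norm times [sdist v 1]; for [sdist v 1 <= 1 / 2] the inequality can be solved. *)
Lemma sdistV v : sdist v 1%g <= 1 / 2 -> sdist (v^-1)%g 1%g <= 2 * c1 * sdist v 1%g.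
Proof.
move=> v1; have : sdist (v^-1)%g 1%g <= nrm (v^-1)%g * sdist v 1%g.
  have -> : sdist (v^-1)%g 1%g = sdist (v^-1 * v)%g (v^-1 * 1)%g.
    by rewrite mulVg mulg1 sdistC.
  exact: sdistMl.
have := nrm_sdist (v^-1)%g 1%g; have := sdist_ge0 v 1%g.
have := sdist_ge0 (v^-1)%g 1%g; rewrite SL1E; nra.
Qed.

Lemma sdistV_small e : 0 < e ->
  exists2 d, 0 < d & forall v, sdist v 1%g < d -> sdist (v^-1)%g 1%g < e.
Proof.
move=> e0; have c0 : 0 <= c1 by exact: nrm_ge0.
have d0 : 0 < e / (2 * c1 + 1) by rewrite divr_gt0//; lra.
exists (Num.min (1 / 2) (e / (2 * c1 + 1))); first by rewrite lt_min d0; lra.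
move=> v; rewrite lt_min => /andP[/ltW/sdistV v1 v2].
rewrite (le_lt_trans v1)// (@le_lt_trans _ _ ((2 * c1 + 1) * sdist v 1%g))//.
  by rewrite ler_wpM2r ?sdist_ge0//; lra.
by rewrite mulrC -ltr_pdivlMr//; lra.
Qed.

Lemma sdistM_small e : 0 < e ->
  exists2 d, 0 < d & forall v w, sdist v 1%g < d -> sdist w 1%g < d ->
    sdist (v * w)%g 1%g < e.
Proof.
move=> e0; have c0 : 0 <= c1 by exact: nrm_ge0.
have d0 : 0 < e / (c1 + 2) by rewrite divr_gt0//; lra.
exists (Num.min 1 (e / (c1 + 2))); first by rewrite lt_min d0; lra.
move=> v w; rewrite !lt_min => /andP[v1 v2] /andP[w1 w2].
rewrite (le_lt_trans (sdist_tri w _ _))//.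
have : sdist (v * w)%g w <= sdist v 1%g * nrm w.
  by rewrite -{2}(mul1g w) sdistMr.
have := nrm_sdist w 1%g; rewrite SL1E; move: d0 v2 w2.
set t := e / (c1 + 2); have -> : e = t * (c1 + 2).
  by rewrite /t divfK// gt_eqF//; lra.
have := sdist_ge0 v 1%g; have := sdist_ge0 w 1%g; have := nrm_ge0 (SLpm_mx w).
move: (sdist v _) (sdist w _) (sdist _ w) (nrm (SLpm_mx w)) v1 w1 => a b s n a1 b1.
move=> n0 b0 a0 t0 at' bt nb sn.
have : a * n <= t * (c1 + 1) by nra.
nra.
Qed.

End sdist_theory.

Section lattice_space.
Context (R : realType) (k : nat).
Local Notation G := (SLpm R k).
Local Notation X := (SLquo R k).
Local Notation pi := (\pi_(SLquo R k)).
Implicit Types (g h v w : G) (y : X) (f : X -> R).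

Lemma piP y : exists g, pi g = y.
Proof. by exists (repr y); rewrite reprK. Qed.

Lemma act1 y : act 1%g y = y.
Proof. by have [g <-] := piP y; rewrite act_pi mul1g. Qed.

Lemma actM g h y : act (g * h)%g y = act g (act h y).
Proof. by have [w <-] := piP y; rewrite !act_pi mulgA. Qed.

Lemma actK g y : act (g^-1)%g (act g y) = y.
Proof. by rewrite -actM mulVg act1. Qed.

Lemma pi_cont : continuous (pi : G -> X).
Proof. exact: pi_continuous. Qed.

Lemma continuous_act h : continuous (act h : X -> X).
Proof.
apply/quotient_continuous.
have -> : act h \o pi = pi \o (fun g => h * g)%g.
  by apply/funext => g /=; rewrite act_pi.
move=> g; apply: continuous_comp; last exact: pi_cont.
move=> W /nbhs_SL[e e0 eW]; apply/nbhs_SL.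
have n0 : 0 < nrm h + 1 by rewrite ltr_wpDl// nrm_ge0.
exists (e / (nrm h + 1)); first by rewrite divr_gt0.
move=> g' gg'; apply: eW; rewrite (le_lt_trans (sdistMl _ _ _))//.
rewrite (@le_lt_trans _ _ ((nrm h + 1) * sdist g' g))//.
  by rewrite ler_wpM2r ?sdist_ge0// lerDl.
by rewrite mulrC -ltr_pdivlMr.
Qed.

(** The quotient map is open and [act v] moves [pi g] to [pi (v * g)], so continuity on the quotient
    is continuity in the group direction at each point. *)
Lemma continuous_actP f : continuous f <->
  (forall y e, 0 < e -> exists2 d, 0 < d & forall v, sdist v 1%g < d -> `|f (act v y) - f y| < e).
Proof.
split=> [/quotient_continuous fc y e e0|fc].
  have [g <-] := piP y; have /(cvgrPdist_lt (FF := nbhs_filter (g : G)))/(_ _ e0)/nbhs_SL_mul[d d0 dd] := fc g.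
  by exists d => // v /dd /=; rewrite distrC act_pi.
apply/quotient_continuous => g.
apply/(cvgrPdist_lt (FF := nbhs_filter (g : G))) => e e0; apply/nbhs_SL_mul.
have [d d0 dd] := fc (pi g) _ e0.
by exists d => // v /dd /=; rewrite distrC act_pi.
Qed.

(** The distance from the matrix [q] to the coset [y].  For [q = 0] it is a proper function on the
    space of lattices, used to express compact support; for rational [q] it gives a countable
    family of bump functions. *)
Definition hgt (q : 'M[R]_k) y : R :=
  inf [set nrm (SLpm_mx g - q) | g in [set g | pi g = y]].

Let fiber_lb q y : has_lbound [set nrm (SLpm_mx g - q) | g in [set g | pi g = y]].
Proof. by exists 0 => _ [g _ <-]; exact: nrm_ge0. Qed.

Let fiber_neq0 q y : [set nrm (SLpm_mx g - q) | g in [set g | pi g = y]] !=set0.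
Proof. by have [g gy] := piP y; exists (nrm (SLpm_mx g - q)); exists g. Qed.

Lemma hgt_ge0 q y : 0 <= hgt q y.
Proof. by apply: lb_le_inf => // _ [g _ <-]; exact: nrm_ge0. Qed.

Lemma hgt_le q g : hgt q (pi g) <= nrm (SLpm_mx g - q).
Proof. by apply: ge_inf => //; exists g. Qed.

Lemma hgt_lt q y c : hgt q y < c -> exists2 g, pi g = y & nrm (SLpm_mx g - q) < c.
Proof. by move=> /inf_lt[]// _ [g gy <-] gc; exists g. Qed.

Lemma hgt_act q v y : hgt q (act v y) <= hgt q y + sdist v 1%g * (nrm q + hgt q y).
Proof.
apply/ler_addgt0Pr => e e0; have d0 := sdist_ge0 v 1%g.
have [] := @hgt_lt q y (hgt q y + e / (1 + sdist v 1%g)).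
  by rewrite ltrDl divr_gt0// ltr_wpDr.
move=> g gy gq; rewrite -{1}gy act_pi (le_trans (hgt_le _ _))//.
rewrite (le_trans (nrmB_tri (SLpm_mx g) _ _))//.
have : sdist (v * g)%g g <= sdist v 1%g * nrm g by rewrite -{2}(mul1g g) sdistMr.
rewrite /sdist -/(sdist v 1%g).
have : nrm g <= nrm q + nrm (SLpm_mx g - q).
  by rewrite -{1}[SLpm_mx g](subrK q) addrC nrmD.
set t := nrm (SLpm_mx g - q) in gq *; set s := sdist v 1%g in d0 gq *.
move: gq; set e' := e / (1 + s).
have ee' : e = e' * (1 + s) by rewrite /e' divfK// gt_eqF// ltr_wpDr.
rewrite ee'; have := nrm_ge0 (SLpm_mx g); nra.
Qed.

Lemma hgt0_act b y : hgt 0 (act b y) <= nrm b * hgt 0 y.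
Proof.
apply/ler_addgt0Pr => e e0; have n0 := nrm_ge0 b.
have [] := @hgt_lt 0 y (hgt 0 y + e / (1 + nrm b)).
  by rewrite ltrDl divr_gt0// ltr_wpDr.
move=> g gy; rewrite subr0 => gq; rewrite -{1}gy act_pi (le_trans (hgt_le _ _))//.
rewrite subr0 SLmulE (le_trans (nrmM _ _))//.
move: gq; set e' := e / (1 + nrm b).
have ee' : e = e' * (1 + nrm b) by rewrite /e' divfK// gt_eqF// ltr_wpDr.
have e'0 : 0 < e' by rewrite divr_gt0// ltr_wpDr.
rewrite ee'; have := nrm_ge0 (SLpm_mx g); nra.
Qed.

Lemma continuous_hgt q : continuous (hgt q : X -> R).
Proof.
apply/continuous_actP => y e e0.
pose K := nrm q + hgt q y + 1.
have K0 : 0 < K by rewrite ltr_wpDl// addr_ge0 ?nrm_ge0 ?hgt_ge0.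
have e1 : 0 < Num.min (e / (2 * K)) (1 / 2).
  by rewrite lt_min divr_gt0//= ?mulr_gt0//; lra.
have [d d0 dd] := @sdistV_small R k _ e1.
exists (Num.min d (Num.min (e / (2 * K)) (1 / 2))); first by rewrite lt_min d0.
move=> v; rewrite lt_min => /andP[/dd vd1]; move: vd1.
rewrite !lt_min => /andP[a1 a2] /andP[b1 b2].
have := hgt_act q v y; have := hgt_act q (v^-1)%g (act v y); rewrite actK.
have := sdist_ge0 v 1%g; have := sdist_ge0 (v^-1)%g 1%g.
have := hgt_ge0 q y; have := hgt_ge0 q (act v y); have := nrm_ge0 q.
have K2 : 0 < 2 * K by rewrite mulr_gt0.
move: a1 b1; rewrite !ltr_pdivlMr// /K in K0 *.
move: (sdist v _) (sdist (v^-1)%g _) (hgt q (act v y)) (hgt q y) (nrm q) a2 b2 K0.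
move=> s s' a' a n s'2 s2 K0 s'e se n0 a'0 a0 s'0 s0 h1 h2.
rewrite ltr_norml; apply/andP; split; last nra.
have [a'a|a'a] := leP a a'; first by lra.
have : s' * a' <= s' * a by rewrite ler_wpM2l// ltW.
nra.
Qed.

(** A sublevel set is a closed subset of the image of a ball of the group, and balls of the group
    are compact. *)
Lemma compact_hgt q c : compact [set y | hgt q y <= c].
Proof.
have K := @compact_SL_ball R k (c + 1 + nrm q).
apply: (subclosed_compact _ (continuous_compact (continuous_subspaceT pi_cont) K)).
  rewrite (_ : [set y | _] = hgt q @^-1` [set x | x <= c])//.
  by apply: closed_comp; [move=> y _; exact: continuous_hgt|exact: closed_le].
move=> y /= yc; have [|g gy gq] := @hgt_lt q y (c + 1); first by lra.
exists g => //=; rewrite -{1}[SLpm_mx g](subrK q) (le_trans (nrmD _ _))//.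
by rewrite lerD2r ltW.
Qed.

End lattice_space.

(** * Test functions on the space of lattices *)

Section test_functions.
Context (R : realType) (k : nat).
Local Notation G := (SLpm R k).
Local Notation X := (SLquo R k).
Local Notation pi := (\pi_(SLquo R k)).
Implicit Types (g h v w : G) (y : X) (f : X -> R).

(** Uniform continuity for the action rather than for a metric on the quotient: it passes to
    averages over compact sets of group elements. *)
Definition ucont f := forall e, 0 < e -> exists2 d, 0 < d &
  forall v, sdist v 1%g < d -> forall y, `|f (act v y) - f y| < e.

Definition hsupp f := exists n, forall y, n < hgt 0 y -> f y = 0.

Definition testf f := ucont f /\ hsupp f.

Lemma ucont_continuous f : ucont f -> continuous f.
Proof.
move=> uf; apply/continuous_actP => y e /uf[d d0 dd].
by exists d => // v /dd.
Qed.

Lemma testf_continuous f : testf f -> continuous f.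
Proof. by move=> [/ucont_continuous]. Qed.

Lemma hsupp_compact f : hsupp f -> compact (closure [set y | f y != 0]).
Proof.
move=> [n fn]; apply: (subclosed_compact _ (@compact_hgt R k 0 n)).
  exact: closed_closure.
have cB : closed [set y : X | hgt 0 y <= n].
  rewrite (_ : [set y | _] = hgt 0 @^-1` [set x | x <= n])//.
  by apply: closed_comp; [move=> y _; exact: continuous_hgt|exact: closed_le].
rewrite [X in _ `<=` X]((closure_id _).1 cB); apply: closure_subset => y /= fy.
by rewrite leNgt; apply/negP => /fn fy0; rewrite fy0 eqxx in fy.
Qed.

Lemma hsupp_bounded f : continuous f -> hsupp f -> exists M, forall y, `|f y| <= M.
Proof.
move=> fc [n fn].
have /compact_bounded[M [_ /(_ (`|M| + 1))]] :=
  continuous_compact (continuous_subspaceT fc) (@compact_hgt R k 0 n).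
rewrite (le_lt_trans (ler_norm M)) ?ltrDl// => /(_ isT) MP.
exists (`|M| + 1) => y; have [yn|yn] := leP (hgt 0 y) n; first by apply: MP; exists y.
by rewrite fn// normr0 addr_ge0.
Qed.

Lemma compact_hsupp f : compact (closure [set y | f y != 0]) -> hsupp f.
Proof.
move=> fK; have /compact_bounded[M [_ /(_ (`|M| + 1))]] :=
  continuous_compact (continuous_subspaceT (@continuous_hgt R k 0)) fK.
rewrite (le_lt_trans (ler_norm M)) ?ltrDl// => /(_ isT) MP.
exists (`|M| + 1) => y yM; apply/eqP; apply: contraLR yM => fy; rewrite -leNgt.
rewrite (le_trans (ler_norm _))//; apply: MP; exists y => //.
exact: subset_closure.
Qed.

(** Heine's theorem: on a ball of the group a continuous function is uniformly continuous for the
    action by compactness, and outside a larger ball neither [y] nor [act v y] meets the support. *)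
Lemma hsupp_ucont f : continuous f -> hsupp f -> ucont f.
Proof.
move=> fc [n fn] e e0.
pose c1 := nrm (1%:M : 'M[R]_k); have c10 : 0 <= c1 by exact: nrm_ge0.
(* if act v y has height at most n, then y has height at most nrm v^-1 * n <= (c1 + 1) * n < N *)
pose N := (c1 + 1) * `|n| + 1.
have cK := @compact_SL_ball R k N.
have : \forall d \near (0 : R)^'+, [set g : G | nrm g <= N] `<=`
    (fun g => forall v, sdist v 1%g < d -> `|f (act v (pi g)) - f (pi g)| < e).
  move/compact_near_coveringP : cK; apply => x _.
  have e2 : 0 < e / 2 by rewrite divr_gt0.
  have [d1 d10 dd1] := (continuous_actP f).1 fc (pi x) _ e2.
  have [d2 d20 dd2] := @sdistM_small R k _ d10.
  have [d3 d30 dd3] : exists2 d3, 0 < d3 & d3 <= d1 /\ d3 <= d2.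
    by exists (Num.min d1 d2); [rewrite lt_min d10|rewrite !ge_min !lexx orbT].
  exists ([set g | exists2 w, sdist w 1%g < d3 & g = (w * x)%g],
          [set d | d < d2]) => /=.
    split; last exact: nbhs_right_lt.
    by apply/nbhs_SL_mul; exists d3 => // v vd3; exists v.
  move=> [g d] /= [[w wd ->] dd2'] v vd; rewrite act_pi mulgA.
  rewrite -[X in `|X|](subrKA (f (pi x))) (le_lt_trans (ler_normD _ _))//.
  rewrite [ltRHS]splitr ltrD//; last first.
    by rewrite distrC -act_pi; apply: dd1; case: dd3 => + _; exact: lt_le_trans.
  rewrite -act_pi; apply: dd1; apply: dd2; first exact: lt_trans vd _.
  by case: dd3 => _; exact: lt_le_trans.
move=> [/= d4 d40 /(_ (d4 / 2))]; rewrite /ball_/= sub0r normrN.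
rewrite gtr0_norm ?divr_gt0// ltr_pdivrMr// ltr_pMr// ltr1n => /(_ isT isT) H.
have [d5 d50 dd5] := @sdistV_small R k _ (@ltr01 R).
exists (Num.min (d4 / 2) d5); first by rewrite lt_min d50 divr_gt0.
move=> v; rewrite lt_min => /andP[v4 /dd5 v5] y.
have [yN|yN] := ltP (hgt 0 y) N.
  have [g <-] := hgt_lt yN; rewrite subr0 => gN.
  by apply: H => //=; exact: ltW.
have nN : n < N.
  by rewrite /N; have := ler_norm n; have := normr_ge0 n; nra.
rewrite !fn ?subrr ?normr0//; first exact: lt_le_trans yN.
rewrite ltNge; apply/negP => vyn.
have := hgt0_act (v^-1)%g (act v y); rewrite actK.
have := nrm_sdist (v^-1)%g 1%g; rewrite SL1E -/c1.
have := nrm_ge0 (SLpm_mx (v^-1)%g); have := hgt_ge0 0 (act v y).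
have := ler_norm n; have := normr_ge0 n; move: yN v5; rewrite /N.
move: (nrm (SLpm_mx _)) (hgt 0 (act _ _)) (hgt 0 y) `|n| (sdist _ _) vyn => a b c n' s.
move=> bn cn s1 n'0 nn' b0 a0 aS ca.
have : a * b <= (c1 + 1) * n' by apply: ler_pM => //; lra.
lra.
Qed.

Lemma testfP f : testf f <-> continuous f /\ compact (closure [set y | f y != 0]).
Proof.
split=> [[uf hf]|[fc /compact_hsupp hf]]; last by split => //; exact: hsupp_ucont.
by split; [exact: ucont_continuous|exact: hsupp_compact].
Qed.

Lemma testf_bounded f : testf f -> exists M, forall y, `|f y| <= M.
Proof. by move=> tf; apply: hsupp_bounded; [exact: testf_continuous|case: tf]. Qed.

Lemma testfD f f' : testf f -> testf f' -> testf (fun y => f y + f' y).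
Proof.
move=> tf tf'; have fc := testf_continuous tf; have fc' := testf_continuous tf'.
have hs : hsupp (fun y => f y + f' y).
  case: tf tf' => _ [n fn] [_ [n' fn']]; exists (Num.max n n') => y.
  by rewrite gt_max => /andP[/fn -> /fn' ->]; rewrite addr0.
split => //; apply: hsupp_ucont => //.
by move=> y; exact: cvgD (fc y) (fc' y).
Qed.

Lemma testfM f f' : testf f -> continuous f' -> testf (fun y => f y * f' y).
Proof.
move=> tf fc'; have fc := testf_continuous tf.
have hs : hsupp (fun y => f y * f' y).
  by case: tf => _ [n fn]; exists n => y /fn ->; rewrite mul0r.
split => //; apply: hsupp_ucont => //.
by move=> y; exact: cvgM (fc y) (fc' y).
Qed.

Lemma testfZ c f : testf f -> testf (fun y => c * f y).
Proof.
move=> tf; under eq_fun do rewrite mulrC; apply: testfM => //.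
exact: cst_continuous.
Qed.

Lemma testfX2 f : testf f -> testf (fun y => f y ^+ 2).
Proof. by move=> tf; apply: testfM => //; exact: testf_continuous. Qed.

Lemma testf0 : testf (fun=> 0).
Proof.
split; first by move=> e e0; exists 1 => // v _ y; rewrite subrr normr0.
by exists 0.
Qed.

Lemma ucont_act h f : ucont f -> ucont (fun y => f (act h y)).
Proof.
move=> uf e /uf[d d0 dd].
pose K := nrm h * nrm (h^-1)%g + 1.
have K0 : 0 < K by rewrite ltr_wpDl// mulr_ge0// nrm_ge0.
exists (d / K); first exact: divr_gt0.
move=> v vd y; rewrite -actM -(mulgVK h (h * v)%g) actM; apply: dd.
rewrite (le_lt_trans (sdist_conj _ _))//.
rewrite (@le_lt_trans _ _ (K * sdist v 1%g))//.
  by rewrite ler_wpM2r ?sdist_ge0// lerDl.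
by rewrite mulrC -ltr_pdivlMr.
Qed.

Lemma hsupp_act h f : hsupp f -> hsupp (fun y => f (act h y)).
Proof.
move=> [n fn]; exists (nrm (h^-1)%g * `|n|) => y yn; apply: fn.
rewrite ltNge; apply/negP => hyn.
have := hgt0_act (h^-1)%g (act h y); rewrite actK leNgt => /negP; apply.
rewrite (le_lt_trans _ yn)// ler_wpM2l ?nrm_ge0//.
by rewrite (le_trans hyn)// ler_norm.
Qed.

Lemma testf_act h f : testf f -> testf (fun y => f (act h y)).
Proof. by move=> [uf hf]; split; [exact: ucont_act|exact: hsupp_act]. Qed.

End test_functions.

Section borel_sets.
Context (R : realType).

Lemma borel_open (T : ptopologicalType) (B : set (borel T)) : open (B : set T) -> measurable B.
Proof. by move=> oB; exact: sub_sigma_algebra. Qed.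

Lemma borel_closed (T : ptopologicalType) (B : set (borel T)) : closed (B : set T) -> measurable B.
Proof. by move=> cB; rewrite -[B]setCK; apply: measurableC; apply: borel_open; exact: closed_openC. Qed.

Lemma borel_continuous (T : ptopologicalType) (f : T -> R) : continuous f ->
  measurable_fun setT (f : borel T -> R).
Proof.
move=> /continuousP fc.
apply: (@measurability _ _ (borel T) (measurableTypeR R) setT f (@RGenOInfty.G R)); first exact: RGenOInfty.measurableE.
move=> _ [_ [x ->] <-]; rewrite setTI; apply: borel_open; apply: fc.
exact: interval_open.
Qed.

Lemma borel_continuous2 (T T' : ptopologicalType) (h : T -> T') : continuous h ->
  measurable_fun setT (h : borel T -> borel T').
Proof.
move=> /continuousP hc.
apply: (@measurability _ _ (borel T) (borel T') setT h (@open T')) => //.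
by move=> _ [B oB <-]; rewrite setTI; apply: borel_open; exact: hc.
Qed.
End borel_sets.

Section invariance.
Context (R : realType) (k : nat).
Local Notation G := (SLpm R k).
Local Notation X := (SLquo R k).
Implicit Types (f : X -> R).

Lemma bmeas_cont f : continuous f -> (exists M, forall y, `|f y| <= M) ->
  bmeas (f : borel X -> R).
Proof. by move=> fc fM; split => //; exact: borel_continuous. Qed.

Lemma bmeas_testf f : testf f -> bmeas (f : borel X -> R).
Proof.
by move=> tf; apply: bmeas_cont; [exact: testf_continuous|exact: testf_bounded].
Qed.

Lemma measurable_act (h : G) : measurable_fun setT (act h : borel X -> borel X).
Proof. by apply: borel_continuous2; exact: continuous_act. Qed.

Lemma bmeas_act (h : G) (f : borel X -> R) : bmeas f ->
  bmeas ((fun y => f (act h y)) : borel X -> R).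
Proof. by apply: bmeas_comp; exact: measurable_act. Qed.

Lemma Rint_act (mu : probability (borel X) R) (h : G) (f : borel X -> R) :
  act_invariant mu -> bmeas f -> \int[mu]_y f (act h y) = \int[mu]_y f y.
Proof.
move=> minv bf; apply/esym; apply: Rint_image => //; first exact: probT_lty.
  exact: measurable_act.
by move=> A mA; apply: esym; exact: minv.
Qed.
End invariance.

(** * Generation of the special linear group by elementary matrices *)

Section elementary_matrices.
Context (F : fieldType).

Definition elemx k (i j : 'I_k) (c : F) : 'M[F]_k := 1%:M + c *: delta_mx i j.

Lemma elemx_mulE k (i j : 'I_k) c (A : 'M[F]_k) a b :
  (elemx i j c *m A) a b = A a b + (a == i)%:R * (c * A j b).
Proof.
rewrite /elemx mulmxDl mul1mx mxE -scalemxAl mxE; congr (_ + _).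
rewrite mxE (bigD1 j)//= big1 ?addr0 => [|l /negPf lj]; last by rewrite mxE lj andbF mul0r.
by rewrite mxE eqxx andbT mulrCA.
Qed.

Lemma mulmx_elemxE k (i j : 'I_k) c (A : 'M[F]_k) a b :
  (A *m elemx i j c) a b = A a b + (b == j)%:R * (c * A a i).
Proof.
rewrite /elemx mulmxDr mulmx1 mxE -scalemxAr mxE; congr (_ + _).
rewrite mxE (bigD1 i)//= big1 ?addr0 => [|l /negPf lj]; last by rewrite mxE lj mulr0.
by rewrite mxE eqxx mulrCA [_ * A a i]mulrC mulrCA; case: (b == j); rewrite ?mul1r ?mul0r ?mulr0 ?mulr1 // mulrC.
Qed.

Lemma elemxE k (i j : 'I_k) c a b :
  elemx i j c a b = (a == b)%:R + (a == i)%:R * (b == j)%:R * c.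
Proof. by rewrite !mxE -natrM mulnb mulrC. Qed.

Lemma elemxK k (i j : 'I_k) c : i != j -> elemx i j (- c) *m elemx i j c = 1%:M.
Proof.
move=> ij; apply/matrixP => a b; rewrite elemx_mulE !elemxE !mxE.
rewrite [j == i]eq_sym (negPf ij) [j == b]eq_sym !mulr0n; ring.
Qed.

(** Elementary matrices inside a diagonal block are commutators of off-diagonal ones; this is
    why the two unipotent groups expanded and contracted by the flow generate everything. *)
Lemma elemx_commutator k (i l j : 'I_k) a b : i != l -> l != j -> i != j ->
  elemx i l a *m (elemx l j b *m (elemx i l (- a) *m elemx l j (- b))) = elemx i j (a * b).
Proof.
move=> il lj ij; apply/matrixP => p q; rewrite !elemx_mulE !elemxE.
rewrite !eqxx [l == i]eq_sym (negPf il) [j == l]eq_sym (negPf lj) [j == i]eq_sym (negPf ij).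
rewrite [j == q]eq_sym [l == q]eq_sym !mulr0n mulr1n; ring.
Qed.

Lemma det_elemx k (i j : 'I_k) c : i != j -> \det (elemx i j c) = 1.
Proof.
move=> ij.
have tri (i1 j1 : 'I_k) c1 : (j1 < i1)%N -> \det (elemx i1 j1 c1 : 'M[F]_k) = 1.
  move=> ji; rewrite det_trig.
    rewrite big1// => a _; rewrite elemxE eqxx.
    have [->|_] := eqVneq a i1; rewrite ?mul0r ?addr0//.
    by rewrite -val_eqE /= gtn_eqF// mulr0 mul0r addr0.
  apply/is_trig_mxP => a b ab; rewrite elemxE -!val_eqE /= ltn_eqF//.
  have [ai|] := eqVneq (a : nat) i1; rewrite ?mul0r ?addr0//.
  by rewrite gtn_eqF ?mulr0 ?mul0r ?addr0// (ltn_trans ji)// -ai.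
have [ji|ij'] := ltnP j i; first exact: tri.
rewrite -det_tr (_ : _^T = elemx j i c); first by apply: tri; rewrite ltn_neqAle val_eqE ij ij'.
by apply/matrixP => a b; rewrite mxE !elemxE eq_sym [X in X * c]mulrC.
Qed.

Section generation.

Definition mulclosed k (P : 'M[F]_k -> Prop) :=
  [/\ P 1%:M, forall A B, P A -> P B -> P (A *m B)
    & forall i j c, i != j -> P (elemx i j c)].

(** Elementary matrices being invertible within [P], row operations can be undone. *)
Lemma mulclosed_cancel k0 (P : 'M[F]_k0 -> Prop) i j c A :
  mulclosed P -> i != j -> P (elemx i j c *m A) -> P A.
Proof.
move=> [_ PM PE] ij PA; rewrite -[A]mul1mx -(elemxK c ij) -mulmxA.
by apply: PM => //; exact: PE.
Qed.

Lemma mulclosed_block k0 (P : 'M[F]_(1 + k0) -> Prop) : mulclosed P ->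
  mulclosed (fun B : 'M[F]_k0 => P (block_mx 1%:M 0 0 B)).
Proof.
move=> [P1 PM PE]; split.
- by rewrite -scalar_mx_block.
- move=> A B PA PB; suff -> : block_mx 1%:M 0 0 (A *m B) =
    block_mx 1%:M 0 0 A *m block_mx 1%:M 0 0 B :> 'M[F]_(1 + k0) by exact: PM.
  by rewrite mulmx_block ?(mulmx0, mul0mx, mulmx1, addr0, add0r).
- move=> i j c ij; suff -> : block_mx 1%:M 0 0 (elemx i j c) =
    elemx (rshift 1 i) (rshift 1 j) c :> 'M[F]_(1 + k0).
    by apply: PE; rewrite (inj_eq (@rshift_inj _ _)).
  apply/matrixP => a b; case: (split_ordP a) => a' ->; case: (split_ordP b) => b' ->;
    rewrite ?block_mxEul ?block_mxEur ?block_mxEdl ?block_mxEdr ?elemxE ?mxE;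
    rewrite ?eq_lrshift ?eq_rlshift ?(inj_eq (@lshift_inj _ _)) ?(inj_eq (@rshift_inj _ _)) ?mulr0n ?mul0r ?mulr0 ?addr0 //. by rewrite mul0r addr0.
Qed.

Lemma mulclosed_col k0 (P : 'M[F]_(1 + k0) -> Prop) (v : 'cV_k0) : mulclosed P ->
  P (block_mx 1%:M 0 v 1%:M).
Proof.
move=> [P1 PM PE]; rewrite (matrix_sum_delta v).
apply: (big_ind (fun u : 'cV_k0 => P (block_mx 1%:M 0 u 1%:M))).
- by rewrite -scalar_mx_block.
- move=> A B PA PB; suff -> : block_mx 1%:M 0 (A + B) 1%:M =
    block_mx 1%:M 0 A 1%:M *m block_mx 1%:M 0 B 1%:M :> 'M[F]_(1 + k0) by exact: PM.
  by rewrite mulmx_block ?(mulmx0, mul0mx, mulmx1, mul1mx, addr0, add0r).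
- move=> i _; rewrite big_ord1.
  suff -> : block_mx 1%:M 0 (v i 0 *: delta_mx i 0) 1%:M =
    elemx (rshift 1 i) (lshift k0 0) (v i 0) :> 'M[F]_(1 + k0).
    by apply: PE; rewrite eq_rlshift.
  apply/matrixP => a b; case: (split_ordP a) => a' ->; case: (split_ordP b) => b' ->;
    rewrite ?block_mxEul ?block_mxEur ?block_mxEdl ?block_mxEdr ?elemxE ?mxE ?(inj_eq (@lshift_inj _ _)) ?(inj_eq (@rshift_inj _ _)) ?eq_lrshift ?eq_rlshift ?ord1 ?eqxx ?mulr0n ?mulr1n ?mul0r ?mulr0 ?addr0//; by rewrite ?andbT ?add0r ?mulr1 ?mul0r ?addr0 // mulrC.
Qed.

Lemma mulclosed_row k0 (P : 'M[F]_(1 + k0) -> Prop) (v : 'rV_k0) : mulclosed P ->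
  P (block_mx 1%:M v 0 1%:M).
Proof.
move=> [P1 PM PE].
suff : (fun A => P A^T) (block_mx 1%:M 0 v^T 1%:M : 'M[F]_(1 + k0)).
  by rewrite /= tr_block_mx !trmx1 trmx0 trmxK.
apply: (@mulclosed_col k0 (fun A => P A^T)); split.
- by rewrite trmx1.
- by move=> A B PA PB; rewrite trmx_mul; exact: PM.
- move=> i j c ij; rewrite (_ : (elemx i j c)^T = elemx j i c).
    by apply: PE; rewrite eq_sym.
  by apply/matrixP => a b; rewrite mxE !elemxE eq_sym [X in X * c]mulrC.
Qed.

(** Gaussian elimination by induction on the size: a row operation makes the corner entry 1, block
    elimination splits it off, and the remaining block again has determinant 1. *)
Lemma mulclosed_det1 k0 (P : 'M[F]_k0 -> Prop) A : mulclosed P -> \det A = 1 -> P A.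
Proof.
elim: k0 P A => [|[|k0] IH] P A Pm detA.
- have -> : A = 1%:M by apply/matrixP => -[].
  by case: Pm.
- have -> : A = 1%:M; last by case: Pm.
  by apply/matrixP => i j; rewrite !ord1 mxE -detA det_mx11.
have corner1 (B : 'M[F]_(1 + k0.+1)) : \det B = 1 -> B 0 0 = 1 -> P B.
  move=> detB B00; rewrite -[B]submxK.
  have -> : ulsubmx B = 1%:M.
    by apply/matrixP => i j; rewrite !ord1 !mxE /= -{}B00; congr (B _ _); exact: val_inj.
  set w := ursubmx B; set v := dlsubmx B; set D := drsubmx B.
  have E : block_mx 1%:M w v D = block_mx 1%:M 0 v 1%:M *m
    (block_mx 1%:M 0 0 (D - v *m w) *m block_mx 1%:M w 0 1%:M) :> 'M[F]_(1 + k0.+1).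
    rewrite !mulmx_block ?(mulmx0, mul0mx, mulmx1, mul1mx, addr0, add0r).
    by rewrite addrC subrK.
  case: (Pm) => _ PM _.
  rewrite E; apply: (PM); first exact: mulclosed_col.
  apply: (PM); last exact: mulclosed_row.
  apply: (IH _ (D - v *m w) (mulclosed_block (k0 := k0.+1) Pm)).
  move: detB; rewrite -[B]submxK (_ : ulsubmx B = 1%:M) -/w -/v -/D.
    by rewrite E !det_mulmx !(det_lblock, det_ublock) !det1 !mul1r mulr1.
  by apply/matrixP => i j; rewrite !ord1 !mxE /= -B00; congr (B _ _); exact: val_inj.
have step1 (B : 'M[F]_(1 + k0.+1)) i : \det B = 1 -> i != 0 -> B i 0 != 0 -> P B.
  move=> detB i0 Bi0; apply: (@mulclosed_cancel _ P 0 i ((1 - B 0 0) / B i 0)) => //.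
    by rewrite eq_sym.
  apply: corner1; last by rewrite elemx_mulE eqxx mul1r divfK// addrC subrK.
  by rewrite det_mulmx detB mulr1 det_elemx// eq_sym.
have [/existsP[i /andP[i0 Ai0]]|] := boolP [exists i, (i != 0) && (A i 0 != 0)].
  exact: (step1 A i).
rewrite negb_exists => /forallP A0.
have A00 : A 0 0 != 0.
  apply/eqP => A00; have := oner_neq0 F; rewrite -detA (expand_det_col _ 0) big1 ?eqxx// => i _.
  have [->|i0] := eqVneq i 0; first by rewrite A00 mul0r.
  by have := A0 i; rewrite i0 /= negbK => /eqP ->; rewrite mul0r.
have i10 : (lift 0 0 : 'I_k0.+2) != 0 by [].
apply: (@mulclosed_cancel _ P (lift 0 0) 0 1) => //.
apply: (step1 _ (lift 0 0)) => //; first by rewrite det_mulmx detA mulr1 det_elemx.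
rewrite elemx_mulE eqxx !mul1r.
by have := A0 (lift 0 0); rewrite i10 /= negbK => /eqP ->; rewrite add0r.
Qed.

End generation.

End elementary_matrices.

(** * Isometries of norms, and the conformal block matrices *)

Section norms_on_columns.
Context (R : realType) (k : nat) (N : 'cV[R]_k -> R) (N_norm : is_norm N).
Implicit Types (u v : 'cV[R]_k) (O : 'M[R]_k).

Let ND u v : N (u + v) <= N u + N v. Proof. by case: N_norm. Qed.
Let NZ c u : N (c *: u) = `|c| * N u. Proof. by case: N_norm. Qed.
Let N_eq0 u : N u = 0 -> u = 0. Proof. by case: N_norm => _ _; exact. Qed.

Lemma norm_ge0 u : 0 <= N u.
Proof.
have := ND u (-1 *: u); rewrite NZ normrN normr1 mul1r scaleN1r subrr.
have -> : N 0 = 0 by rewrite -(scale0r (0 : 'cV[R]_k)) NZ normr0 mul0r.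
lra.
Qed.

Lemma norm_upper : exists2 C, 0 < C & forall v, N v <= C * nrm v.
Proof.
exists (1 + \sum_i N (delta_mx i 0)).
  by rewrite ltr_wpDr// sumr_ge0// => i _; exact: norm_ge0.
move=> v; rewrite {1}(matrix_sum_delta v).
apply: (@le_trans _ _ (\sum_i nrm v * N (delta_mx i 0))); last first.
  by rewrite -mulr_sumr mulrC ler_wpM2r ?nrm_ge0// lerDr.
elim/big_ind2 : _ => //.
- by rewrite -(scale0r (0 : 'cV[R]_k)) NZ normr0 mul0r.
- by move=> x1 x2 y1 y2 h1 h2; rewrite (le_trans (ND _ _))// lerD.
- by move=> i _; rewrite big_ord1 NZ ler_wpM2r ?norm_ge0// nrm_entry.
Qed.

Lemma norm_dist u v : `|N u - N v| <= N (u - v).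
Proof.
have h w w' : N w - N w' <= N (w - w') by rewrite lerBlDr -{1}[w](subrK w') ND.
rewrite ler_norml h lerNl opprB.
by rewrite (le_trans (h v u))// -[N (u - v)]mul1r -normr1 -normrN -NZ scaleN1r opprB.
Qed.

(** All norms on a finite-dimensional space are equivalent: the norm is continuous and does not
    vanish on the compact unit sphere of [nrm]. *)
Lemma norm_lower : exists2 c, 0 < c & forall v, c * nrm v <= N v.
Proof.
have [C C0 CN] := norm_upper.
pose S := [set v : 'cV[R]_k | forall i j, `|v i j| <= 1] `&` [set v | nrm v = 1].
have nc : continuous (@nrm R k 1) by exact: continuous_nrm.
have cS : compact S.
  apply: compact_closedI; first exact: compact_box.
  rewrite (_ : mkset _ = @nrm R k 1 @^-1` [set 1])//.
  by apply: closed_comp; [move=> v _; exact: nc|exact: closed_eq].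
have Nc : continuous N.
  move=> v; apply/(cvgrPdist_lt (FF := nbhs_filter v)) => e e0.
  apply/nbhs_nrm; exists (e / C).
    exact: divr_gt0.
  move=> w wv; rewrite (le_lt_trans (norm_dist _ _))// (le_lt_trans (CN _))//.
  by rewrite nrmBC mulrC -ltr_pdivlMr.
have cl : closed (N @` S).
  apply: compact_closed; first exact: norm_hausdorff.
  by apply: continuous_compact => //; exact: continuous_subspaceT.
have : nbhs (0 : R) (~` (N @` S)).
  apply: open_nbhs_nbhs; split; first exact: closed_openC.
  by move=> [v [_ /= v1] /N_eq0 v0]; move: v1; rewrite v0 nrm0; lra.
move=> /nbhs_ballP[d /= d0 dS]; exists d => // v.
have [v0|v0] := eqVneq (nrm v) 0; first by rewrite v0 mulr0 norm_ge0.
have vp : 0 < nrm v by rewrite lt_neqAle eq_sym v0 nrm_ge0.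
rewrite leNgt; apply/negP => Nv.
have := dS (N ((nrm v)^-1 *: v)); rewrite /ball/= sub0r normrN ger0_norm ?norm_ge0//.
rewrite NZ gtr0_norm ?invr_gt0// mulrC ltr_pdivrMr// => /(_ Nv); apply.
exists ((nrm v)^-1 *: v); last by rewrite NZ gtr0_norm ?invr_gt0// mulrC.
have n1 : nrm ((nrm v)^-1 *: v) = 1 by rewrite nrmZ gtr0_norm ?invr_gt0// mulVf.
by split => //= i j; rewrite -n1 nrm_entry.
Qed.

(** Isometry groups of norms are bounded, since each column is the image of a basis vector. *)
Lemma orthogonal_bound : exists B, forall O, orthogonal_group N O -> nrm O <= B.
Proof.
have [C C0 CN] := norm_upper; have [c c0 cN] := norm_lower.
exists (\sum_(j < k) C / c * nrm (delta_mx j 0 : 'cV[R]_k)) => O OO.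
rewrite /nrm exchange_big ler_sum// => j _.
apply: (@le_trans _ _ (nrm (O *m delta_mx j 0 : 'cV[R]_k))).
  rewrite /nrm ler_sum// => i _; rewrite big_ord1 mxE (bigD1 j)//= mxE !eqxx mulr1.
  rewrite big1 ?addr0// => l /negPf lj; by rewrite mxE lj mulr0.
rewrite mulrAC ler_pdivlMr// mulrC (le_trans (cN _))// OO.
exact: CN.
Qed.

Lemma orthogonal1 : orthogonal_group N 1%:M.
Proof. by move=> v; rewrite mul1mx. Qed.

Lemma orthogonalM O O' : orthogonal_group N O -> orthogonal_group N O' ->
  orthogonal_group N (O *m O').
Proof. by move=> NO NO' v; rewrite -mulmxA NO NO'. Qed.

Lemma orthogonalV O : O \in unitmx -> orthogonal_group N O -> orthogonal_group N (invmx O).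
Proof. by move=> uO NO v; rewrite -[LHS]NO mulmxA mulmxV// mul1mx. Qed.

End norms_on_columns.

Section block_subgroup.
Context (R : realType) (m n : nat) (m_gt0 : (0 < m)%N) (n_gt0 : (0 < n)%N).
Context (Nm : 'cV[R]_m -> R) (Nn : 'cV[R]_n -> R).
Context (Nm_norm : is_norm Nm) (Nn_norm : is_norm Nn).
Local Notation G := (SLpm R (m + n)).
Implicit Types (g h v w b : G) (s t : R).

(** An element of the flow at time [t], up to isometries of the two norms.  These elements form a
    group on which [t] is additive, and elements of time zero form a bounded group. *)
Definition conformal t g : Prop := exists O O', [/\ orthogonal_group Nm O,
  orthogonal_group Nn O' &
  SLpm_mx g = block_mx (expR t *: O) 0 0 (expR (- (m%:R * t / n%:R)) *: O')].

Lemma nrm_block m1 m2 n1 n2 (A : 'M[R]_(m1, n1)) (B : 'M[R]_(m1, n2)) (C : 'M[R]_(m2, n1))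
  (D : 'M[R]_(m2, n2)) : nrm (block_mx A B C D) = nrm A + nrm B + nrm C + nrm D.
Proof.
rewrite /nrm big_split_ord/= -addrA -big_split -big_split /=; congr (_ + _);
  apply: eq_bigr => i _; rewrite big_split_ord; congr (_ + _); apply: eq_bigr => j _.
- by rewrite block_mxEul.
- by rewrite block_mxEur.
- by rewrite block_mxEdl.
- by rewrite block_mxEdr.
Qed.

Lemma conformal1 : conformal 0 1%g.
Proof.
exists 1%:M, 1%:M; split; [exact: orthogonal1|exact: orthogonal1|].
by rewrite mulr0 mul0r oppr0 expR0 !scale1r -scalar_mx_block.
Qed.

Lemma conformalM t s g h : conformal t g -> conformal s h -> conformal (t + s) (g * h)%g.
Proof.
move=> [ O [ O' [NO NO' gE]]] [Q [Q' [NQ NQ' hE]]].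
exists (O *m Q), (O' *m Q'); split; [exact: orthogonalM|exact: orthogonalM|].
rewrite SLmulE gE hE mulmx_block !(mulmx0, mul0mx, addr0, add0r).
rewrite -!scalemxAl -!scalemxAr !scalerA -!expRD.
congr (block_mx _ _ _ (expR _ *: _)); ring.
Qed.

Lemma conformalV t g : conformal t g -> conformal (- t) (g^-1)%g.
Proof.
move=> [ O [ O' [NO NO' gE]]].
have : SLpm_mx g \in unitmx by exact: SLpm_unit.
rewrite gE unitmxE det_ublock unitrM -!unitmxE !unitmxZ ?unitfE ?gt_eqF ?expR_gt0//.
move=> /andP[uO uO']; exists (invmx O), (invmx O'); split; [exact: orthogonalV|exact: orthogonalV|].
pose B := block_mx (expR (- t) *: invmx O) 0 0 (expR (- (m%:R * - t / n%:R)) *: invmx O').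
have gB : SLpm_mx g *m B = 1%:M.
  rewrite gE mulmx_block !(mulmx0, mul0mx, addr0, add0r).
  rewrite -!scalemxAl -!scalemxAr !scalerA -!expRD !mulmxV// subrr.
  rewrite (_ : - _ + - _ = 0); last by ring.
  by rewrite expR0 !scale1r -scalar_mx_block.
rewrite -/B -[LHS]mulmx1 -gB mulmxA -SLmulE mulVg SL1E.
by rewrite mul1mx.
Qed.

Lemma conformal_flow t : conformal t (flow m n_gt0 t).
Proof.
exists 1%:M, 1%:M; split; [exact: orthogonal1|exact: orthogonal1|].
by rewrite /= /flow_mx !scalemx1.
Qed.

Lemma conformal_comm t s q : conformal s q -> (flow m n_gt0 t * q = q * flow m n_gt0 t)%g.
Proof.
move=> [ O [ O' [NO NO' qE]]]; apply/val_inj => /=; rewrite qE /flow_mx.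
rewrite !mulmx_block !(mulmx0, mul0mx, addr0, add0r).
by rewrite !mul_scalar_mx !mul_mx_scalar.
Qed.

Lemma conformal_bound : exists2 B, 0 < B &
  forall t g, conformal t g -> nrm g <= B * (expR t + expR (- (m%:R * t / n%:R))).
Proof.
have [B BO] := orthogonal_bound Nm_norm; have [B' BO'] := orthogonal_bound Nn_norm.
exists (`|B| + `|B'| + 1); first by rewrite ltr_wpDl// addr_ge0.
move=> t g [ O [ O' [/BO NO /BO' NO' ->]]].
rewrite nrm_block !nrm0 !addr0 !nrmZ !(gtr0_norm (expR_gt0 _)).
have := normr_ge0 B; have := normr_ge0 B'; have := ler_norm B; have := ler_norm B'.
move=> b1 b2 b3 b4; rewrite mulrDr lerD// mulrC ler_wpM2r ?expR_ge0//; lra.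
Qed.

Lemma conformal_bounded tau : exists2 B, 0 < B &
  forall t g, conformal t g -> `|t| <= tau -> nrm g <= B.
Proof.
have [B B0 BP] := conformal_bound.
exists (B * (expR tau + expR (m%:R * tau / n%:R))).
  by rewrite mulr_gt0// addr_gt0 ?expR_gt0.
move=> t g /BP gB; rewrite ler_norml => /andP[t1 t2].
rewrite (le_trans gB)// ler_pM2l// lerD ?ler_expR//.
by rewrite -mulNr -mulrN ler_wpM2r// ler_wpM2l//; lra.
Qed.

(** The flow commutes with block-diagonal matrices of this form, so conjugation by [h] is
    conjugation by its time-zero part, which ranges over a bounded set.  This is
    where the equality of the expansion rates within each block is used. *)
Lemma conformal_conj : exists2 C, 0 < C & forall t s h q, conformal t h -> conformal s q ->
  sdist (h * q * h^-1)%g 1%g <= C * sdist q 1%g.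
Proof.
have [B B0 BP] := conformal_bounded 0; exists (B * B); first exact: mulr_gt0.
move=> t s h q Hh Hq; pose k := (h * flow m n_gt0 (- t))%g.
have Hk : conformal 0 k.
  by rewrite /k -(subrr t); apply: conformalM => //; exact: conformal_flow.
have flowK : (flow m n_gt0 (- t) * flow m n_gt0 t = 1)%g.
  apply/val_inj => /=; rewrite /flow_mx mulmx_block !(mulmx0, mul0mx, addr0, add0r).
  rewrite -!scalar_mxM -!expRD addNr (_ : - _ + - _ = 0); last by ring.
  by rewrite expR0 -scalar_mx_block.
have -> : (h * q * h^-1)%g = (k * q * k^-1)%g.
  have -> : h = (k * flow m n_gt0 t)%g by rewrite /k -mulgA flowK mulg1.
  rewrite invgM mulgA -[(k * _ * q)%g]mulgA (conformal_comm t Hq) mulgA.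
  by rewrite mulgK.
have := sdist_conj k q; have := BP _ _ Hk; have := BP _ _ (conformalV Hk).
rewrite oppr0 normr0 lexx => /(_ isT) h1 /(_ isT) h2 h3.
rewrite (le_trans h3)// ler_wpM2r ?sdist_ge0// ler_pM ?nrm_ge0//.
Qed.

End block_subgroup.

(** * The Mautner phenomenon *)

Section times.
Context (R : realType) (m n : nat) (m_gt0 : (0 < m)%N) (n_gt0 : (0 < n)%N).
Context (Nm : 'cV[R]_m -> R) (Nn : 'cV[R]_n -> R).
Context (Nm_norm : is_norm Nm) (Nn_norm : is_norm Nn).
Local Notation G := (SLpm R (m + n)).
Implicit Types (g h v w b : G) (s t : R).

Lemma nrm_ulsubmx (A : 'M[R]_(m + n)) : nrm (ulsubmx A) <= nrm A.
Proof.
rewrite -{2}(submxK A) nrm_block -!addrA lerDl !addr_ge0 ?nrm_ge0//.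
Qed.

Lemma ulsubmxB (A B : 'M[R]_(m + n)) : ulsubmx A - ulsubmx B = ulsubmx (A - B).
Proof. by apply/matrixP => i j; rewrite !mxE. Qed.

(** The ratio [rho] is recovered as a continuous function of [e], namely the factor by which the
    first block of [e^-1] stretches a fixed vector.  It takes a compact set of values in the open
    interval from 0 to 1, hence stays away from both ends. *)
Lemma contraction_times (E : set G) : compact E ->
  (forall e, E e -> exists (rho : R) (O : 'M[R]_m) (O' : 'M[R]_n),
      [/\ 0 < rho < 1,
          orthogonal_group Nm O,
          orthogonal_group Nn O' &
          SLpm_mx (e^-1)%g =
            block_mx (rho *: O) 0 0 (rho `^ (- (m%:R / n%:R)) *: O')]) ->
  exists tmin tmax, 0 < tmin /\
    forall e, E e -> exists2 t, tmin <= t <= tmax & conformal Nm Nn t e.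
Proof.
(* any nonzero vector serves to measure the stretching factor; m > 0 is used here *)
move=> cE Eform; pose u : 'cV[R]_m := const_mx 1.
have u0 : Nm u != 0.
  apply/eqP => Nu; case: (Nm_norm) => _ _ /(_ _ Nu)/matrixP/(_ (Ordinal m_gt0) 0).
  by rewrite !mxE; apply/eqP; exact: oner_neq0.
have up : 0 < Nm u by rewrite lt_neqAle eq_sym u0 norm_ge0.
pose phi (e : G) := Nm (ulsubmx (SLpm_mx (e^-1)%g) *m u) / Nm u.
have [C C0 CN] := norm_upper Nm_norm.
have phic : continuous phi.
  move=> e; apply/(cvgrPdist_lt (FF := nbhs_filter (e : G))) => eps eps0.
  apply/nbhs_SL_mul.
  pose K := C * nrm (SLpm_mx (e^-1)%g) * (nrm u + 1) + 1.
  have K0 : 0 < K.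
    by rewrite ltr_wpDl// !mulr_ge0 ?nrm_ge0 ?addr_ge0 ?nrm_ge0// ltW.
  have [d d0 dd] := @sdistV_small R (m + n) _ (divr_gt0 (mulr_gt0 eps0 up) K0).
  exists d => // v /dd; rewrite ltr_pdivlMr// => vd.
  rewrite /phi -mulrBl normrM normfV (gtr0_norm up) ltr_pdivrMr//.
  rewrite (le_lt_trans (norm_dist Nm_norm _ _))// (le_lt_trans _ vd)//.
  rewrite (le_trans (CN _))// -mulmxBl ulsubmxB.
  apply: (@le_trans _ _ (C * (nrm (SLpm_mx (e^-1)%g) * sdist (v^-1)%g 1%g * nrm u))).
    rewrite ler_pM2l// (le_trans (nrmM _ _))// ler_wpM2r ?nrm_ge0//.
    rewrite (le_trans (nrm_ulsubmx _))// nrmBC.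
    rewrite (_ : _ - _ = SLpm_mx (e^-1)%g *m (SLpm_mx (v^-1)%g - SLpm_mx 1%g)) ?nrmM//.
    by rewrite mulmxBr -!SLmulE invgM mulg1.
  have := sdist_ge0 (v^-1)%g 1%g; have := nrm_ge0 (SLpm_mx (e^-1)%g); have := nrm_ge0 u.
  rewrite /K; move: (nrm u) (nrm (SLpm_mx (e^-1)%g)) (sdist _ _) => a b s a0 b0 s0.
  have x0 : 0 <= C * b * s by rewrite !mulr_ge0// ltW.
  rewrite -subr_ge0 (_ : _ - _ = C * b * s + s); last by ring.
  exact: addr_ge0.
have phiE e : E e -> exists rho, [/\ 0 < rho < 1, phi e = rho & conformal Nm Nn (- ln rho) e].
  move=> /Eform[rho [ O [ O' [/andP[r0 r1] NO NO' eE]]]]; exists rho; split; first by rewrite r0.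
    rewrite /phi eE block_mxKul -scalemxAl; case: (Nm_norm) => _ -> _.
    by rewrite NO gtr0_norm// mulfK.
  rewrite -[e]invgK; apply: conformalV => //; exists O, O'; split => //.
  rewrite eE lnK//; congr (block_mx _ _ _ (_ *: _)).
  by rewrite /powR gt_eqF//; congr expR; ring.
have cl : closed (phi @` E).
  apply: compact_closed; first exact: norm_hausdorff.
  by apply: continuous_compact => //; exact: continuous_subspaceT.
have nb x : ~ (phi @` E) x -> exists2 d, 0 < d & forall e, E e -> d <= `|x - phi e|.
  move=> xE; have : nbhs x (~` (phi @` E)).
    by apply: open_nbhs_nbhs; split => //; exact: closed_openC.
  move=> /nbhs_ballP[d /= d0 dS]; exists d => // e Ee.
  by rewrite leNgt; apply/negP => xd; apply: (dS (phi e)) => //; exists e.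
have [d d0 dP] : exists2 d, 0 < d & forall e, E e -> d <= `|0 - phi e|.
  apply: nb => -[e /phiE[rho [/andP[r0 _] -> _]] r]; by rewrite r ltxx in r0.
have [d' d'0 dP'] : exists2 d, 0 < d & forall e, E e -> d <= `|1 - phi e|.
  apply: nb => -[e /phiE[rho [/andP[_ r1] -> _]] r]; by rewrite r ltxx in r1.
(* the cut-off 1 / 2 keeps 1 - D positive, so that its logarithm is defined *)
pose D := Num.min d' (1 / 2); have D0 : 0 < D by rewrite lt_min d'0; lra.
have D1 : D < 1 by rewrite gt_min; apply/orP; right; lra.
exists (- ln (1 - D)), (- ln d); split.
  by rewrite oppr_gt0 ln_lt0//; lra.
move=> e Ee; have := dP _ Ee; have := dP' _ Ee.
have [rho [/andP[r0 r1] -> He]] := phiE _ Ee.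
rewrite sub0r normrN !gtr0_norm ?subr_gt0// => h1 h2.
exists (- ln rho) => //; rewrite !lerN2 !ler_ln ?posrE ?subr_gt0//.
rewrite h2 andbT; have : D <= d' by rewrite ge_min lexx.
lra.
Qed.

(** Think of [I i h] as the L^1 size of [g_i o h - g_i].  If [u] is in the unipotent group expanded
    by [b], then [u = b^N u' b^-N] with [u'] close to 1, so [I i u <= I i u' + 2 N I i b] is small;
    the opposite unipotent group is treated with [b^-N].  Elementary matrices between the two blocks
    are of this type, their commutators give the others, and these generate SL.  The number [N]
    depends only on the lower bound [tmin] of the times, which is what allows [b] to vary with [i]. *)
Lemma mautner (I : nat -> G -> R) (tmin : R) : 0 < tmin ->
  (forall i g h, I i (g * h)%g <= I i g + I i h) ->
  (forall i g, I i (g^-1)%g = I i g) ->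
  (forall e, 0 < e -> exists j, forall i, (j <= i)%N -> forall h, I i h <= I j h + e) ->
  (forall j e, 0 < e -> exists2 d, 0 < d & forall v, sdist v 1%g < d -> I j v < e) ->
  (forall e, 0 < e -> exists j, forall i, (j <= i)%N ->
     exists b t, [/\ tmin <= t, conformal Nm Nn t b & I i b < e]) ->
  forall h, \det (SLpm_mx h) = 1 ->
  forall e, 0 < e -> exists j, forall i, (j <= i)%N -> I i h < e.
Proof.
move=> tmin0 IM IV Icauchy Icont Ib.
pose Z (h : G) := forall e, 0 < e -> exists j, forall i, (j <= i)%N -> I i h < e.
have ZM g h : Z g -> Z h -> Z (g * h)%g.
  move=> Zg Zh e e0; have e2 : 0 < e / 2 by rewrite divr_gt0.
  have [j jP] := Zg _ e2; have [l lP] := Zh _ e2; exists (maxn j l) => i.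
  rewrite geq_max => /andP[/jP ji /lP li].
  by rewrite (le_lt_trans (IM _ _ _))// [ltRHS]splitr ltrD.
have ZV g : Z g -> Z (g^-1)%g.
  by move=> Zg e /Zg[j jP]; exists j => i /jP; rewrite IV.
have Isup (g : G) : (forall d, 0 < d ->
    exists N : nat, forall b t, tmin <= t -> conformal Nm Nn t b ->
      exists w w', [/\ g = (w * w' * w^-1)%g, sdist w' 1%g < d &
        forall i, I i w <= N%:R * I i b]) -> Z g.
  move=> gP e e0; have e3 : 0 < e / 4 by rewrite divr_gt0.
  have [j jP] := Icauchy _ e3; have [d d0 dP] := Icont j _ e3.
  have [N NP] := gP _ d0.
  have e4 : 0 < e / 4 / (N%:R + 1) by rewrite divr_gt0// ltr_wpDl.
  have [l lP] := Ib _ e4; exists (maxn j l) => i; rewrite geq_max => /andP[ji li].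
  have [b [t [tt bt Ibi]]] := lP _ li; have [w [w' [-> w'd /(_ i) wI]]] := NP _ _ tt bt.
  have h1 := IM i (w * w')%g (w^-1)%g; have h2 := IM i w w'.
  have h3 := jP i ji w'; have := dP _ w'd.
  rewrite IV in h1; have : I i w <= e / 4.
    rewrite (le_trans wI)// (@le_trans _ _ (N%:R * (e / 4 / (N%:R + 1))))//.
      by rewrite ler_wpM2l// ltW.
    rewrite mulrCA ler_piMr//; first exact: ltW.
    by rewrite ler_pdivrMr ?ltr_wpDl// mul1r lerDl.
  lra.
have Iexp i b N : I i (b ^+ N)%g <= N%:R * I i b.
  have I1 : I i 1%g <= 0.
    apply/ler_addgt0Pr => e e0; have [d d0 dP] := Icont i _ e0.
    by rewrite add0r; apply/ltW/dP; rewrite sdistxx.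
  elim: N => [|N IH]; first by rewrite expg0 mul0r.
  rewrite expgS (le_trans (IM _ _ _))// -natr1 mulrDl mul1r addrC lerD//.
have exp_conf b t N : conformal Nm Nn t b -> conformal Nm Nn (N%:R * t) (b ^+ N)%g.
  move=> bt; elim: N => [|N IH]; first by rewrite expg0 mul0r; exact: conformal1.
  by rewrite expgS -natr1 mulrDl mul1r addrC; exact: conformalM.
have [Bm BmP] := orthogonal_bound Nm_norm; have [Bn BnP] := orthogonal_bound Nn_norm.
have decay c d : 0 < d -> exists N : nat, forall s t, tmin <= t -> s = N%:R * t ->
    expR (- s) * expR (- (m%:R * s / n%:R)) * c < d.
  (* expR (- N t) <= 1 / (1 + N t), so N t > |c| / d is enough, whatever the size of t >= tmin *)
  move=> d0; exists (Num.bound (`|c| / d / tmin)) => s t tt ->.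
  set N := Num.bound _.
  have Nb : `|c| / d < N%:R * t.
    rewrite (@lt_le_trans _ _ (N%:R * tmin))//; last by rewrite ler_wpM2l.
    rewrite -ltr_pdivrMr// archi_boundP// !divr_ge0//; exact: ltW.
  have t0 : 0 < t by exact: lt_le_trans tt.
  apply: (@le_lt_trans _ _ (expR (- (N%:R * t)) * `|c|)).
    rewrite -mulrA ler_wpM2l ?expR_ge0// (le_trans (ler_norm _))// normrM.
    rewrite ler_piMl// ger0_norm ?expR_ge0// -expR0 ler_expR oppr_le0.
    by rewrite divr_ge0// mulr_ge0// mulr_ge0// ltW.
  rewrite expRN mulrC ltr_pdivrMr ?expR_gt0//.
  rewrite ltr_pdivrMr// in Nb; rewrite (lt_le_trans Nb)// mulrC ler_pM2l//.
  by rewrite (le_trans _ (expR_ge1Dx _))// lerDr.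
have conj1 (U w : G) (D : 'M[R]_(m + n)) : SLpm_mx U = 1%:M + D ->
    sdist (w^-1 * U * w)%g 1%g = nrm (SLpm_mx (w^-1)%g *m D *m SLpm_mx w).
  move=> UE; rewrite /sdist !SLmulE UE mulmxDr mulmx1 mulmxDl -SLmulE mulVg.
  by rewrite SL1E addrC addKr.
have Zelem i j c (U : G) : i != j -> SLpm_mx U = elemx i j c ->
    (i < m)%N != (j < m)%N -> Z U.
  move=> ij UE imjm; apply: Isup => d d0.
  case: (split_ordP i) => i' iE; case: (split_ordP j) => j' jE.
  - by move: imjm; rewrite iE jE /= !ltn_ord.
  - pose D' : 'M[R]_(m, n) := c *: delta_mx i' j'.
    have DE : c *: delta_mx i j = block_mx 0 D' 0 0.
      apply/matrixP => x y; case: (split_ordP x) => x' ->; case: (split_ordP y) => y' ->;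
      rewrite ?block_mxEul ?block_mxEur ?block_mxEdl ?block_mxEdr !mxE iE jE
       ?eq_lrshift ?eq_rlshift ?(inj_eq (@lshift_inj _ _)) ?(inj_eq (@rshift_inj _ _))
       ?andbF ?mulr0 //.
    have [N NP] := decay (Bm * nrm D' * Bn) _ d0; exists N => b t tt bt.
    have bN := exp_conf _ _ N bt; have bV := conformalV bN.
    exists (b ^+ N)%g, ((b ^+ N)^-1 * U * (b ^+ N))%g; split.
    + by rewrite !mulgA mulgV mul1g mulgK.
    + rewrite (conj1 _ _ _ UE) DE.
      case: bN bV => [ O [ O' [NO NO' ->]]] [ Q [ Q' [NQ NQ' ->]]].
      rewrite !mulmx_block !(mulmx0, mul0mx, addr0, add0r) nrm_block !nrm0 addr0 add0r addr0.
      rewrite -!scalemxAl -scalemxAr scalerA nrmZ ger0_norm ?mulr_ge0 ?expR_ge0//.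
      rewrite (le_lt_trans _ (NP _ _ tt erefl))// ler_wpM2l ?mulr_ge0 ?expR_ge0//.
      rewrite (le_trans (nrmM _ _))// ler_pM ?nrm_ge0 ?BnP//.
      by rewrite (le_trans (nrmM _ _))// ler_wpM2r ?nrm_ge0 ?BmP.
    + by move=> k; exact: Iexp.
  - pose D' : 'M[R]_(n, m) := c *: delta_mx i' j'.
    have DE : c *: delta_mx i j = block_mx 0 0 D' 0.
      apply/matrixP => x y; case: (split_ordP x) => x' ->; case: (split_ordP y) => y' ->;
      rewrite ?block_mxEul ?block_mxEur ?block_mxEdl ?block_mxEdr !mxE iE jE
       ?eq_lrshift ?eq_rlshift ?(inj_eq (@lshift_inj _ _)) ?(inj_eq (@rshift_inj _ _))
       ?andbF ?mulr0 //.
    have [N NP] := decay (Bn * nrm D' * Bm) _ d0; exists N => b t tt bt.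
    have bN := exp_conf _ _ N bt; have bV := conformalV bN.
    exists ((b ^+ N)^-1)%g, (((b ^+ N)^-1)^-1 * U * (b ^+ N)^-1)%g; split.
    + by rewrite !mulgA mulgV mul1g mulgK.
    + rewrite (conj1 _ _ _ UE) DE invgK.
      case: bN bV => [ O [ O' [NO NO' ->]]] [ Q [ Q' [NQ NQ' ->]]].
      rewrite !mulmx_block !(mulmx0, mul0mx, addr0, add0r) nrm_block !nrm0 addr0 add0r add0r.
      rewrite -!scalemxAl -scalemxAr scalerA nrmZ ger0_norm ?mulr_ge0 ?expR_ge0//.
      rewrite (le_lt_trans _ (NP _ _ tt erefl))// [X in X * _ <= _]mulrC ler_wpM2l ?mulr_ge0 ?expR_ge0//.
      rewrite (le_trans (nrmM _ _))// ler_pM ?nrm_ge0 ?BmP//.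
      by rewrite (le_trans (nrmM _ _))// ler_wpM2r ?nrm_ge0 ?BnP.
    + by move=> k; rewrite IV; exact: Iexp.
  - by move: imjm; rewrite iE jE /= ![(m + _ < m)%N]ltnNge !leq_addr.
move=> h deth.
suff : (exists2 g : G, SLpm_mx g = SLpm_mx h & Z g) by move=> [g /val_inj ->].
apply: (mulclosed_det1 (P := fun A => exists2 g : G, SLpm_mx g = A & Z g)) => //.
have PM A B : (exists2 g : G, SLpm_mx g = A & Z g) -> (exists2 g : G, SLpm_mx g = B & Z g) ->
    exists2 g : G, SLpm_mx g = A *m B & Z g.
  by move=> [g <- Zg] [g' <- Zg']; exists (g * g')%g => //; exact: ZM.
have Pcross (i j : 'I_(m + n)) c : i != j -> (i < m)%N != (j < m)%N -> exists2 g : G, SLpm_mx g = elemx i j c & Z g.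
  move=> ij imjm; have dE : det_pm1 (elemx i j c) by rewrite /det_pm1 det_elemx// eqxx.
  by exists (MkSLpm dE) => //; exact: (Zelem i j c).
split => //.
  exists 1%g => // e e0; exists 0%N => i _; have [d d0 dP] := Icont i _ e0.
  by apply: dP; rewrite sdistxx.
move=> i j c ij; have [ijm|] := eqVneq (i < m)%N (j < m)%N; last exact: Pcross.
have [l [il lj [il' lj']]] : exists l : 'I_(m + n), [/\ i != l, l != j &
    (i < m)%N != (l < m)%N /\ (l < m)%N != (j < m)%N].
  have [im|im] := ltnP i m.
    have ln : (m + 0 < m + n)%N by rewrite ltn_add2l.
    exists (Ordinal ln); rewrite -!val_eqE /= addn0 ltnn -ijm im; split => //.
      by rewrite ltn_eqF.
    by rewrite gtn_eqF// -ijm.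
  have ln : (0 < m + n)%N by rewrite addn_gt0 m_gt0.
  exists (Ordinal ln); rewrite -!val_eqE /= m_gt0 -ijm ltnNge im; split => //.
    by rewrite gtn_eqF// (leq_trans m_gt0).
  have : (m <= j)%N by rewrite leqNgt -ijm -leqNgt.
  by move=> jm; rewrite ltn_eqF// (leq_trans m_gt0).
(* i and j lie in the same block: pass through an index l of the other block *)
rewrite -[c]mulr1 -(elemx_commutator c 1 il lj ij).
apply: (PM _ _ (Pcross _ _ c il il')); apply: (PM _ _ (Pcross _ _ 1 lj lj')).
apply: (PM _ _ (Pcross _ _ (- c) il il')); exact: (Pcross _ _ (- 1) lj lj').
Qed.

End times.

(** * Null sets for finitely many real coordinates *)

Section countable_unions.
Context d (Z : measurableType d).

Lemma measurable_countable_bigcup (I : countType) (F : I -> set Z) :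
  (forall i, measurable (F i)) -> measurable (\bigcup_i F i).
Proof.
move=> mF; rewrite (_ : \bigcup_i F i =
    \bigcup_n (if choice.unpickle n is Some i then F i else set0)).
  by apply: bigcupT_measurable => n; case: choice.unpickle.
apply/seteqP; split=> z [i _ Fz].
  by exists (choice.pickle i) => //; rewrite choice.pickleK.
by move: Fz; case: choice.unpickle => // j Fz; exists j.
Qed.

End countable_unions.

Section separate_continuity.
Context d d' (Z : measurableType d) (T : measurableType d') (R : realType).

(** Caratheodory's argument: round the parameters [ent i z] down to the grid of mesh [1/n], which
    takes countably many values, and replace [z] by a chosen point [r n q] of its cell.  The
    approximations are measurable and converge pointwise. *)
Lemma measurable_separately (I : finType) (ent : I -> Z -> R) (f : Z * T -> R) :
  (forall i, measurable_fun setT (ent i)) ->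
  (forall z, measurable_fun setT (fun y => f (z, y))) ->
  (forall z y e, 0 < e -> exists2 d, 0 < d &
     forall z', (forall i, `|ent i z' - ent i z| < d) -> `|f (z', y) - f (z, y)| < e) ->
  measurable_fun setT f.
Proof.
move=> ment mf fc.
pose cell (n : nat) z : {ffun I -> int} := [ffun i => Num.floor (n.+1%:R * ent i z)].
pose r n q := xget (point : Z) [set z | cell n z = q].
have flP (x : R) : (Num.floor x)%:~R <= x < (Num.floor x)%:~R + 1.
  by have := real_floor_itv (num_real x); rewrite intrD.
have rE n z : cell n (r n (cell n z)) = cell n z.
  by apply: (@xgetPex _ (point : Z) [set z0 | cell n z0 = cell n z]); exists z.
have mcell n q : measurable [set z | cell n z = q].
  rewrite (_ : [set z | _] = \bigcap_(i in [set: I])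
      ((fun z => n.+1%:R * ent i z) @^-1` `[(q i)%:~R, (q i)%:~R + 1[%classic)).
    apply: fin_bigcap_measurable => // i _.
    rewrite -[X in measurable X]setTI; apply: measurable_funM => //.
  apply/seteqP; split=> z /=.
    by move=> <- i _ /=; rewrite in_itv/= ffunE flP.
  move=> h; apply/ffunP => i; rewrite ffunE; apply: floor_def.
  by have := h i Logic.I; rewrite /= in_itv/= intrD.
pose f_ n (zy : Z * T) := f (r n (cell n zy.1), zy.2).
apply: (@measurable_fun_cvg _ _ _ _ f_).
  move=> n _ B mB; rewrite setTI.
  rewrite (_ : _ @^-1` _ = \bigcup_q ([set z | cell n z = q] `*`
      ((fun y => f (r n q, y)) @^-1` B))).
    apply: measurable_countable_bigcup => q; apply: measurableX => //.
    by rewrite -[X in measurable X]setTI; exact: mf.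
  apply/seteqP; split=> -[z y] /=; first by move=> fB; exists (cell n z).
  by move=> [q _ [/= <-]].
move=> [z y] _; apply/cvgrPdist_lt => e e0; have [dl d0 dP] := fc z y e e0.
near=> n; rewrite distrC /f_ /=; apply: dP => i.
have /ffunP/(_ i) := rE n z; rewrite !ffunE => fl.
have n0 : 0 < n.+1%:R :> R by [].
have h1 := flP (n.+1%:R * ent i z).
have := flP (n.+1%:R * ent i (r n (cell n z))); rewrite fl.
move: h1 => /andP[a1 a2] /andP[b1 b2].
rewrite -(ltr_pM2l n0) -[X in X * `|_|]gtr0_norm// -normrM mulrBr.
apply: (@lt_trans _ _ 1).
  by rewrite ltr_norml; apply/andP; split; lra.
rewrite -ltr_pdivrMr// mul1r.
near: n; exists (Num.bound dl^-1) => // n /= bn.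
rewrite (lt_le_trans (archi_boundP _)) ?invr_ge0 1?ltW// ltr_nat ltnS.
Unshelve. all: by end_near. Qed.

End separate_continuity.

Section null_sections.
Context d d' (T : measurableType d) (T' : measurableType d') (R : realType).
Variables (m : {sigma_finite_measure set T -> \bar R}) (m' : {sigma_finite_measure set T' -> \bar R}).

(** Tonelli: both iterated integrals compute the product measure of [B]. *)
Lemma null_sections_swap (B : set (T * T')) : measurable B ->
  {ae m', forall s, m (ysection B s) = 0%E} -> {ae m, forall y, m' (xsection B y) = 0%E}.
Proof.
move=> mB ms.
have m1 : measurable_fun setT (m' \o xsection B) by exact: measurable_fun_xsection.
have m2 : measurable_fun setT (m \o ysection B) by exact: measurable_fun_ysection.
have : (\int[m]_y `|(m' \o xsection B) y| = 0)%E.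
  transitivity ((m \x m')%E B).
    by apply: eq_integral => y _; rewrite gee0_abs.
  rewrite (@product_measure_unique _ _ _ _ _ m m' (m \x^ m')%E)//; last first.
    by move=> A1 A2 mA1 mA2 /=; rewrite product_measure2E.
  transitivity (\int[m']_y `|(m \o ysection B) y|)%E.
    by apply: eq_integral => y _; rewrite gee0_abs.
  apply/ae_eq_integral_abs => //.
  by apply: filterS ms => s /= ->.
move/ae_eq_integral_abs => /(_ measurableT m1).
by apply: filterS => y /= /(_ I).
Qed.

End null_sections.

Section generic_points.
Context (R : realType) (I : finType).
Local Notation leb := (@lebesgue_measure R).

#[local] Instance leb_ae_filter : Filter (almost_everywhere leb).
Proof. exact: ae_filter_ringOfSetsType. Qed.

(** Only the measurable structure of the product of finitely many real lines is needed.  Almost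
    every point is expressed by iterating the quantifier for almost every real number over the
    coordinates, which avoids Lebesgue measure in higher dimension. *)
Definition coord_sets : set (set (I -> R)) :=
  [set C | exists i (B : set (measurableTypeR R)), measurable B /\ C = [set a | B (a i)]].
Definition coordR := g_sigma_algebraType coord_sets.

Lemma measurable_coord i : measurable_fun setT (fun a : coordR => a i : measurableTypeR R).
Proof.
by move=> _ B mB; rewrite setTI; apply: sub_sigma_algebra; exists i, B.
Qed.

Definition upd (a : I -> R) (p : I) (s : R) : I -> R := fun q => if q == p then s else a q.

(** The coordinate [p] of [a] is quantified away; the parameter [y] is carried along so that
    measurability in both can be stated. *)
Definition aecoord T (p : I) (S : T -> (I -> R) -> Prop) : T -> (I -> R) -> Prop :=
  fun y a => {ae leb, forall s, S y (upd a p s)}.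

Lemma lebesgue_translate (c : R) (A : set (measurableTypeR R)) :
  measurable A -> leb A = leb ((fun x => x + c) @^-1` A).
Proof.
move=> mA.
have mc : measurable_fun setT (fun x : measurableTypeR R => x + c : measurableTypeR R).
  exact: measurable_funD.
pose pf := measure_function_pushforward__canonical__measure_function_Measure leb mc.
apply: (@lebesgue_measure_unique R pf) => // _ [[a b]] _ <-.
rewrite /= /pushforward.
rewrite (_ : _ @^-1` _ = `](a - c), (b - c)]%classic).
  rewrite !lebesgue_measure_itv/= !lte_fin ltrD2r -!EFinB.
  by congr (if _ then _%:E else _); ring.
by apply/seteqP; split=> x /=; rewrite !in_itv/= ltrBlDr lerBrDr.
Qed.

Lemma ae_translate (c : R) (P : R -> Prop) :
  {ae leb, forall s, P s} -> {ae leb, forall s, P (s + c)}.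
Proof.
move=> [N [mN N0 PN]]; exists ((fun x => x + c) @^-1` N); split.
- rewrite -[X in measurable X]setTI.
  have mc : measurable_fun setT (fun x : measurableTypeR R => x + c : measurableTypeR R).
    exact: measurable_funD.
  exact: mc.
- by rewrite -lebesgue_translate.
- by move=> x /= nP; apply: PN.
Qed.

Section param.
Context d (T : measurableType d).
Implicit Types S : T -> (I -> R) -> Prop.

Definition mpred S := measurable [set z : T * coordR | S z.1 z.2].

Let updf p (z : (T * coordR) * measurableTypeR R) : T * coordR :=
  (z.1.1, upd z.1.2 p z.2).

Let measurable_updf p : measurable_fun setT (updf p).
Proof.
apply: measurable_fun_pair => /=; first exact: measurableT_comp.
apply: (@measurability _ _ _ coordR setT _ coord_sets) => //.
move=> _ [_ [i [B [mB ->]]] <-]; rewrite setTI.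
have [->|ip] := eqVneq i p.
  rewrite (_ : _ @^-1` _ = snd @^-1` B).
    by rewrite -[X in measurable X]setTI; exact: measurable_snd.
  by apply/seteqP; split=> z /=; rewrite /upd eqxx.
rewrite (_ : _ @^-1` _ = (fun z : (T * coordR) * measurableTypeR R => z.1.2 i) @^-1` B).
  rewrite -[X in measurable X]setTI.
  have mz : measurable_fun setT (fun z : (T * coordR) * measurableTypeR R => z.1.2 i : measurableTypeR R).
    have m12 := measurableT_comp (@measurable_snd _ _ T coordR)
      (@measurable_fst _ _ (T * coordR)%type (measurableTypeR R)).
    exact: (measurableT_comp (measurable_coord i) m12).
  exact: mz.
by apply/seteqP; split=> z /=; rewrite /upd (negPf ip).
Qed.

Let bad p S : set ((T * coordR) * measurableTypeR R) :=
  updf p @^-1` ~` [set z | S z.1 z.2].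

Let measurable_bad p S : mpred S -> measurable (bad p S).
Proof.
move=> mS; rewrite -[X in measurable X]setTI; apply: measurable_updf => //.
exact: measurableC.
Qed.

Let aecoordE p S : mpred S -> forall z,
  aecoord p S z.1 z.2 <-> leb (xsection (bad p S) z) = 0%E.
Proof.
move=> mS z.
have mx : measurable (xsection (bad p S) z).
  by apply: measurable_xsection; exact: measurable_bad.
rewrite -(negligibleP _ mx); rewrite /aecoord /almost_everywhere.
have <- : ~` [set s | S z.1 (upd z.2 p s)] = xsection (bad p S) z; last by [].
by apply/seteqP; split=> s; rewrite xsectionP.
Qed.

Lemma mpred_aecoord p S : mpred S -> mpred (aecoord p S).
Proof.
move=> mS; rewrite /mpred.
rewrite (_ : [set z | _] = (leb \o xsection (bad p S)) @^-1` [set 0%E]).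
  rewrite -[X in measurable X]setTI.
  apply: measurable_fun_xsection => //; exact: measurable_bad.
by apply/seteqP; split=> z /=; [move/(aecoordE _ mS)|move=> h; exact/(aecoordE _ mS)].
Qed.

(** A property of [y] and [a] that holds for each [a] at almost every [y] holds at almost every [y]
    for almost every value of a coordinate of [a]. *)
Lemma aecoord_fubini (mu : probability T R) p S : mpred S ->
  (forall a, {ae mu, forall y, S y a}) -> forall a, {ae mu, forall y, aecoord p S y a}.
Proof.
move=> mS aS a.
pose B : set (T * measurableTypeR R) := [set ys | ~ S ys.1 (upd a p ys.2)].
have mB : measurable B.
  rewrite (_ : B = (fun ys : T * measurableTypeR R => ((ys.1, a), ys.2)) @^-1` bad p S)//.
  rewrite -[X in measurable X]setTI.
  have mm : measurable_fun setT (fun ys : T * measurableTypeR R => ((ys.1, a : coordR), ys.2)).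
    apply: measurable_fun_pair => //=; apply: measurable_fun_pair => //.
  by apply: mm => //; exact: measurable_bad.
have h : {ae leb, forall s, mu (ysection B s) = 0%E}.
  apply: aeW => s; have [N [mN N0 NP]] := aS (upd a p s).
  apply: (subset_measure0 _ _ _ N0) => //; first exact: measurable_ysection.
  by move=> y; rewrite ysectionP => By; exact: NP.
apply: filterS (null_sections_swap mB h) => y yB.
exists (xsection B y); split => //; first exact: measurable_xsection.
by move=> s; rewrite xsectionP.
Qed.

Lemma updC (a : I -> R) p q s t : p != q -> upd (upd a p s) q t = upd (upd a q t) p s.
Proof.
move=> pq; apply/funext => i; rewrite /upd.
by have [->|//] := eqVneq i q; rewrite eq_sym (negPf pq).
Qed.

Lemma aecoordC p q S : p != q -> mpred S ->
  aecoord p (aecoord q S) = aecoord q (aecoord p S).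
Proof.
move=> pq mS; suff h p' q' : p' != q' -> forall y a,
    aecoord p' (aecoord q' S) y a -> aecoord q' (aecoord p' S) y a.
  by apply/funext => y; apply/funext => a; apply/propext; split; apply: h; rewrite // eq_sym.
move=> {}pq y a ha.
pose B : set (measurableTypeR R * measurableTypeR R) :=
  [set ts | ~ S y (upd (upd a p' ts.2) q' ts.1)].
have mB : measurable B.
  rewrite (_ : B = (fun ts : measurableTypeR R * measurableTypeR R =>
      (updf p' ((y, a : coordR), ts.2), ts.1)) @^-1` bad q' S)//.
  rewrite -[X in measurable X]setTI.
  have m1 : measurable_fun setT (fun ts : measurableTypeR R * measurableTypeR R =>
      updf p' ((y, a : coordR), ts.2)).
    apply: (measurableT_comp (measurable_updf p')).
    by apply: measurable_fun_pair.
  have m2 : measurable_fun setT (fun ts : measurableTypeR R * measurableTypeR R =>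
      (updf p' ((y, a : coordR), ts.2), ts.1)) by exact: measurable_fun_pair.
  by apply: m2 => //; exact: measurable_bad.
have h : {ae leb, forall s, leb (ysection B s) = 0%E}.
  apply: filterS (ha : {ae leb, forall s, aecoord q' S y (upd a p' s)}) => s [N [mN N0 NP]].
  apply: (subset_measure0 _ _ _ N0) => //; first exact: measurable_ysection.
  by move=> t; rewrite ysectionP => Bt; exact: NP.
apply: filterS (null_sections_swap mB h) => t tB.
exists (xsection B t); split => //; first exact: measurable_xsection.
by move=> s; rewrite xsectionP /B /= (updC a s t pq).
Qed.

Definition aecoords (l : seq I) S := foldr (@aecoord T) S l.

Lemma mpred_aecoords l S : mpred S -> mpred (aecoords l S).
Proof. by move=> mS; elim: l => //= p l; exact: mpred_aecoord. Qed.

Lemma aecoords_move l j S : j \notin l -> mpred S ->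
  aecoord j (aecoords l S) = aecoords l (aecoord j S).
Proof.
move=> + mS; elim: l => //= p l IH; rewrite inE negb_or => /andP[jp jl].
by rewrite aecoordC//; [rewrite IH|exact: mpred_aecoords].
Qed.

Lemma aecoords_rem l j S : uniq l -> j \in l -> mpred S ->
  aecoords l S = aecoords (rem j l) (aecoord j S).
Proof.
move=> + + mS; elim: l => //= p l IH /andP[pl ul]; rewrite inE eq_sym.
have [pj _|pj /= jl] := eqVneq p j; last by rewrite IH.
by rewrite -pj aecoords_move.
Qed.

Definition shear (c : R) (q p : I) (a : I -> R) := upd a p (a p + c * a q).

Lemma mpred_shear c q p S : mpred S -> mpred (fun y a => S y (shear c q p a)).
Proof.
move=> mS; rewrite /mpred.
have m1 : measurable_fun setT (fun z : T * coordR => (z, z.2 p + c * z.2 q : measurableTypeR R)).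
  apply: measurable_fun_pair => //; apply: measurable_funD.
    exact: (measurableT_comp (measurable_coord p) (@measurable_snd _ _ T coordR)).
  apply: measurable_funM => //.
  exact: (measurableT_comp (measurable_coord q) (@measurable_snd _ _ T coordR)).
have m2 := measurableT_comp (measurable_updf p) m1.
by rewrite -[X in measurable X]setTI; exact: (m2 measurableT _ mS).
Qed.

Lemma aecoord_shear c q p S : q != p ->
  aecoord p (fun y a => S y (shear c q p a)) = aecoord p S.
Proof.
move=> qp; apply/funext => y; apply/funext => a; apply/propext.
have E s : shear c q p (upd a p s) = upd a p (s + c * a q).
  apply/funext => i; rewrite /shear /upd eqxx (negPf qp).
  by case: (i == p).
rewrite /aecoord; split=> h.
  pose P s := S y (shear c q p (upd a p s)).
  apply: filterS (ae_translate (P := P) (- (c * a q)) h) => s.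
  by rewrite /P E subrK.
pose P s := S y (upd a p s).
by apply: filterS (ae_translate (P := P) (c * a q) h) => s; rewrite E.
Qed.

(** A shear is a translation in one coordinate with the others fixed; that coordinate can be
    quantified first, and Lebesgue measure is translation invariant. *)
Lemma aecoords_shear l c q p S : uniq l -> p \in l -> q != p -> mpred S ->
  aecoords l (fun y a => S y (shear c q p a)) = aecoords l S.
Proof.
move=> ul pl qp mS.
rewrite (aecoords_rem ul pl (mpred_shear c q p mS)) aecoord_shear//.
by rewrite -aecoords_rem.
Qed.

Lemma aecoords_cst l S y y' a :
  aecoords l S y a = aecoords l (fun _ => S y) y' a.
Proof.
elim: l a => //= p l IH a.
have E : aecoords l S y = aecoords l (fun _ => S y) y' by apply/funext.
exact: (congr1 (fun P : (I -> R) -> Prop => {ae leb, forall s, P (upd a p s)}) E).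
Qed.

Lemma aecoordsI l S S' y a : aecoords l S y a -> aecoords l S' y a ->
  aecoords l (fun y a => S y a /\ S' y a) y a.
Proof.
elim: l a => //= p l IH a h h'.
rewrite /aecoord.
apply: filterS2 (h : {ae leb, forall s, aecoords l S y (upd a p s)})
  (h' : {ae leb, forall s, aecoords l S' y (upd a p s)}) => s.
exact: IH.
Qed.

(** Intervals have positive measure, so a property true almost everywhere is true arbitrarily close
    to any given point. *)
Lemma ae_near (P : R -> Prop) (t e : R) : 0 < e -> {ae leb, forall s, P s} ->
  exists2 s, P s & `|s - t| < e.
Proof.
move=> e0 [N [mN N0 NP]]; apply: contrapT => nP.
pose J : set R := [set` `](t - e), (t + e)[].
have : (leb J <= leb N)%E.
  apply: le_measure; rewrite ?inE//; first exact: measurable_itv.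
  rewrite /J => s /=; rewrite in_itv/= => /andP[s1 s2]; apply: NP => Ps; apply: nP.
  by exists s => //; rewrite ltr_norml; apply/andP; split; lra.
have te : t - e < t + e by lra.
rewrite /J [X in (_ <= X)%E]N0 lebesgue_measure_itv/= lte_fin te -EFinB lee_fin; lra.
Qed.

Lemma aecoords_near l S y a (t : I -> R) e : 0 < e -> aecoords l S y a ->
  exists a', [/\ S y a', forall p, p \in l -> `|a' p - t p| < e
    & forall p, p \notin l -> a' p = a p].
Proof.
move=> e0; elim: l a => [|p l IH] a /=; first by move=> Sa; exists a.
move=> /(ae_near (t p) e0)[s /IH[a' [Sa' a'l a'nl]] st].
exists a'; split => // q; rewrite inE.
  have [ql _|ql] := boolP (q \in l); first exact: a'l.
  by rewrite orbF => /eqP qp; rewrite a'nl// /upd qp eqxx.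
by rewrite negb_or => /andP[qp ql]; rewrite a'nl// /upd (negPf qp).
Qed.

Lemma aecoords_fubini (mu : probability T R) l S : mpred S ->
  (forall a, {ae mu, forall y, S y a}) -> forall a, {ae mu, forall y, aecoords l S y a}.
Proof.
move=> mS aS; elim: l => //= p l IH; apply: aecoord_fubini => //.
exact: mpred_aecoords.
Qed.

End param.
End generic_points.

(** * Almost invariant sequences are almost constant *)

Section matrix_coordinates.
Context (R : realType) (k : nat).
Local Notation G := (SLpm R k).
Local Notation I := ('I_k * 'I_k)%type.
Implicit Types (a : I -> R) (A : 'M[R]_k).

Definition mxof a : 'M[R]_k := \matrix_(i, j) a (i, j).

(** Adding a multiple of column [i] to column [j] is a composition of shears, one for each row. *)
Lemma mxof_elemx (i j : 'I_k) c : i != j ->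
  exists s : (I -> R) -> I -> R, (forall a, mxof (s a) = mxof a *m elemx i j c) /\
  forall d (T : measurableType d) l (S : T -> (I -> R) -> Prop), uniq l ->
    (forall p, p \in l) -> mpred S ->
    mpred (fun y a => S y (s a)) /\ aecoords l (fun y a => S y (s a)) = aecoords l S.
Proof.
move=> ij; pose sh (x : 'I_k) := shear c (x, i) (x, j).
pose s (r : seq 'I_k) a := foldr (fun x => sh x) a r.
exists (s (enum 'I_k)); split.
  move=> a; apply/matrixP => x y; rewrite mulmx_elemxE !mxE.
  have sE r : uniq r -> s r a (x, y) =
      a (x, y) + ((x \in r) && (y == j))%:R * (c * a (x, i)).
    have si r0 : s r0 a (x, i) = a (x, i).
      elim: r0 => //= z r0 IH; rewrite /sh /shear /upd IH.
      by have [[_ /eqP]|//] := eqVneq (x, i) (z, j); rewrite (negPf ij).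
    elim: r => [|z r IH] /=; first by rewrite mul0r addr0.
    move=> /andP[zr ur]; rewrite {1}/sh /shear /upd.
    have [[xz yj]|ne] := eqVneq (x, y) (z, j).
      rewrite -xz -yj si IH// xz (negPf zr) yj eqxx inE eqxx /=.
      by rewrite mul0r addr0 mul1r -yj -xz.
    rewrite IH// inE; have [xz|//] := eqVneq x z; rewrite xz (negPf zr) /=.
    have [yj|//] := eqVneq y j.
    by rewrite xz yj eqxx in ne.
  by rewrite sE ?enum_uniq// mem_enum.
move=> d T l S ul pl mS.
elim: (enum 'I_k) S mS => [|z r IH] S mS //=.
have mS' := mpred_shear c (z, i) (z, j) mS.
have [m' e'] := IH _ mS'; split => //.
rewrite e' aecoords_shear//.
by apply: contraNN ij => /eqP[->].
Qed.

(** Right translation by SL preserves null sets of matrices: it suffices to check elementary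
    matrices.  This substitutes for the invariance of Haar measure. *)
Lemma aecoords_mulmx (h : 'M[R]_k) d (T : measurableType d) l (S : T -> 'M[R]_k -> Prop) :
  \det h = 1 -> uniq l -> (forall p, p \in l) -> mpred (fun y a => S y (mxof a)) ->
  aecoords l (fun y a => S y (mxof a *m h)) = aecoords l (fun y a => S y (mxof a)).
Proof.
move=> deth ul pl.
pose P (h : 'M[R]_k) := forall S : T -> 'M[R]_k -> Prop, mpred (fun y a => S y (mxof a)) ->
    mpred (fun y a => S y (mxof a *m h)) /\
    aecoords l (fun y a => S y (mxof a *m h)) = aecoords l (fun y a => S y (mxof a)).
suff : P h by move=> H /H[].
apply: mulclosed_det1 deth; split.
- move=> {}S mS; under eq_fun do under eq_fun do rewrite mulmx1.
  by split.
- move=> A B HA HB {}S mS.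
  have [mB eB] := HB _ mS; have [mA eA] := HA (fun y A' => S y (A' *m B)) mB.
  under eq_fun do under eq_fun do rewrite mulmxA.
  by split => //; rewrite eA.
- move=> i j c ij {}S mS; have [s [sE sP]] := mxof_elemx c ij.
  have [m1 e1] := sP _ _ l _ ul pl mS.
  suff -> : (fun y a => S y (mxof a *m elemx i j c)) = (fun y a => S y (mxof (s a))) by [].
  by apply/funext => y; apply/funext => a; rewrite sE.
Qed.

End matrix_coordinates.
Section normalization.
Context (R : realType) (k : nat) (i0 : 'I_k).
Local Notation G := (SLpm R k).
Implicit Types (A B h : 'M[R]_k).

(** Dividing row [i0] by the determinant retracts invertible matrices onto SL, equivariantly for
    right translations by SL; matrices thus parametrize SL up to null sets. *)
Definition rowscale A : 'M[R]_k :=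
  diag_mx (\row_i (if i == i0 then (\det A)^-1 else 1)) *m A.

Lemma det_rowscale A : \det A != 0 -> det_pm1 (rowscale A).
Proof.
move=> A0; rewrite /det_pm1 det_mulmx det_diag (bigD1 i0)//= mxE eqxx.
rewrite big1 => [|i /negPf ii0]; last by rewrite mxE ii0.
by rewrite mulr1 mulVf// eqxx.
Qed.

Definition normal A : G := insubd (1%g : G) (rowscale A).

Lemma normalE A : \det A != 0 -> SLpm_mx (normal A) = rowscale A.
Proof. by move=> /det_rowscale A0; rewrite /normal val_insubd A0. Qed.

Lemma det_normal A : \det A != 0 -> \det (SLpm_mx (normal A)) = 1.
Proof.
move=> A0; rewrite normalE// det_mulmx det_diag (bigD1 i0)//= mxE eqxx.
rewrite big1 => [|i /negPf ii0]; last by rewrite mxE ii0.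
by rewrite mulr1 mulVf.
Qed.

Lemma normalM A (h : G) : \det A != 0 -> \det (SLpm_mx h) = 1 ->
  normal (A *m SLpm_mx h) = (normal A * h)%g.
Proof.
move=> A0 h1; apply/val_inj => /=.
rewrite !normalE ?det_mulmx ?h1 ?mulr1// /rowscale mulmxA.
by rewrite det_mulmx h1 mulr1.
Qed.

Lemma near_entries p q T (F : set_system T) (f : T -> 'M[R]_(p, q)) (A : 'M[R]_(p, q)) e :
  Filter F -> 0 < e -> (forall i j, f t i j @[t --> F] --> A i j) ->
  \forall t \near F, nrm (f t - A) < e.
Proof.
move=> FF e0 fA.
have e1 : 0 < e / (p * q).+1%:R by rewrite divr_gt0.
have : \forall t \near F, forall i j, `|A i j - f t i j| < e / (p * q).+1%:R.
  apply: filter_forall => i; apply: filter_forall => j.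
  by have /cvgrPdist_lt/(_ _ e1) := fA i j.
apply: filterS => t tA; apply: nrm_lt => // i j; rewrite !mxE distrC ltW//.
Qed.

Lemma normal_continuous A e : \det A != 0 -> 0 < e ->
  \forall B \near A, \det B != 0 /\ sdist (normal B) (normal A) < e.
Proof.
move=> A0 e0.
have detA : \det B @[B --> A] --> \det A by exact: continuous_det.
have B0 : \forall B \near A, \det B != 0 by exact: cvgr_neq0 detA A0.
have n1 : \forall B \near A, nrm (rowscale B - rowscale A) < e.
  apply: (near_entries (f := fun B => rowscale B) (nbhs_filter A) e0) => i j.
  have E (C : 'M[R]_k) : rowscale C i j = (if i == i0 then (\det C)^-1 else 1) * C i j.
    by rewrite /rowscale mul_diag_mx !mxE.
  under eq_fun do rewrite E; rewrite E; apply: cvgM; last exact: coord_continuous.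
  by case: (i == i0); [exact: cvgV|exact: cvg_cst].
by apply: filterS2 B0 n1 => B B0; rewrite /sdist !normalE.
Qed.

End normalization.

Section ergodicity_const.
Context (R : realType) (k : nat) (k_gt0 : (0 < k)%N).
Local Notation G := (SLpm R k).
Local Notation X := (SLquo R k).
Local Notation pi := (\pi_(SLquo R k)).
Local Notation I := ('I_k * 'I_k)%type.

Let cvg_normM T (F : set_system T) (FF : Filter F) (u v : T -> R) a b c :
  u t @[t --> F] --> a -> v t @[t --> F] --> b ->
  `|u t| * `|v t - c| @[t --> F] --> `|a| * `|b - c|.
Proof.
move=> ua vb; apply: cvgM; apply: cvg_norm => //.
by apply: cvgB => //; exact: cvg_cst.
Qed.

(** The group acts transitively by definition, and a matrix of determinant -1 can be corrected by an
    integral reflection, which fixes the base coset. *)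
Lemma transitive_det1 (y y' : X) : exists2 h : G, \det (SLpm_mx h) = 1 & y' = act h y.
Proof.
have [g <-] := piP y; have [g' <-] := piP y'.
have [dh|dh] := orP (SLpm_det (g' * g^-1)%g).
  by exists (g' * g^-1)%g; [exact/eqP|rewrite act_pi mulgVK].
pose D (A : comUnitRingType) : 'M[A]_k := diag_mx (\row_i (if i == Ordinal k_gt0 then -1 else 1)).
have detD A : \det (D A) = -1.
  rewrite det_diag (bigD1 (Ordinal k_gt0))//= mxE eqxx big1 ?mulr1// => i /negPf ii0.
  by rewrite mxE ii0.
have pD A : det_pm1 (D A) by rewrite /det_pm1 detD eqxx orbT.
pose r := SLpm_of_int R (MkSLpm (pD int)).
have rE : SLpm_mx r = D R.
  apply/matrixP => i j; rewrite !mxE; case: (i == j); last by rewrite !mulr0n.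
  by rewrite !mulr1n; case: (_ == _).
have piE : pi (g' * r)%g = pi g'.
  apply/eqmodP => /=; rewrite /coset_rel; apply/asboolP.
  exists ((MkSLpm (pD int))^-1)%g => //.
  by rewrite SLpm_of_intV invgM mulgVK.
exists (g' * r * g^-1)%g; last by rewrite act_pi mulgVK piE.
have : \det (SLpm_mx (g' * g^-1)%g) = -1 by exact/eqP.
rewrite !SLmulE !det_mulmx rE detD => h; rewrite mulrAC h; ring.
Qed.

(** For each [h] the relation [g_i (h y) - g_i y -> 0] holds for almost every [y]; by Fubini it holds
    at almost every [y] for almost every matrix [A], through its normalization [normal A].  Fix such
    a point [y0], and let [y = h y0] be another one.  Since right translation by [h] preserves null
    sets, some [A] is good for [y], while [A h] is good for [y0]; both express the value at the common point
    [normal A * y], and comparison gives [g_i y - g_i y0 -> 0].  The factor [det A] makes the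
    compared function continuous in [A] also at singular matrices. *)
Lemma almost_invariant_const (mu : probability (borel X) R) (g_ : nat -> X -> R) M :
  act_invariant mu -> (forall i, testf (g_ i)) -> (forall i y, `|g_ i y| <= M) ->
  (forall h : G, \det (SLpm_mx h) = 1 ->
     {ae mu, forall y : borel X, g_ i (act h y) - g_ i y @[i --> \oo] --> (0 : R)}) ->
  exists y0, {ae mu, forall y : borel X, g_ i y - g_ i y0 @[i --> \oo] --> (0 : R)}.
Proof.
move=> minv tg gM inv; pose i0 := Ordinal k_gt0.
pose F (i : nat) (z : coordR R I * borel X) : R :=
  `|\det (mxof z.1)| * `|g_ i (act (normal i0 (mxof z.1)) z.2) - g_ i z.2|.
have F0 i z : 0 <= F i z by rewrite mulr_ge0.
have mF i : measurable_fun setT (F i).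
  apply: (@measurable_separately _ _ (coordR R I) (borel X) R I (fun p (a : coordR R I) => a p) (F i)).
  - by move=> p; exact: measurable_coord.
  - move=> a; rewrite /F /=; apply: measurable_funM => //; apply: measurableT_comp => //.
    apply: measurable_funB; last by case: (bmeas_testf (tg i)).
    by case: (bmeas_testf (testf_act (normal i0 (mxof a)) (tg i))).
  move=> a y e e0; rewrite /F /=; set A := mxof a.
  have : \forall B \near A, `| `|\det B| * `|g_ i (act (normal i0 B) y) - g_ i y|
      - `|\det A| * `|g_ i (act (normal i0 A) y) - g_ i y| | < e.
    have [A0|A0] := eqVneq (\det A) 0.
      rewrite A0 normr0 mul0r.
      have M0 : 0 <= M by exact: le_trans (gM i y).
      have e1 : 0 < e / (2 * M + 1) by rewrite divr_gt0//; lra.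
      have /(cvgrPdist_lt (FF := nbhs_filter A))/(_ _ e1) := @continuous_det R k A.
      apply: filterS => B; rewrite A0 sub0r normrN ltr_pdivlMr; last by lra.
      move=> dB; rewrite subr0 ger0_norm ?mulr_ge0// (le_lt_trans _ dB)//.
      rewrite ler_wpM2l// (le_trans (ler_normB _ _))//.
      by have := gM i (act (normal i0 B) y); have := gM i y; lra.
    have detA : \det B @[B --> A] --> \det A by exact: continuous_det.
    suff : `|\det B| * `|g_ i (act (normal i0 B) y) - g_ i y| @[B --> A] -->
      `|\det A| * `|g_ i (act (normal i0 A) y) - g_ i y|.
      move=> /(cvgrPdist_lt (FF := nbhs_filter A))/(_ _ e0).
      by apply: filterS => B; rewrite distrC.
    apply: (@cvg_normM _ (nbhs A) (nbhs_filter A) _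
      (fun B => g_ i (act (normal i0 B) y)) _ _ (g_ i y) detA).
    apply/(cvgrPdist_lt (FF := nbhs_filter A)) => e1 e10.
    have := (continuous_actP _).1 (testf_continuous (tg i)) (act (normal i0 A) y) _ e10.
    move=> [d d0 dP]; pose N := nrm (SLpm_mx (normal i0 A)^-1%g) + 1.
    have N0 : 0 < N by rewrite ltr_wpDl// nrm_ge0.
    apply: filterS (normal_continuous i0 A0 (divr_gt0 d0 N0)) => B [B0 BA].
    rewrite distrC -{1}(mulgVK (normal i0 A) (normal i0 B)) actM; apply: dP.
    rewrite -(mulgV (normal i0 A)) (le_lt_trans (sdistMr _ _ _))//.
    rewrite ltr_pdivlMr// in BA; rewrite (le_lt_trans _ BA)// ler_wpM2l ?sdist_ge0//.
    by rewrite lerDl.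
  move=> /nbhs_nrm[d d0 dP]; exists (d / (k * k).+1%:R); first by rewrite divr_gt0.
  move=> a' aa'; apply: dP; apply: nrm_lt => // x z; rewrite !mxE.
  exact/ltW/aa'.
pose S (y : borel X) (A : 'M[R]_k) :=
  `|\det A| * `|g_ i (act (normal i0 A) y) - g_ i y| @[i --> \oo] --> (0 : R).
have mS : mpred (fun y (a : I -> R) => S y (mxof a)).
  rewrite /mpred.
  (* convergence to 0 of a nonnegative sequence is the vanishing of its upper limit *)
  pose E (z : borel X * coordR R I) := limn_esup (fun i => (F i (z.2, z.1))%:E).
  rewrite (_ : [set z | _] = E @^-1` [set 0%E]).
    rewrite -[X in measurable X]setTI; apply: measurable_fun_limn_esup => // i.
    apply/measurable_EFinP.
    exact: (measurableT_comp (mF i) (@measurable_swap _ _ _ _)).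
  apply/seteqP; split=> -[y a] /=; rewrite /S /E /F /= => h.
    rewrite (is_cvg_limn_esupE (u := EFin \o _)).
      by apply/cvg_lim => //; apply: cvg_EFin => //; exact: nearW.
    by apply/cvg_ex; exists 0%E; apply: cvg_EFin => //; exact: nearW.
  apply: (@fine_cvg _ _ \oo _ (fun i => (F i (a, y))%:E) 0).
  apply: limn_esup_le_cvg; first by rewrite -/(F _ (a, y)) h.
  by move=> i; rewrite lee_fin.
have aeS a : {ae mu, forall y, S y (mxof a)}.
  have [A0|A0] := eqVneq (\det (mxof a)) 0.
    by apply: aeW => y; rewrite /S A0 normr0; under eq_fun do rewrite mul0r; exact: cvg_cst.
  apply: filterS (inv _ (det_normal i0 A0)) => y yA; rewrite /S.
  rewrite -(mulr0 `|\det (mxof a)|); apply: cvgM; first exact: cvg_cst.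
  by rewrite -(normr0 R); apply: cvg_norm.
pose l : seq I := enum {: I}.
have lP p : p \in l by rewrite mem_enum.
have ae1 := aecoords_fubini l mS aeS (fun=> 0).
have [y0 y0P] : exists y0 : borel X, aecoords l (fun y (a : I -> R) => S y (mxof a)) y0 (fun=> 0).
  apply: filter_ex ae1; apply: ae_properfilter_algebraOfSetsType.
  by rewrite [X in (_ < X)%E](@probability_setT _ _ _ mu).
exists y0; apply: filterS ae1 => y yP.
have [h h1 yE] := transitive_det1 y0 y.
have := aecoords_mulmx (l := l) h1 (enum_uniq _) lP mS.
move=> /(congr1 (fun f => f y0 (fun=> 0))) H.
have y0h : aecoords l (fun _ (a : I -> R) => S y0 (mxof a *m SLpm_mx h)) y (fun=> 0).
  by rewrite -(aecoords_cst l (fun y (a : I -> R) => S y (mxof a *m SLpm_mx h)) y0) H.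
have [d d0 dP] : exists2 d, 0 < d & forall A : 'M[R]_k, nrm (A - 1%:M) < d -> \det A != 0.
  have /(cvgr_neq0 (FF := nbhs_filter (1%:M : 'M[R]_k))) := @continuous_det R k 1%:M.
  by rewrite det1 => /(_ (oner_neq0 _))/nbhs_nrm.
(* a common good matrix close to the identity, hence invertible *)
have [a' [[Sa Sa'] a'1 _]] := aecoords_near (fun p : I => (p.1 == p.2)%:R)
  (divr_gt0 d0 (ltr0Sn _ (k * k))) (aecoordsI yP y0h).
have A0 : \det (mxof a') != 0.
  apply: dP; apply: nrm_lt => // i j; rewrite !mxE ltW//.
  exact: (a'1 (i, j)).
have c1 A (u : nat -> R) : \det A != 0 -> `|\det A| * `|u i| @[i --> \oo] --> (0 : R) ->
    u i @[i --> \oo] --> (0 : R).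
  move=> dA h'; apply: norm_cvg0; rewrite -(mulr0 (`|\det A|^-1)).
  rewrite (_ : (fun i => _) = fun i => `|\det A|^-1 * (`|\det A| * `|u i|)).
    by apply: cvgM => //; exact: cvg_cst.
  by apply/funext => i; rewrite mulKf// normr_eq0.
have {}Sa := c1 _ _ _ A0 Sa.
have Ah : \det (mxof a' *m SLpm_mx h) != 0 by rewrite det_mulmx h1 mulr1.
have {}Sa' := c1 _ _ _ Ah Sa'.
rewrite normalM// in Sa'.
have -> : (fun i => g_ i y - g_ i y0) =
    (fun i => g_ i (act (normal i0 (mxof a') * h)%g y0) - g_ i y0) -
    (fun i => g_ i (act (normal i0 (mxof a')) y) - g_ i y).
  by apply/funext => i /=; rewrite actM -yE !fctE; ring.
by rewrite -[X in _ --> X]subr0; exact: cvgB.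
Qed.
End ergodicity_const.

(** * A mean ergodic theorem by convex averaging *)

Section bounded_series.
Context (R : realType).

Lemma bounded_series_cvg (u : nat -> R) : (forall i, 0 <= u i) ->
  (exists K, forall n0, \sum_(i < n0) u i <= K) -> cvgn (series u).
Proof.
move=> u0 [K uK]; apply: nondecreasing_is_cvgn.
  by apply/nondecreasing_seqP => i; rewrite !seriesEord /= big_ord_recr /= lerDl.
by exists K => _ [n0 _ <-]; rewrite seriesEord; exact: uK.
Qed.

Lemma bounded_variation_cvg (u : nat -> R) :
  (exists K, forall n0, \sum_(i < n0) `|u i - u i.+1| <= K) -> cvgn u.
Proof.
move=> uK; have : cvgn [normed series (telescope u)].
  apply: (bounded_series_cvg (u := fun i => `|telescope u i|)) => //.
  case: uK => K uK; exists K => n0.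
  by under eq_bigr do rewrite /telescope /= distrC; exact: uK.
move=> /(normed_cvg (V := R)) cu.
rewrite (_ : u = (fun=> u 0%N) + series (telescope u)).
  by apply: is_cvgD => //; exact: is_cvg_cst.
by apply/funext => i; rewrite {1}[u i]eq_sum_telescope.
Qed.

End bounded_series.

Section ae_monotonicity.
Context d (T : measurableType d) (R : realType) (m : {measure set T -> \bar R}).
Hypothesis mT : (m setT < +oo)%E.
Implicit Types f g : T -> R.

Let shift_ge0 (a b c : R) : `|a| <= b -> 0 <= c -> 0 <= a + (b + c).
Proof. by rewrite ler_norml => /andP[]; lra. Qed.

Lemma le_Rint_ae_finite f g : bmeas f -> bmeas g -> {ae m, forall x, f x <= g x} ->
  \int[m]_x f x <= \int[m]_x g x.
Proof.
move=> bf bg fg; have [mf [M fM]] := bf; have [mg [M' gM]] := bg.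
have bs (h : T -> R) : bmeas h -> bmeas (fun x => h x + (M + M')) by move=> bh; apply: bmeasD => //; exact: bmeas_cst.
have pos (x : T) : 0 <= M /\ 0 <= M'.
  by split; [exact: le_trans (normr_ge0 _) (fM x)|exact: le_trans (normr_ge0 _) (gM x)].
suff : \int[m]_x (f x + (M + M')) <= \int[m]_x (g x + (M + M')).
  rewrite (RintD mT bf (bmeas_cst T _)) (RintD mT bg (bmeas_cst T _)).
  by rewrite lerD2r.
rewrite -lee_fin (EFin_Rint mT (bs _ bf)) (EFin_Rint mT (bs _ bg)).
apply: ae_ge0_le_integral => //.
- move=> x _; rewrite lee_fin; have [M0 M'0] := pos x.
  exact: shift_ge0 (fM x) M'0.
- by apply/measurable_EFinP; case: (bs _ bf).
- move=> x _; rewrite lee_fin; have [M0 M'0] := pos x.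
  by rewrite [M + M']addrC; exact: shift_ge0 (gM x) M0.
- by apply/measurable_EFinP; case: (bs _ bg).
- by apply: filterS fg => x fgx _; rewrite lee_fin lerD2r.
Qed.

End ae_monotonicity.

Section variance.
Context d (T : measurableType d) (R : realType) (m : {measure set T -> \bar R}).
Hypothesis m1 : m setT = 1%E.

Let sq_expand (a b : R) : (a - b) ^+ 2 = a ^+ 2 - 2 * b * a + b ^+ 2.
Proof. by ring. Qed.

Let sq_aux (a I : R) : 0 <= a - 2 * I * I + I ^+ 2 -> I ^+ 2 <= a.
Proof. by lra. Qed.

Lemma Rint_sqr_ge (f : T -> R) : bmeas f -> (\int[m]_x f x) ^+ 2 <= \int[m]_x (f x ^+ 2).
Proof.
move=> bf; set I := \int[m]_x f x.
have mT : (m setT < +oo)%E by rewrite m1 ltry.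
have b1 := bmeas_cst T I.
have b2 : bmeas (fun x => 2 * I * f x) by apply: bmeasM => //; exact: bmeas_cst.
have : 0 <= \int[m]_x ((f x - I) ^+ 2) by apply: Rint_ge0 => x; rewrite sqr_ge0.
under eq_Rintegral => x _ do rewrite sq_expand.
rewrite RintD//; last 2 first.
- by apply: bmeasB => //; exact: bmeasX2.
- exact: bmeas_cst.
rewrite RintB//; last exact: bmeasX2.
rewrite RintZ// (Rint_cst m1) -/I; exact: sq_aux.
Qed.

End variance.

Section ae_integrals.
Context d (T : measurableType d) (R : realType) (m : probability T R).
Implicit Types f g : T -> R.

Lemma le_Rint_ae f g : bmeas f -> bmeas g -> {ae m, forall x, f x <= g x} ->
  \int[m]_x f x <= \int[m]_x g x.
Proof. exact/le_Rint_ae_finite/probT_lty. Qed.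

Lemma prob1_ae (E : set T) : measurable E -> m E = 1%E -> {ae m, forall x, E x}.
Proof.
move=> mE E1; exists (~` E); split => //; first exact: measurableC.
by rewrite probability_setC// E1 subee.
Qed.

Let young (a eta : R) : 0 < eta -> `|a| <= eta + eta^-1 * a ^+ 2.
Proof.
move=> eta0; rewrite -real_normK ?num_real//; have := normr_ge0 a.
move: `|a| => {}a a0.
have : 0 <= eta^-1 * (a - eta) ^+ 2 by rewrite mulr_ge0 ?invr_ge0 ?sqr_ge0// ltW.
rewrite (_ : eta^-1 * (a - eta) ^+ 2 = eta^-1 * a ^+ 2 - 2 * a + eta); last by field; rewrite gt_eqF.
lra.
Qed.

(** Young's inequality, integrated; it turns L^2 estimates into L^1 estimates. *)
Lemma Rint_norm_le (f : T -> R) eta : 0 < eta -> bmeas f ->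
  \int[m]_x `|f x| <= eta + (\int[m]_x (f x ^+ 2)) / eta.
Proof.
move=> eta0 bf; have mT : (m setT < +oo)%E by exact: probT_lty.
have b2 := bmeasX2 bf.
have b3 : bmeas (fun x => eta^-1 * f x ^+ 2) by apply: bmeasM => //; exact: bmeas_cst.
apply: (@le_trans _ _ (\int[m]_x (eta + eta^-1 * f x ^+ 2))).
  apply: le_Rint => //; first exact: bmeas_norm.
    by apply: bmeasD => //; exact: bmeas_cst.
  by move=> x; exact: young.
rewrite RintD//; last exact: bmeas_cst.
by rewrite RintZ// (Rint_cst (probability_setT m)) mulrC.
Qed.

End ae_integrals.

Section averaging.
Context (R : realType) (k : nat).
Local Notation G := (SLpm R k).
Local Notation X := (SLquo R k).
Implicit Types (F : X -> R).

Let sqB_expand (a b : R) : (a - b) ^+ 2 = (a ^+ 2 + b ^+ 2) - 2 * (a * b).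
Proof. by ring. Qed.

Let sqD_half (a b : R) : ((a + b) / 2) ^+ 2 = 4^-1 * (a ^+ 2 + b ^+ 2 + 2 * (b * a)).
Proof. by field. Qed.

(** The function is continuous in [b] for the entries of the matrix, and measurable in the second
    variable. *)
Lemma measurable_act_pair d (Om : measurableType d) (y : Om -> X) F :
  ucont F -> (forall b, measurable_fun setT (fun om => F (act b (y om)))) ->
  measurable_fun setT (fun z : borel G * Om => F (act z.1 (y z.2))).
Proof.
move=> uF mF.
apply: (@measurable_separately _ _ (borel G) Om R ('I_k * 'I_k)%type
  (fun p (b : borel G) => SLpm_mx b p.1 p.2)) => //.
  move=> [i j] /=; apply: borel_continuous => /=.
  move=> g; apply: (@continuous_comp _ _ _ (@SLpm_mx R k : G -> _) (fun A : 'M[R]_k => A i j)).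
    exact: continuous_SLmx.
  exact: coord_continuous.
move=> b om e e0 /=; have [d0 d00 dP] := uF _ e0.
pose N := nrm (SLpm_mx (b : G)^-1%g) + 1.
have N0 : 0 < N by rewrite ltr_wpDl// nrm_ge0.
exists (d0 / N / (k * k).+1%:R); first by rewrite !divr_gt0.
move=> b' bb'.
rewrite -[X in act X](mulgVK (b : G)) actM; apply: dP.
rewrite -(mulgV (b : G)) (le_lt_trans (sdistMr _ _ _))//.
have : sdist (b' : G) b < d0 / N.
  apply: nrm_lt; first exact: divr_gt0.
  by move=> i j; rewrite !mxE; apply/ltW; exact: (bb' (i, j)).
rewrite ltr_pdivlMr//; apply: le_lt_trans; rewrite ler_wpM2l ?sdist_ge0//.
by rewrite lerDl.
Qed.

Definition avg (nu : probability (borel G) R) F (y : X) : R := \int[nu]_b F (act b y).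

Variables (nu : probability (borel G) R) (E : set G) (B : R).
Hypotheses (mE : measurable (E : set (borel G))) (nuE : nu E = 1%E).
Hypothesis EB : forall b, E b -> nrm (SLpm_mx b) <= B /\ nrm (SLpm_mx (b^-1)%g) <= B.

Lemma bmeas_actl F y : testf F -> bmeas (fun b : borel G => F (act b y)).
Proof.
move=> tF; split.
  apply: (measurable_fun_pair1 (f := fun z : borel G * unit => F (act z.1 y)) tt).
  by apply: (measurable_act_pair (y := fun=> y)) => //; case: tF.
by have [M FM] := testf_bounded tF; exists M.
Qed.

Lemma bmeas_act2 F : testf F -> bmeas (fun z : borel G * borel X => F (act z.1 z.2)).
Proof.
move=> tF; split.
  apply: (measurable_act_pair (y := fun y : borel X => (y : X))); first by case: tF.
  by move=> b; case: (bmeas_testf (testf_act b tF)).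
by have [M FM] := testf_bounded tF; exists M.
Qed.

#[local] Instance nu_ae_filter : Filter (almost_everywhere nu).
Proof. exact: ae_filter_ringOfSetsType. Qed.

Let aeE : {ae nu, forall b : borel G, E b}.
Proof. exact: prob1_ae. Qed.

Let nuT : (nu setT < +oo)%E. Proof. exact: probT_lty. Qed.

(** Uniform continuity survives because [b v b^-1] stays close to 1 for [b] in the bounded set [E]; the
    support grows by a bounded factor. *)
Lemma avg_testf F : testf F -> testf (avg nu F).
Proof.
move=> tF; have [uF hF] := tF; split.
  move=> e e0; have e2 : 0 < e / 2 by rewrite divr_gt0.
  have [d0 d00 dP] := uF _ e2.
  pose K := B * B + 1; have K0 : 0 < K by rewrite ltr_wpDl// -expr2 sqr_ge0.
  exists (d0 / K); first exact: divr_gt0.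
  move=> v vd y; rewrite /avg -RintB//; [|exact: bmeas_actl..].
  rewrite (@le_lt_trans _ _ (e / 2))//; last lra.
  apply: (le_trans (le_norm_Rint nuT _)).
    by apply: bmeasB; exact: bmeas_actl.
  rewrite -[leRHS](Rint_cst (probability_setT nu)).
  apply: le_Rint_ae; [apply: bmeas_norm; apply: bmeasB; exact: bmeas_actl|exact: bmeas_cst|].
  apply: filterS aeE => b /EB[bB bB']; apply/ltW.
  rewrite -actM -[X in act X](mulgVK (b : G)) actM; apply: dP.
  rewrite (le_lt_trans (sdist_conj _ _))// (@le_lt_trans _ _ (K * sdist v 1%g))//.
    rewrite ler_wpM2r ?sdist_ge0// (@le_trans _ _ (B * B)) ?lerDl//.
    by rewrite ler_pM ?nrm_ge0.
  by rewrite mulrC -ltr_pdivlMr.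
have [n Fn] := hF; exists (B * `|n|) => y yn; rewrite /avg.
have F0 : {ae nu, forall b : borel G, F (act b y) = 0}.
  apply: filterS aeE => b /EB[bB bB']; apply: Fn; rewrite ltNge; apply/negP => byn.
  have := hgt0_act (b^-1)%g (act b y); rewrite actK => hy.
  have : hgt 0 y <= B * `|n|.
    rewrite (le_trans hy)// ler_pM ?nrm_ge0 ?hgt_ge0//.
    by rewrite (le_trans byn)// ler_norm.
  by rewrite leNgt yn.
apply/eqP; rewrite eq_le; apply/andP; split.
  rewrite -[leRHS](Rint_cst (probability_setT nu)); apply: le_Rint_ae.
  - exact: bmeas_actl.
  - exact: bmeas_cst.
  - by apply: filterS F0 => b ->.
rewrite -[leLHS](Rint_cst (probability_setT nu)); apply: le_Rint_ae.
- exact: bmeas_cst.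
- exact: bmeas_actl.
- by apply: filterS F0 => b ->.
Qed.

Lemma avg_bound F M : testf F -> (forall y, `|F y| <= M) -> forall y, `|avg nu F y| <= M.
Proof.
move=> tF FM y; have bF := bmeas_actl y tF.
rewrite (le_trans (le_norm_Rint nuT bF))//.
rewrite -[leRHS](Rint_cst (probability_setT nu)); apply: le_Rint => //.
  exact: bmeas_norm.
exact: bmeas_cst.
Qed.

Lemma Rint_avg (mu : probability (borel X) R) F : act_invariant mu -> testf F ->
  \int[mu]_y avg nu F y = \int[mu]_y F y.
Proof.
move=> minv tF; have b2 := bmeas_act2 tF.
rewrite -(Rint_fubini nu mu b2) /=.
under eq_Rintegral => b _ do rewrite (Rint_act b minv (bmeas_testf tF)).
by rewrite (Rint_cst (probability_setT nu)).
Qed.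

(** With [N] the squared L^2 norm of [F] and [A F] its average, the left side is [2 N - 2 <A F, F>],
    while the squared norm of the midpoint is [(N + |A F|^2 + 2 <A F, F>) / 4] and [|A F|^2 <= N].  So if
    [F] almost minimizes the norm in a convex set stable under averaging, then it is almost
    invariant under typical elements [b]. *)
Lemma Rint_osc (mu : probability (borel X) R) F : act_invariant mu -> testf F ->
  \int[nu]_b \int[mu]_y (F (act b y) - F y) ^+ 2 <=
  4 * (\int[mu]_y F y ^+ 2 - \int[mu]_y ((F y + avg nu F y) / 2) ^+ 2).
Proof.
move=> minv tF; have tA := avg_testf tF.
have bF := bmeas_testf tF; have bA := bmeas_testf tA.
have muT : (mu setT < +oo)%E by exact: probT_lty.
have b2 := bmeas_act2 tF.
have bFs : bmeas (fun z : borel G * borel X => F z.2).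
  exact: (bmeas_comp (@measurable_snd _ _ _ _) bF).
have bp : bmeas (fun z : borel G * borel X => F (act z.1 z.2) * F z.2) by exact: bmeasM.
set N := \int[mu]_y F y ^+ 2.
have bx b : bmeas ((fun y => F (act b y)) : borel X -> R) by exact: bmeas_act.
have -> : \int[nu]_b \int[mu]_y (F (act b y) - F y) ^+ 2 =
    2 * N - 2 * \int[mu]_y (avg nu F y * F y).
  transitivity (\int[nu]_b (2 * N - 2 * \int[mu]_y (F (act b y) * F y))).
    apply: eq_Rintegral => b _.
    under eq_Rintegral => y _ do rewrite sqB_expand.
    rewrite RintB//; last 2 first.
    - by apply: bmeasD; apply: bmeasX2.
    - by apply: bmeasM; [exact: bmeas_cst|exact: bmeasM].
    rewrite RintD ?RintZ//; last 3 first.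
    - exact: bmeasM.
    - exact: bmeasX2.
    - exact: bmeasX2.
    rewrite (@Rint_act _ _ mu b (fun y => F y ^+ 2))//; last exact: bmeasX2.
    by rewrite -/N; ring.
  rewrite RintB//; last 2 first.
  - exact: bmeas_cst.
  - by apply: bmeasM; [exact: bmeas_cst|exact: (bmeas_Rint nu mu bp)].
  rewrite (Rint_cst (probability_setT nu)) RintZ//; last exact: (bmeas_Rint nu mu bp).
  rewrite (Rint_fubini nu mu bp) /=; congr (_ - _ * _); apply: eq_Rintegral => y _.
  rewrite /avg mulrC -RintZ//; last exact: bmeas_actl.
  by apply: eq_Rintegral => b _; rewrite mulrC.
have NA : \int[mu]_y avg nu F y ^+ 2 <= N.
  have bsq := bmeasX2 b2.
  apply: (@le_trans _ _ (\int[mu]_y \int[nu]_b (F (act b y) ^+ 2))).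
    apply: le_Rint => //; first exact: bmeasX2.
      exact: (bmeas_Rint mu nu (bmeas_comp (@measurable_swap _ _ _ _) bsq)).
    by move=> y; apply: Rint_sqr_ge; [exact: probability_setT|exact: bmeas_actl].
  rewrite -(Rint_fubini nu mu bsq) /=.
  under eq_Rintegral => b _ do rewrite (@Rint_act _ _ mu b (fun y => F y ^+ 2) minv (bmeasX2 bF)).
  by rewrite (Rint_cst (probability_setT nu)).
have -> : \int[mu]_y ((F y + avg nu F y) / 2) ^+ 2 =
    4^-1 * (N + \int[mu]_y avg nu F y ^+ 2 + 2 * \int[mu]_y (avg nu F y * F y)).
  under eq_Rintegral => y _ do rewrite sqD_half.
  have b3 : bmeas (fun y : borel X => 2 * (avg nu F y * F y)).
    by apply: bmeasM; [exact: bmeas_cst|exact: bmeasM].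
  rewrite RintZ//; last by apply: bmeasD => //; apply: bmeasD; exact: bmeasX2.
  rewrite RintD//; last by apply: bmeasD; exact: bmeasX2.
  rewrite RintD//; [|exact: bmeasX2..].
  by rewrite RintZ//; exact: bmeasM.
rewrite -/N; lra.
Qed.

End averaging.

Section mean_ergodic.
Context (R : realType) (m n : nat) (m_gt0 : (0 < m)%N) (n_gt0 : (0 < n)%N).
Context (Nm : 'cV[R]_m -> R) (Nn : 'cV[R]_n -> R).
Context (Nm_norm : is_norm Nm) (Nn_norm : is_norm Nn).
Local Notation G := (SLpm R (m + n)).
Local Notation X := (SLquo R (m + n)).
Variables (mu : probability (borel X) R) (nu : probability (borel G) R) (E : set G) (B tmin : R).
Hypotheses (mu_inv : act_invariant mu).
Hypotheses (mE : measurable (E : set (borel G))) (nuE : nu E = 1%E).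
Hypothesis EB : forall b, E b -> nrm (SLpm_mx b) <= B /\ nrm (SLpm_mx (b^-1)%g) <= B.
Hypothesis tmin_gt0 : 0 < tmin.
Hypothesis Econf : forall b, E b -> exists2 t, tmin <= t & conformal Nm Nn t b.

Variables (V : set (X -> R)) (M c : R) (F0 : X -> R).
Hypotheses (VF0 : V F0) (Vtest : forall F, V F -> testf F).
Hypothesis VM : forall F, V F -> forall y, `|F y| <= M.
Hypothesis Vc : forall F, V F -> \int[mu]_y F y = c.
Hypothesis Vmid : forall F F', V F -> V F' -> V (fun y => (F y + F' y) / 2).
Hypothesis Vavg : forall F, V F -> V (avg nu F).

Let muT : (mu setT < +oo)%E. Proof. exact: probT_lty. Qed.
Let N (F : X -> R) : R := \int[mu]_y F y ^+ 2.

Let bV F : V F -> bmeas (F : borel X -> R).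
Proof. by move=> /Vtest; exact: bmeas_testf. Qed.

Let d := inf [set N F | F in V].

Let dN F : V F -> d <= N F.
Proof.
move=> VF; apply: ge_inf; last by exists F.
by exists 0 => _ [F' _ <-]; apply: Rint_ge0 => y; rewrite sqr_ge0.
Qed.

Let minimizing : exists g : nat -> X -> R, forall i, V (g i) /\ N (g i) <= d + ((1 / 2) ^+ i) ^+ 2.
Proof.
have h i : exists F, V F /\ N F <= d + ((1 / 2) ^+ i) ^+ 2.
  have [||_ [F VF <-] NF] := @inf_adherent R [set N F | F in V] (((1 / 2) ^+ i) ^+ 2).
  - by rewrite !exprn_gt0//; lra.
  - split; first by exists (N F0), F0.
    by exists 0 => _ [F' _ <-]; apply: Rint_ge0 => y; rewrite sqr_ge0.
  by exists F; split => //; exact: ltW.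
by have [g gP] := choice h; exists g.
Qed.

Let parallelogram F F' e : V F -> V F' -> N F <= d + e -> N F' <= d + e ->
  \int[mu]_y (F y - F' y) ^+ 2 <= 4 * e.
Proof.
move=> VF VF' h h'; have hm := dN (Vmid VF VF'); have bF := bV VF; have bF' := bV VF'.
have E1 : N (fun y => (F y + F' y) / 2) = 2^-1 * (N F + N F') - 4^-1 * \int[mu]_y (F y - F' y) ^+ 2.
  have bB : bmeas (fun y : borel X => (F y - F' y) ^+ 2) by apply: bmeasX2; exact: bmeasB.
  rewrite -RintD//; [|exact: bmeasX2..].
  rewrite -RintZ//; last by apply: bmeasD; exact: bmeasX2.
  rewrite -RintZ// -RintB//; last 2 first.
  - by apply: bmeasM; [exact: bmeas_cst|apply: bmeasD; exact: bmeasX2].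
  - by apply: bmeasM; [exact: bmeas_cst|].
  by apply: eq_Rintegral => y _; field.
rewrite E1 in hm; lra.
Qed.

Let subseq_cvg0 (j : nat -> nat) (u : nat -> R) : (forall k, (k <= j k)%N) ->
  (exists K, forall n0, \sum_(i < n0) `|u (j i)| <= K) -> cvgn u -> u i @[i --> \oo] --> (0 : R).
Proof.
move=> jk uK /cvg_ex[l ul].
have /cvg_series_cvg_0 uj0 := bounded_series_cvg (fun i => normr_ge0 (u (j i))) uK.
have ujl : u (j i) @[i --> \oo] --> l.
  apply: (cvg_comp j u); last exact: ul.
  by move=> A [k _ kA]; exists k => // i /= ki; apply: kA; exact: leq_trans (jk i).
suff -> : 0 = l by [].
by apply: (cvg_unique _ _ ujl) => //; exact: norm_cvg0.
Qed.

(** Choose [g_i] in [V] minimizing the L^2 norm up to [4^-i].  By the parallelogram identity the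
    differences are summable in L^1, so that the sequence converges almost everywhere; by [Rint_osc]
    each [g_i] is almost invariant under some [b] of [E], hence under SL by [mautner].  The limit is
    therefore constant, and the constant is [c] by bounded convergence.  Minimizing inside [V]
    rather than projecting in L^2 keeps all approximants continuous with compact support. *)
Lemma mean_ergodic e : 0 < e -> exists2 F, V F & \int[mu]_y (F y - c) ^+ 2 <= e.
Proof.
move=> e0; have [g gP] := minimizing.
have Vg i : V (g i) by case: (gP i).
have tg i := Vtest (Vg i); have bg i := bV (Vg i).
pose q i : R := (1 / 2) ^+ i.
have q0 i : 0 < q i by rewrite exprn_gt0//; lra.
have qle i j : (i <= j)%N -> q j <= q i.
  by move=> ij; apply: ler_wiXn2l => //; lra.
have qN i : N (g i) <= d + q i ^+ 2 by case: (gP i).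
have qsmall eps : 0 < eps -> exists j, forall i, (j <= i)%N -> q i < eps.
  move=> eps0; have : (1 / 2 : R) ^+ i @[i --> \oo] --> (0 : R).
    by apply: cvg_expr; rewrite ger0_norm; lra.
  move=> /cvgrPdist_lt/(_ _ eps0)[j _ jP]; exists j => i /jP /=.
  by rewrite sub0r normrN ger0_norm// ltW// q0.
have g2 i j : (i <= j)%N -> \int[mu]_y (g i y - g j y) ^+ 2 <= 4 * q i ^+ 2.
  move=> ij; apply: parallelogram => //.
  by rewrite (le_trans (qN j))// lerD2l ler_pXn2r ?nnegrE ?qle// ltW.
have bgB i j : bmeas (fun y : borel X => g i y - g j y) by exact: bmeasB.
have g1 i j : (i <= j)%N -> \int[mu]_y `|g i y - g j y| <= 5 * q i.
  move=> ij; rewrite (le_trans (Rint_norm_le mu (q0 i) (bgB i j)))//.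
  rewrite (_ : 5 * q i = q i + 4 * q i ^+ 2 / q i); last by field; rewrite gt_eqF.
  by rewrite lerD2l ler_pM2r ?invr_gt0// g2.
(* the L^1 displacement of g_i by h, to which the Mautner argument applies *)
pose I i (h : G) : R := \int[mu]_y `|g i (act h y) - g i y|.
have bI i h h' : bmeas ((fun y => `|g i (act h y) - g i (act h' y)|) : borel X -> R).
  by apply: bmeas_norm; apply: bmeasB; exact: bmeas_act.
have bI1 i h : bmeas ((fun y => `|g i (act h y) - g i y|) : borel X -> R).
  by apply: bmeas_norm; apply: bmeasB => //; exact: bmeas_act.
have IM i h h' : I i (h * h')%g <= I i h + I i h'.
  rewrite -[I i h](Rint_act h' mu_inv (bI1 i h)) /I -RintD//; last first.
    by under eq_fun do rewrite -actM; exact: bI.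
  apply: le_Rint => //; first by apply: bmeasD => //; under eq_fun do rewrite -actM; exact: bI.
  by move=> y; rewrite actM -[X in `|X| <= _](subrKA (g i (act h' y))) ler_normD.
have IV i h : I i (h^-1)%g = I i h.
  rewrite /I -[LHS](Rint_act h mu_inv (bI1 i h^-1%g)).
  by apply: eq_Rintegral => y _; rewrite actK distrC.
have Icauchy eps : 0 < eps -> exists j, forall i, (j <= i)%N -> forall h, I i h <= I j h + eps.
  move=> eps0; have [j jq] := qsmall (eps / 10) (divr_gt0 eps0 (ltr0Sn _ _)).
  exists j => i ji h; have := jq j (leqnn j); rewrite ltr_pdivlMr// => jq'.
  have gij := g1 _ _ ji.
  apply: (@le_trans _ _ (\int[mu]_y (`|g j (act h y) - g i (act h y)| +
     (`|g j (act h y) - g j y| + `|g j y - g i y|)))).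
    apply: le_Rint => //.
      apply: bmeasD; last by apply: bmeasD => //; exact: bmeas_norm.
      by apply: bmeas_norm; apply: bmeasB; exact: bmeas_act.
    move=> y; rewrite -[X in `|X| <= _](subrKA (g j (act h y))).
    rewrite (le_trans (ler_normD _ _))// distrC lerD2l.
    by rewrite -[X in `|X| <= _](subrKA (g j y)) ler_normD.
  rewrite RintD//; last 2 first.
  - by apply: bmeas_norm; apply: bmeasB; exact: bmeas_act.
  - by apply: bmeasD => //; exact: bmeas_norm.
  rewrite RintD//; last exact: bmeas_norm.
  rewrite (@Rint_act _ _ mu h (fun y => `|g j y - g i y|))//; last exact: bmeas_norm.
  by rewrite -/(I j h); lra.
have Icont j eps : 0 < eps -> exists2 dl, 0 < dl & forall v, sdist v 1%g < dl -> I j v < eps.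
  move=> eps0; have [uj _] := tg j; have [dl dl0 dP] := uj (eps / 2) (divr_gt0 eps0 (ltr0Sn _ _)).
  exists dl => // v /dP vP; apply: (@le_lt_trans _ _ (eps / 2)); last by lra.
  rewrite -[leRHS](Rint_cst (probability_setT mu)); apply: le_Rint => //.
    exact: bmeas_cst.
  by move=> y; apply/ltW/vP.
have Ib eps : 0 < eps -> exists j, forall i, (j <= i)%N ->
     exists b t, [/\ tmin <= t, conformal Nm Nn t b & I i b < eps].
  move=> eps0; have [j jq] := qsmall (eps / 6) (divr_gt0 eps0 (ltr0Sn _ _)).
  exists j => i /jq; rewrite ltr_pdivlMr// => qi.
  pose rho b := \int[mu]_y (g i (act b y) - g i y) ^+ 2.
  have [b Eb rb] : exists2 b, E b & rho b <= 5 * q i ^+ 2.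
    apply: contrapT => nb.
    have brho : bmeas (rho : borel G -> R).
      have b2 : bmeas (fun z : borel G * borel X => (g i (act z.1 z.2) - g i z.2) ^+ 2).
        apply: bmeasX2; apply: bmeasB; first exact: bmeas_act2.
        exact: (bmeas_comp (@measurable_snd _ _ _ _) (bg i)).
      exact: (bmeas_Rint nu mu b2).
    have l1 : 5 * q i ^+ 2 <= \int[nu]_b rho b.
      rewrite -[leLHS](Rint_cst (probability_setT nu)); apply: le_Rint_ae => //.
        exact: bmeas_cst.
      have aeE : {ae nu, forall b : borel G, E b} by exact: prob1_ae.
      have FN : Filter (almost_everywhere nu) by exact: ae_filter_ringOfSetsType.
      apply: filterS aeE => b Eb.
      by rewrite leNgt; apply/negP => /ltW rb; apply: nb; exists b.
    have := Rint_osc mE nuE EB mu_inv (tg i).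
    have := dN (Vmid (Vg i) (Vavg (Vg i))); rewrite -/(N (fun y => (g i y + avg nu (g i) y) / 2)).
    rewrite -/(N (g i)) -[\int[nu]_b _]/(\int[nu]_b rho b).
    have := qN i; have : 0 < q i ^+ 2 by rewrite exprn_gt0.
    lra.
  have [t tt bt] := Econf Eb; exists b, t; split => //.
  have bb : bmeas ((fun y => g i (act b y) - g i y) : borel X -> R).
    by apply: bmeasB => //; exact: bmeas_act.
  rewrite (le_lt_trans (Rint_norm_le mu (q0 i) bb))// (le_lt_trans _ qi)//.
  rewrite (_ : q i * 6 = q i + 5 * q i ^+ 2 / q i); last by field; rewrite gt_eqF.
  by rewrite lerD2l ler_pM2r ?invr_gt0.
have sumq C (a : nat -> R) : 0 <= C -> (forall k, a k <= C * q k) ->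
    forall n0, \sum_(i < n0) a i <= C * 2.
  move=> C0 aq n0; apply: (@le_trans _ _ (\sum_(i < n0) C * q i)); first exact: ler_sum.
  rewrite -mulr_sumr ler_wpM2l//.
  have -> : \sum_(i < n0) q i = 2 - 2 * q n0.
    elim: n0 => [|n0 IH]; first by rewrite big_ord0 /q expr0; ring.
    by rewrite big_ord_recr /= IH /q exprS; field.
  by rewrite lerBlDr lerDl mulr_ge0// ltW.
have cvg_g : {ae mu, forall y : borel X, cvgn (fun i => g i y)}.
  have gq k : \int[mu]_y `|g k y - g k.+1 y| <= 5 * q k by exact: g1.
  have := ae_bounded_series muT (u := fun k y => `|g k y - g k.+1 y|)
    (fun k => bmeas_norm (bgB k k.+1)) (fun _ _ => normr_ge0 _) (sumq 5 _ (ler0n _ 5) gq).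
  by apply: filterS => y yb; exact: bounded_variation_cvg.
have ae_act h (Q : borel X -> Prop) : {ae mu, forall y, Q y} -> {ae mu, forall y : borel X, Q (act h y)}.
  move=> [S [mS S0 SP]]; exists (act h @^-1` S); split.
  - by rewrite -[X in measurable X]setTI; exact: measurable_act.
  - by have := mu_inv h mS; rewrite S0.
  - by move=> y; exact: SP.
have h_ae : forall h : G, \det (SLpm_mx h) = 1 ->
     {ae mu, forall y : borel X, g i (act h y) - g i y @[i --> \oo] --> (0 : R)}.
  move=> h h1.
  have Ih := mautner m_gt0 n_gt0 Nm_norm Nn_norm tmin_gt0 IM IV Icauchy Icont Ib h1.
  have [j jP] : exists j : nat -> nat, forall k, (k <= j k)%N /\ I (j k) h <= q k.
    have hk k : exists jk, (k <= jk)%N /\ I jk h <= q k.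
      have [j jP] := Ih _ (q0 k).
      by exists (maxn j k); rewrite leq_maxr ltW// jP// leq_maxl.
    by have [j jP] := choice hk; exists j.
  have jP' k : I (j k) h <= 1 * q k by rewrite mul1r; case: (jP k).
  have subseq := ae_bounded_series muT (u := fun k y => `|g (j k) (act h y) - g (j k) y|)
    (fun k => bI1 (j k) h) (fun _ _ => normr_ge0 _) (sumq 1 _ ler01 jP').
  have hcvg := ae_act h (fun y => cvgn (fun i => g i y)) cvg_g.
  have FM : Filter (almost_everywhere mu) by exact: ae_filter_ringOfSetsType.
  have c2 : {ae mu, forall y : borel X, cvgn (fun i => g i y) /\ cvgn (fun i => g i (act h y))}.
    by apply: filterS2 cvg_g hcvg => y.
  apply: filterS2 subseq c2 => y yb [yc hyc].
  exact: (subseq_cvg0 (fun k => (jP k).1) yb (is_cvgB hyc yc)).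
have [y0 y0P] := almost_invariant_const (ltn_addr n m_gt0) mu_inv tg (fun i => VM (Vg i)) h_ae.
pose D i : R := \int[mu]_y `|g i y - g i y0|.
have bD i : bmeas (fun y : borel X => g i y - g i y0).
  by apply: bmeasB => //; exact: bmeas_cst.
have D0 : D i @[i --> \oo] --> (0 : R).
  rewrite -[X in _ --> X](Rint_cst (probability_setT mu)).
  apply: (Rint_cvg muT (f_ := fun i y => `|g i y - g i y0|) (M := 2 * M)).
  - by move=> i; case: (bmeas_norm (bD i)).
  - exact: bmeas_cst.
  - move=> i y; rewrite normr_id (le_trans (ler_normB _ _))//.
    by have := VM (Vg i) y; have := VM (Vg i) y0; lra.
  - by apply: filterS y0P => y yP; rewrite -(normr0 R); exact: cvg_norm.
have M0 : 0 <= M + `|c| by rewrite addr_ge0// (le_trans _ (VM VF0 y0)).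
have K0 : 0 < (M + `|c| + 1) * 2 by rewrite mulr_gt0// ltr_wpDl.
have [i Di] : exists i, D i < e / ((M + `|c| + 1) * 2).
  have /cvgrPdist_lt/(_ _ (divr_gt0 e0 K0))[j _ /(_ j (leqnn j))] := D0.
  rewrite /= sub0r normrN => jj; exists j; exact: le_lt_trans (ler_norm _) jj.
exists (g i) => //.
have bgc : bmeas (fun y : borel X => g i y - c) by apply: bmeasB => //; exact: bmeas_cst.
apply: (@le_trans _ _ (\int[mu]_y ((M + `|c|) * `|g i y - c|))).
  apply: le_Rint => //; first exact: bmeasX2.
    by apply: bmeasM; [exact: bmeas_cst|exact: bmeas_norm].
  move=> y; rewrite -real_normK ?num_real// expr2 ler_wpM2r//.
  by rewrite (le_trans (ler_normB _ _))// lerD2r VM.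
rewrite RintZ//; last exact: bmeas_norm.
have : \int[mu]_y `|g i y - c| <= D i + D i.
  apply: (@le_trans _ _ (\int[mu]_y (`|g i y - g i y0| + `|g i y0 - c|))).
    apply: le_Rint => //; first exact: bmeas_norm.
      by apply: bmeasD; [exact: bmeas_norm|exact: bmeas_cst].
    by move=> y; rewrite -[X in `|X| <= _](subrKA (g i y0)) ler_normD.
  rewrite RintD//; [|exact: bmeas_norm|exact: bmeas_cst].
  rewrite (Rint_cst (probability_setT mu)) lerD2l distrC.
  rewrite -(Vc (Vg i)) -[X in _ - X](Rint_cst (probability_setT mu)) -RintB//; last exact: bmeas_cst.
  exact: le_norm_Rint.
rewrite ltr_pdivlMr// in Di => h.
have D_ge0 : 0 <= D i by exact: Rint_ge0.
rewrite (le_trans (ler_wpM2l M0 h))// (le_trans _ (ltW Di))//.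
move: (D i) D_ge0 M0 => Di' Di0; move: (M + `|c|) => K Kge; nra.
Qed.

End mean_ergodic.

(** * The strong law of large numbers along the random walk *)

Section square_gaps.
Context (R : realType).

(** Convergence of averages along the times [(k + 1)^2] is enough for bounded terms: between two
    consecutive squares there are [O(k)] terms, against [k^2]. *)
Lemma cvg_average_squares (D : nat -> R) C : (forall q, `|D q| <= C) ->
  (\sum_(q < k.+1 ^ 2) D q) / (k.+1 ^ 2)%:R @[k --> \oo] --> (0 : R) ->
  (\sum_(q < N) D q) / N%:R @[N --> \oo] --> (0 : R).
Proof.
move=> DC Sk; have C0 : 0 <= C by exact: le_trans (DC 0%N).
apply/cvgrPdist_lt => e e0; have e2 : 0 < e / 2 by rewrite divr_gt0.
have /cvgrPdist_lt/(_ _ e2)[k0 _ k0P] := Sk.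
(* past the last square (k + 1)^2 there are at most 2 k + 3 <= 5 (k + 1) terms, each at most C *)
pose k1 := Num.bound (5 * C / (e / 2)); pose K := maxn k0 k1.
exists (K.+2 ^ 2)%N => // N /= KN.
have [k [k1N Nk2]] : exists k, (k.+1 ^ 2 <= N)%N /\ (N < k.+2 ^ 2)%N.
  have ex : exists j, (j.+1 ^ 2 <= N)%N by exists K; apply: leq_trans KN; rewrite leq_exp2r.
  have ub j : (j.+1 ^ 2 <= N)%N -> (j <= N)%N.
    by move=> jN; rewrite (leq_trans _ jN)// -mulnn (leq_trans (leqnSn j))// leq_pmull.
  case: (ex_maxnP ex ub) => k kN kmax; exists k; split => //.
  by rewrite ltnNge; apply/negP => /kmax; rewrite ltnn.
have Kk : (K <= k)%N.
  by have := leq_ltn_trans KN Nk2; rewrite ltn_exp2r// !ltnS => /ltnW.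
have N0 : (0 < N)%N by apply: leq_trans k1N.
have N0' : 0 < N%:R :> R by rewrite ltr0n.
have Nk : (N - k.+1 ^ 2 <= 2 * k + 3)%N by rewrite leq_subLR; rewrite -!mulnn in Nk2 *; lia.
have sE : \sum_(q < N) D q = \sum_(q < k.+1 ^ 2) D q + \sum_(k.+1 ^ 2 <= q < N) D q.
  by rewrite -!(big_mkord xpredT) -big_cat_nat.
have s2 : `|\sum_(k.+1 ^ 2 <= q < N) D q| <= C * (2 * k + 3)%:R.
  rewrite (le_trans (ler_norm_sum _ _ _))//.
  rewrite (@le_trans _ _ (\sum_(k.+1 ^ 2 <= q < N) C))//; first exact: ler_sum.
  by rewrite sumr_const_nat -[leLHS]mulr_natr ler_wpM2l// ler_nat.
have k0k : (k0 <= k)%N by apply: leq_trans Kk; exact: leq_maxl.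
have kk1 : (k1 <= k)%N by apply: leq_trans Kk; exact: leq_maxr.
have := k0P _ k0k; rewrite /= !sub0r !normrN => s1.
rewrite sE normrM normfV [X in _ / X]ger0_norm// ltr_pdivrMr//.
have q0 : 0 < (k.+1 ^ 2)%:R :> R by rewrite ltr0n expn_gt0.
rewrite normrM normfV [X in _ / X]ger0_norm ?ltW// ltr_pdivrMr// in s1.
rewrite (le_lt_trans (ler_normD _ _))//.
have kN : (k.+1 ^ 2)%:R <= N%:R :> R by rewrite ler_nat.
have : C * (2 * k + 3)%:R <= e / 2 * N%:R.
  have : 5 * C / (e / 2) <= k.+1%:R.
    rewrite ltW// (lt_le_trans (archi_boundP _))//; first by rewrite divr_ge0 ?mulr_ge0// ltW.
    by rewrite ler_nat; exact: leqW.
  rewrite ler_pdivrMr// => h.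
  have h2 : (2 * k + 3)%:R <= 5 * k.+1%:R :> R by rewrite -natrM ler_nat; lia.
  have h3 : (k.+1 ^ 2)%:R = k.+1%:R * k.+1%:R :> R by rewrite -natrM mulnn.
  have k10 : 0 < k.+1%:R :> R by [].
  rewrite h3 in kN; move: h h2 kN k10.
  move: (k.+1%:R) ((2 * k + 3)%:R) (N%:R) => a b c0 h h2 kN k10.
  have : C * b <= C * (5 * a) by rewrite ler_wpM2l.
  have : 5 * C * a <= a * (e / 2) * a by rewrite ler_wpM2r// ltW.
  have : e / 2 * (a * a) <= e / 2 * c0 by rewrite ler_wpM2l// ltW.
  nra.
nra.
Qed.

Lemma sum_inv_squares (n : nat) : \sum_(i < n) ((i.+1 ^ 2)%:R)^-1 <= 2 :> R.
Proof.
have step (i : nat) : ((i.+1 ^ 2)%:R)^-1 <= 2 * (i.+1%:R^-1 - i.+2%:R^-1) :> R.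
  rewrite natrX -[i.+2%:R]natr1; have : 1 <= i.+1%:R :> R by rewrite ler1n.
  move: (i.+1%:R) => a a1; have a0 : 0 < a by lra.
  rewrite (_ : 2 * _ = 2 / (a * (a + 1))); last first.
    by field; rewrite !gt_eqF// ltr_wpDr.
  rewrite ler_pdivlMr; last by rewrite mulr_gt0// ltr_wpDr.
  rewrite mulrC ler_pdivrMr ?exprn_gt0//; nra.
rewrite (le_trans (ler_sum _ (fun (i : 'I_n) _ => step i)))// -mulr_sumr.
have -> : \sum_(i < n) (i.+1%:R^-1 - i.+2%:R^-1) = 1 - n.+1%:R^-1 :> R.
  elim: n => [|n IH]; first by rewrite big_ord0 invr1 subrr.
  by rewrite big_ord_recr /= IH; ring.
by rewrite -[leRHS]mulr1 ler_wpM2l// lerBlDr lerDl invr_ge0.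
Qed.
End square_gaps.

Section strong_law.
Context (R : realType) (k : nat).
Local Notation G := (SLpm R k).
Local Notation X := (SLquo R k).
Local Notation Om := (seq_space (borel G)).
Variables (nu : probability (borel G) R) (P : probability Om R).
Hypothesis P_prod : is_infinite_product nu P.
Variable x : X.

Lemma measurable_coordinate p : measurable_fun setT (fun b : Om => b p : borel G).
Proof.
by move=> _ A mA; rewrite setTI; apply: sub_sigma_algebra; exists p, A.
Qed.

Definition pos (b : Om) (p : nat) : X := act (walk b p) x.

Lemma posS b p : pos b p.+1 = act (b p) (pos b p).
Proof. by rewrite /pos /= actM. Qed.

Lemma measurable_pos p (F : X -> R) : ucont F -> measurable_fun setT (fun b : Om => F (pos b p)).
Proof.
elim: p F => [|p IH] F uF.
  by rewrite (_ : (fun b : Om => _) = cst (F (act 1%g x))).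
rewrite (_ : (fun b : Om => _) = fun b : Om => F (act (b p) (pos b p))); last first.
  by apply/funext => b; rewrite posS.
have m1 : measurable_fun setT (fun z : borel G * Om => F (act z.1 (pos z.2 p))).
  apply: (measurable_act_pair (y := fun b : Om => pos b p)) => // g.
  exact: (IH (fun y => F (act g y)) (ucont_act g uF)).
have m2 : measurable_fun setT (fun b : Om => ((b p : borel G), b)).
  by apply: measurable_fun_pair => //; exact: measurable_coordinate.
exact: (measurableT_comp m1 m2).
Qed.

(** Forgetting the coordinates from [q] on.  The first [q] coordinates are represented by a sequence
    completed by 1, so that no other product space is needed. *)
Definition trunc (q : nat) (b : Om) : Om := fun p => if (p < q)%N then b p else 1%g.

Lemma walk_trunc q b p : (p <= q)%N -> walk (trunc q b) p = walk b p.
Proof.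
by elim: p => //= p IH pq; rewrite IH ?(ltnW pq)// /trunc pq.
Qed.

Lemma measurable_trunc q : measurable_fun setT (trunc q).
Proof.
apply: (@measurability _ _ Om Om setT _ (@coordinate_sets _ (borel G))) => //.
move=> _ [_ [p [A [mA ->]]] <-]; rewrite setTI.
have [pq|pq] := boolP (p < q)%N.
  rewrite (_ : _ @^-1` _ = (fun b : Om => b p : borel G) @^-1` A).
    by rewrite -[X in measurable X]setTI; exact: measurable_coordinate.
  by apply/seteqP; split=> b /=; rewrite /trunc pq.
have [A1|A1] := pselect (A 1%g).
  rewrite (_ : _ @^-1` _ = setT)//.
  by apply/seteqP; split=> b //= _; rewrite /trunc (negPf pq).
rewrite (_ : _ @^-1` _ = set0)//.
by apply/seteqP; split=> b //=; rewrite /trunc (negPf pq).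
Qed.

(** A pi-system on which the law is given by [P_prod]; it generates the product structure. *)
Definition cylinders : set (set Om) :=
  [set C | exists l (A : nat -> set (borel G)), (forall p, measurable (A p)) /\
     C = [set b | forall p, (p < l)%N -> A p (b p)]].

Lemma measurable_cylinder C : cylinders C -> measurable C.
Proof.
move=> [l [A [mA ->]]].
rewrite (_ : mkset _ = \bigcap_(p in [set p | (p < l)%N]) ((fun b : Om => b p : borel G) @^-1` A p))//.
apply: bigcap_measurableType => p _.
by rewrite -[X in measurable X]setTI; exact: measurable_coordinate.
Qed.

Lemma measurable_cylindersE : measurable = <<s cylinders >>.
Proof.
apply/seteqP; split.
  apply: smallest_sub; first exact: smallest_sigma_algebra.
  move=> _ [p [A [mA ->]]]; apply: sub_sigma_algebra.
  exists p.+1, (fun p' => if p' == p then A else setT); split.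
    by move=> p'; case: ifP.
  apply/seteqP; split=> b /=; first by move=> bA p' _; case: eqP => [->|].
  by move=> /(_ p (ltnSn p)); rewrite eqxx.
apply: smallest_sub; first exact: sigma_algebra_measurable.
exact: measurable_cylinder.
Qed.

Lemma cylindersI : setI_closed cylinders.
Proof.
move=> _ _ [l [A [mA ->]]] [l' [A' [mA' ->]]].
exists (maxn l l'), (fun p => (if (p < l)%N then A p else setT) `&` (if (p < l')%N then A' p else setT)).
split; first by move=> p; apply: measurableI; case: ifP.
apply/seteqP; split=> b /=.
  by move=> [h h'] p _; split; case: ifP => // pl; [exact: h|exact: h'].
move=> h; split=> p pl; have := h p; rewrite leq_max pl ?orbT => /(_ isT)[]; by [].
Qed.

Let ball_ (l : nat) (A : nat -> set (borel G)) : set Om :=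
  [set b | forall p, (p < l)%N -> A p (b p)].

Let P_cyl l (A : nat -> set (borel G)) : (forall p, measurable (A p)) ->
  P (ball_ l A) = (\prod_(p < l) nu (A p))%E.
Proof. exact: P_prod. Qed.

(** Two finite measures that agree on cylinders agree. *)
Lemma trunc_independent q (A1 : set Om) (A2 : set (borel G)) : measurable A1 -> measurable A2 ->
  P (trunc q @^-1` A1 `&` [set b | A2 (b q)]) = (P (trunc q @^-1` A1) * nu A2)%E.
Proof.
move=> mA1 mA2.
have mC : measurable [set b : Om | A2 (b q)].
  by apply: sub_sigma_algebra; exists q, A2.
pose m1 := measure_function_pushforward__canonical__measure_function_Measure
  (mrestr P mC) (measurable_trunc q).
pose m2 := measure_function_pushforward__canonical__measure_function_Measure
  P (measurable_trunc q).
have nuA2 : (0 <= fine (nu A2))%R by rewrite fine_ge0.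
pose m3 := mscale (NngNum nuA2) m2.
have m1E A : m1 A = P (trunc q @^-1` A `&` [set b | A2 (b q)]) by [].
have m3E A : m3 A = ((fine (nu A2))%:E * P (trunc q @^-1` A))%E by [].
have H : m1 A1 = m3 A1.
  apply: (measure_unique cylinders (fun=> setT)) => //.
  - exact: measurable_cylindersE.
  - exact: cylindersI.
  - move=> _; exists 0%N, (fun=> setT); split => //.
    by apply/seteqP; split.
  - by rewrite bigcup_const.
  - move=> C [l [A [mA CE]]]; apply: (etrans (m1E C)); apply/esym.
    apply: (etrans (m3E C)); apply/esym; rewrite {}CE.
    have [A1c|A1c] := pselect (forall p, (p < l)%N -> (q <= p)%N -> A p 1%g); last first.
      have -> : trunc q @^-1` [set b : Om | forall p, (p < l)%N -> A p (b p)] = set0.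
        apply/seteqP; split=> b //= bA; apply: A1c => p pl qp.
        by have := bA p pl; rewrite /trunc ltnNge qp.
      by rewrite set0I !measure0 mule0.
    pose A' p : set (borel G) := if (p < l)%N then A p else setT.
    pose A'' p : set (borel G) := if (p < q)%N then A' p else A2.
    have mA' p : measurable (A' p) by rewrite /A'; case: ifP.
    have mA'' p : measurable (A'' p) by rewrite /A''; case: ifP.
    have E1 : trunc q @^-1` [set b : Om | forall p, (p < l)%N -> A p (b p)] = ball_ q A'.
      apply/seteqP; split=> b /= bA p.
        move=> pq; rewrite /A'; case: ifP => // pl.
        by have := bA p pl; rewrite /trunc pq.
      move=> pl; rewrite /trunc; case: ltnP => pq; last exact: A1c.
      by have := bA p pq; rewrite /A' pl.
    have E2 : ball_ q A' `&` [set b : Om | A2 (b q)] = ball_ q.+1 A''.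
      apply/seteqP; split=> b /=.
        move=> [bA bq] p; rewrite ltnS leq_eqVlt /A'' => /predU1P[->|pq]; first by rewrite ltnn.
        by rewrite pq; exact: bA.
      move=> bA; split; last by have := bA q (ltnSn q); rewrite /A'' ltnn.
      by move=> p pq; have := bA p (ltnW pq); rewrite /A'' pq.
    rewrite E1 E2 !P_cyl// big_ord_recr /= {2}/A'' ltnn muleC; congr (_ * _)%E.
      by rewrite fineK// ge0_fin_numE// (le_lt_trans (probability_le1 _ _)) ?ltry.
    by apply: eq_bigr => p _; rewrite /A'' ltn_ord.
  - move=> _; rewrite [X in (X < _)%E]m1E (le_lt_trans (probability_le1 _ _)) ?ltry//.
    by rewrite preimage_setT setTI.
rewrite -m1E H [LHS]m3E.
rewrite muleC fineK//.
by rewrite ge0_fin_numE// (le_lt_trans (probability_le1 _ _)) ?ltry.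
Qed.

Lemma Rint_independent q (Phi : Om * borel G -> R) : bmeas Phi ->
  \int[P]_b Phi (trunc q b, b q) = \int[P]_b \int[nu]_g Phi (trunc q b, g).
Proof.
move=> bPhi.
have mT : measurable_fun setT (fun b : Om => (trunc q b, (b q : borel G))).
  by apply: measurable_fun_pair; [exact: measurable_trunc|exact: measurable_coordinate].
pose tr : {mfun Om >-> Om} := HB.pack (trunc q)
  (@isMeasurableFun.Build _ _ Om Om _ (measurable_trunc q)).
pose P' := distribution P tr.
have b1 : bmeas (fun b : Om => \int[nu]_g Phi (b, g)) by exact: (bmeas_Rint P nu bPhi).
have PT : (P setT < +oo)%E by exact: probT_lty.
rewrite -(@Rint_image _ _ _ _ _ P P' (trunc q) _ PT (measurable_trunc q) b1)//.
rewrite -(Rint_prod P' nu bPhi); apply/esym.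
apply: (@Rint_image _ _ _ _ _ P _ (fun b : Om => (trunc q b, (b q : borel G)))) => //.
move=> A mA.
pose m' := measure_function_pushforward__canonical__measure_function_Measure P mT.
apply: (@product_measure_unique _ _ _ _ _ P' nu m') => //.
by move=> A1 A2 mA1 mA2; exact: trunc_independent.
Qed.

Section orthogonality.
Variable F : X -> R.
Hypothesis tF : testf F.

(** The average of [F] at [pos b q] is the conditional expectation of [F (pos b q.+1)] given the
    first [q] steps, so these are martingale differences. *)
Definition mdiff (q : nat) (b : Om) : R := F (pos b q.+1) - avg nu F (pos b q).

Let PT : (P setT < +oo)%E. Proof. exact: probT_lty. Qed.

Let bF_step q : bmeas (fun z : Om * borel G => F (act z.2 (pos z.1 q))).
Proof.
have [M FM] := testf_bounded tF; split; last by exists M.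
have m1 : measurable_fun setT (fun z : borel G * Om => F (act z.1 (pos z.2 q))).
  apply: (measurable_act_pair (y := fun b : Om => pos b q)) => // [|g]; first by case: tF.
  by apply: (measurable_pos q (F := fun y => F (act g y))); apply: ucont_act; case: tF.
exact: (measurableT_comp m1 (@measurable_swap _ _ _ _)).
Qed.

Let bF_pos q : bmeas (fun b : Om => F (pos b q)).
Proof.
have [M FM] := testf_bounded tF; split; last by exists M.
by apply: measurable_pos; case: tF.
Qed.

Let bavg_pos q : bmeas (fun b : Om => avg nu F (pos b q)).
Proof. exact: (bmeas_Rint P nu (bF_step q)). Qed.

Let bmdiff q : bmeas (mdiff q).
Proof. by apply: bmeasB; [exact: bF_pos|exact: bavg_pos]. Qed.

Definition martingale (N : nat) (b : Om) : R := \sum_(q < N) mdiff q b.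

Let bmartingale N : bmeas (martingale N).
Proof. by apply: bmeas_sum. Qed.

Let martingale_trunc N b : martingale N (trunc N b) = martingale N b.
Proof.
apply: eq_bigr => q _; rewrite /mdiff /pos !walk_trunc//.
exact: ltnW.
Qed.

Let ortho N : \int[P]_b (martingale N b * mdiff N b) = 0.
Proof.
pose Phi (z : Om * borel G) := martingale N z.1 * (F (act z.2 (pos z.1 N)) - avg nu F (pos z.1 N)).
have bm : bmeas (fun z : Om * borel G => avg nu F (pos z.1 N)).
  exact: (bmeas_comp (@measurable_fst _ _ _ _) (bavg_pos N)).
have bPhi : bmeas Phi.
  apply: bmeasM; first exact: (bmeas_comp (@measurable_fst _ _ _ _) (bmartingale N)).
  exact: bmeasB.
have nuT : (nu setT < +oo)%E by exact: probT_lty.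
transitivity (\int[P]_b Phi (trunc N b, b N)).
  apply: eq_Rintegral => b _; rewrite /Phi /= martingale_trunc /mdiff posS.
  by rewrite /pos walk_trunc.
rewrite Rint_independent//.
rewrite -[RHS](Rint_cst (probability_setT P)); apply: eq_Rintegral => b _.
have bg : bmeas (fun g : borel G => F (act g (pos (trunc N b) N))) by exact: bmeas_actl.
rewrite /Phi /= RintZ//; last by apply: bmeasB => //; exact: bmeas_cst.
rewrite RintB//; last exact: bmeas_cst.
by rewrite (Rint_cst (probability_setT nu)) subrr mulr0.
Qed.

Let mdiff_bound M : (forall y, `|F y| <= M) -> forall q b, `|mdiff q b| <= 2 * M.
Proof.
move=> FM q b; rewrite (le_trans (ler_normB _ _))//.
by have := FM (pos b q.+1); have := avg_bound nu tF FM (pos b q); lra.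
Qed.

Let martingale_sq M N : (forall y, `|F y| <= M) ->
  \int[P]_b (martingale N b ^+ 2) <= N%:R * (2 * M) ^+ 2.
Proof.
move=> FM; elim: N => [|N IH].
  under eq_Rintegral do rewrite /martingale big_ord0 expr0n.
  by rewrite (Rint_cst (probability_setT P)) mul0r.
have -> : \int[P]_b (martingale N.+1 b ^+ 2) = \int[P]_b (martingale N b ^+ 2) + \int[P]_b (mdiff N b ^+ 2).
  transitivity (\int[P]_b (martingale N b ^+ 2 + mdiff N b ^+ 2 + 2 * (martingale N b * mdiff N b))).
    by apply: eq_Rintegral => b _; rewrite /martingale big_ord_recr /=; ring.
  have b3 : bmeas (fun b : Om => 2 * (martingale N b * mdiff N b)).
    by apply: bmeasM; [exact: bmeas_cst|exact: bmeasM].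
  rewrite RintD//; last by apply: bmeasD; exact: bmeasX2.
  rewrite RintD//; [|exact: bmeasX2..].
  by rewrite RintZ ?ortho ?mulr0 ?addr0//; exact: bmeasM.
rewrite -natr1 mulrDl mul1r lerD// -[leRHS](Rint_cst (probability_setT P)).
apply: le_Rint => //; [exact: bmeasX2|exact: bmeas_cst|].
by move=> b; rewrite -real_normK ?num_real// ler_pXn2r ?nnegrE ?mdiff_bound// (le_trans _ (mdiff_bound FM N b)).
Qed.

(** Martingale differences are orthogonal in L^2, so their sum over [N] terms has variance [O(N)];
    along [N = (k + 1)^2] the variances of the averages are summable. *)
Lemma martingale_average :
  {ae P, forall b : Om, (\sum_(q < N) (F (pos b q.+1) - avg nu F (pos b q))) / N%:R
     @[N --> \oo] --> (0 : R)}.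
Proof.
have [M FM] := testf_bounded tF.
pose u (k0 : nat) (b : Om) : R := (martingale (k0.+1 ^ 2) b / (k0.+1 ^ 2)%:R) ^+ 2.
have bu k0 : bmeas (u k0).
  by apply: bmeasX2; apply: bmeasM => //; exact: bmeas_cst.
have uI k0 : \int[P]_b u k0 b <= (2 * M) ^+ 2 * ((k0.+1 ^ 2)%:R)^-1.
  have q0 : 0 < (k0.+1 ^ 2)%:R :> R by rewrite ltr0n expn_gt0.
  rewrite /u; under eq_Rintegral do rewrite exprMn mulrC.
  rewrite RintZ//; last exact: bmeasX2.
  have := martingale_sq (k0.+1 ^ 2) FM; move: (\int[P]_b _) ((k0.+1 ^ 2)%:R) q0 => I a a0 h.
  rewrite exprVn mulrC ler_pdivrMr ?exprn_gt0//.
  rewrite (_ : (2 * M) ^+ 2 / a * a ^+ 2 = a * (2 * M) ^+ 2)//.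
  by field; rewrite gt_eqF.
have := @ae_bounded_series _ _ _ P PT u ((2 * M) ^+ 2 * 2) bu (fun _ _ => sqr_ge0 _).
have h n0 : \sum_(i < n0) \int[P]_b u i b <= (2 * M) ^+ 2 * 2.
  apply: (@le_trans _ _ (\sum_(i < n0) (2 * M) ^+ 2 * ((i.+1 ^ 2)%:R)^-1)).
    exact: ler_sum.
  by rewrite -mulr_sumr ler_wpM2l ?sqr_ge0// sum_inv_squares.
move=> /(_ h); apply: filterS => b bK.
apply: (@cvg_average_squares _ (fun q => mdiff q b) (2 * M)); first by move=> q; exact: mdiff_bound.
have /cvg_series_cvg_0 := bounded_series_cvg (u := u ^~ b) (fun i => sqr_ge0 _) bK.
rewrite /u => u0.
have : Num.sqrt ((martingale (i.+1 ^ 2) b / (i.+1 ^ 2)%:R) ^+ 2) @[i --> \oo] --> (0 : R).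
  by rewrite -(@sqrtr0 R); apply: continuous_cvg => //; exact: sqrt_continuous.
by under eq_fun do rewrite sqrtr_sqr; exact: norm_cvg0.
Qed.

End orthogonality.

End strong_law.

(** * Separability of the space of test functions *)

Section separability.
Context (R : realType) (k : nat).
Local Notation G := (SLpm R k).
Local Notation X := (SLquo R k).
Local Notation pi := (\pi_(SLquo R k)).
Implicit Types (f : X -> R) (y : X).

Definition bump (q : 'M[rat]_k) (N : nat) y : R :=
  Num.max 0 (Num.min 1 (2 - N.+1%:R * hgt (map_mx ratr q) y)).

Lemma bump_ge0 q N y : 0 <= bump q N y.
Proof. by rewrite /bump le_max lexx. Qed.

Lemma bump_le1 q N y : bump q N y <= 1.
Proof. by rewrite /bump ge_max ler01 ge_min lexx. Qed.

Lemma bump_eq1 q N y : hgt (map_mx ratr q) y < N.+1%:R^-1 -> bump q N y = 1.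
Proof.
rewrite -[ltRHS]mul1r ltr_pdivlMr// mulrC => h.
by rewrite /bump min_l ?max_r//; lra.
Qed.

Lemma bump_gt0 q N y : 0 < bump q N y -> hgt (map_mx ratr q) y < 2 / N.+1%:R.
Proof.
by rewrite /bump lt_max ltxx /= lt_min ltr01 /= ltr_pdivlMr// mulrC subr_gt0.
Qed.

Lemma continuous_maxf (f f' : X -> R) : continuous f -> continuous f' ->
  continuous (fun y => Num.max (f y) (f' y)).
Proof. by move=> fc fc' y; exact: (@continuous_max R X f f' y (fc y) (fc' y)). Qed.

Lemma continuous_minf (f f' : X -> R) : continuous f -> continuous f' ->
  continuous (fun y => Num.min (f y) (f' y)).
Proof. by move=> fc fc' y; exact: (@continuous_min R X f f' y (fc y) (fc' y)). Qed.

Lemma testf_bump q N : testf (bump q N).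
Proof.
have bc : continuous (bump q N).
  have c0 (c : R) : continuous (fun _ : X => c) by exact: cst_continuous.
  apply: continuous_maxf => //; apply: continuous_minf => //.
  move=> y; exact: cvgB (c0 2 y) (cvgM (c0 N.+1%:R y) (@continuous_hgt R k (map_mx ratr q) y)).
suff h : hsupp (bump q N) by split => //; exact: hsupp_ucont.
exists (2 + nrm (map_mx ratr q : 'M[R]_k)) => y yN; apply/eqP; rewrite eq_le bump_ge0 andbT.
  rewrite leNgt; apply/negP => /bump_gt0/hgt_lt[g gy gq].
  move: yN; rewrite ltNge => /negP; apply; rewrite -gy (le_trans (hgt_le _ _))// subr0.
  rewrite -[SLpm_mx g](subrK (map_mx ratr q)) (le_trans (nrmD _ _))// lerD2r.
  by rewrite (le_trans (ltW gq))// ler_pdivrMr// ler_peMr// ler1n.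
Qed.

Lemma testf_max f f' : testf f -> testf f' -> testf (fun y => Num.max (f y) (f' y)).
Proof.
move=> tf tf'; have c := continuous_maxf (testf_continuous tf) (testf_continuous tf').
suff h : hsupp (fun y => Num.max (f y) (f' y)) by split => //; exact: hsupp_ucont.
case: tf tf' => _ [n fn] [_ [n' fn']]; exists (Num.max n n') => y.
by rewrite gt_max => /andP[/fn -> /fn' ->]; rewrite maxxx.
Qed.

Local Notation code := (rat * ('M[rat]_k * nat))%type.

Definition maxbump (s : seq code) y : R :=
  foldr (fun c r => Num.max (ratr c.1 * bump c.2.1 c.2.2 y) r) 0 s.

Lemma testf_maxbump s : testf (maxbump s).
Proof.
elim: s => [|c s IH] /=; first exact: testf0.
by apply: testf_max => //; apply: testfZ; exact: testf_bump.
Qed.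

Lemma rational_matrix (A : 'M[R]_k) e : 0 < e -> exists q : 'M[rat]_k, nrm (A - map_mx ratr q) < e.
Proof.
move=> e0; pose d := e / (k * k).+1%:R; have d0 : 0 < d by rewrite divr_gt0.
have h (ij : 'I_k * 'I_k) : exists q : rat, `|A ij.1 ij.2 - ratr q| <= d.
  have [|q] := @rat_in_itvoo R (A ij.1 ij.2) (A ij.1 ij.2 + d); first by rewrite ltrDl.
  rewrite in_itv /= => /andP[q1 q2]; exists q.
  by rewrite ler_norml; apply/andP; split; lra.
have [q qP] := choice h; exists (\matrix_(i, j) q (i, j)); apply: nrm_lt => // i j.
by rewrite !mxE; exact: (qP (i, j)).
Qed.

(** Around each point of the compact set that carries [f], take a bump with rational centre,
    of a radius at which [f] varies by less than [e], scaled by a rational value between [f] and [f + e].  The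
    maximum over a finite subcover is squeezed: each scaled bump is at most [f + 2 e] because the
    bump lives where [f] is close to its scale, and at each point some bump equals 1. *)
Lemma maxbump_dense f e : testf f -> (forall y, 0 <= f y) -> 0 < e ->
  exists s, forall y, `|f y - maxbump s y| <= 2 * e.
Proof.
move=> tf f0 e0; have [_ [n fn]] := tf; have fc := testf_continuous tf.
pose good : set code := [set c | 0 <= (ratr c.1 : R) /\
  forall y, 0 < bump c.2.1 c.2.2 y -> `|f y - ratr c.1| <= 2 * e].
pose U (c : code) : set X := [set y | hgt (map_mx ratr c.2.1) y < c.2.2.+1%:R^-1].
have cov : [set y : X | hgt 0 y <= n] `<=` cover good U.
  move=> y _; have [g0 gy] := piP y.
  have [uf _] := tf; have [d d0 dP] := uf _ e0.
  pose K := nrm (SLpm_mx (g0^-1)%g) + 1; have K0 : 0 < K by rewrite ltr_wpDl// nrm_ge0.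
  pose N := Num.bound (3 * K / d).
  have Nd : 3 / N.+1%:R * K < d.
    have := @archi_boundP R (3 * K / d); rewrite divr_ge0 ?mulr_ge0 ?ltW// => /(_ isT).
    rewrite ltr_pdivrMr// => h; rewrite mulrAC ltr_pdivrMr// (lt_le_trans h)//.
    by rewrite mulrC ler_pM2l// ler_nat.
  have dl0 : 0 < N.+1%:R^-1 :> R by rewrite invr_gt0.
  have [q qg] := rational_matrix (SLpm_mx g0) dl0.
  have [|v] := @rat_in_itvoo R (f y) (f y + e); first by rewrite ltrDl.
  rewrite in_itv /= => /andP[v1 v2].
  exists (v, (q, N)); last first.
    by rewrite /U /= -gy (le_lt_trans (hgt_le _ _)).
  split => /=; first by rewrite (le_trans (f0 y))// ltW.
  move=> y' /bump_gt0/hgt_lt[g' gy' gq'].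
  have : `|f y' - f y| < e.
    rewrite -gy -gy' -(mulgVK g0 g') -act_pi; apply: dP.
    rewrite -(mulgV g0) (le_lt_trans (sdistMr _ _ _))// (le_lt_trans _ Nd)//.
    rewrite ler_pM ?sdist_ge0 ?nrm_ge0// ?lerDl//.
    rewrite /sdist (le_trans (nrmB_tri (map_mx ratr q) _ _))//.
    rewrite (_ : 3 / _ = 2 / N.+1%:R + N.+1%:R^-1); last by ring.
    by apply: lerD; [exact: ltW|rewrite nrmBC ltW].
  rewrite ltr_norml ler_norml => /andP[a1 a2]; apply/andP; split; lra.
have := @compact_hgt R k 0 n; rewrite compact_cover => /(_ _ good U).
move=> [|//|D Dgood Dcov].
  move=> c _; rewrite /U (_ : [set y | _] = hgt (map_mx ratr c.2.1) @^-1` [set r | r < c.2.2.+1%:R^-1])//.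
  by apply: open_comp; [move=> y _; exact: continuous_hgt|exact: open_lt].
have mb_ge (s : seq code) c y : c \in s -> ratr c.1 * bump c.2.1 c.2.2 y <= maxbump s y.
  elim: s => //= c' s IH; rewrite inE le_max => /predU1P[->|cs]; first by rewrite lexx.
  by rewrite IH ?orbT.
have mb_le (s : seq code) y r : 0 <= r -> (forall c, c \in s -> ratr c.1 * bump c.2.1 c.2.2 y <= r) ->
    maxbump s y <= r.
  move=> r0; elim: s => //= c s IH h; rewrite ge_max h ?mem_head// IH// => c' c's.
  by apply: h; rewrite inE c's orbT.
exists D => y; rewrite ler_norml; apply/andP; split.
  rewrite lerBrDl lerBlDr; apply: mb_le.
    by rewrite addr_ge0// mulr_ge0// ltW.
  move=> c cD; have [c0 /(_ y) h] : good c by apply: set_mem; apply: Dgood.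
  have := bump_ge0 c.2.1 c.2.2 y; rewrite le_eqVlt => /predU1P[<-|bp].
    by rewrite mulr0 addr_ge0// mulr_ge0// ltW.
  have := h bp; rewrite ler_norml => /andP[h1 h2].
  have := bump_le1 c.2.1 c.2.2 y => b1.
  by rewrite (@le_trans _ _ (ratr c.1))//; [rewrite ler_piMr|lra].
have [yn|yn] := leP (hgt 0 y) n; last first.
  have mb0 (s : seq code) : 0 <= maxbump s y.
    by elim: s => //= c s IH; rewrite le_max IH orbT.
  by rewrite fn// sub0r (@le_trans _ _ 0) ?oppr_le0 ?mb0// mulr_ge0// ltW.
have [c /= cD yc] := Dcov y yn.
have [c0 /(_ y) h] : good c by apply: set_mem; apply: Dgood.
have b1 := bump_eq1 yc; have := mb_ge D c y cD; rewrite b1 mulr1 => mc.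
have := h; rewrite b1 ltr01 ler_norml => /(_ isT)/andP[h1 h2]; lra.
Qed.

(** Apply the density of maxima of bumps to the positive and the negative parts. *)
Lemma testf_separable : exists D : nat -> X -> R, (forall i, testf (D i)) /\
  forall f e, testf f -> 0 < e -> exists i, forall y, `|f y - D i y| <= e.
Proof.
pose D (i : nat) : X -> R := if (@choice.unpickle (seq code * seq code)%type i) is Some s
  then fun y => maxbump s.1 y + -1 * maxbump s.2 y else fun=> 0.
exists D; split.
  move=> i; rewrite /D; case: choice.unpickle => [s|]; last exact: testf0.
  by apply: testfD; [exact: testf_maxbump|apply: testfZ; exact: testf_maxbump].
move=> f e tf e0; have e4 : 0 < e / 4 by rewrite divr_gt0.
have tp : testf (fun y => Num.max (f y) 0) by apply: testf_max => //; exact: testf0.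
have tn : testf (fun y => Num.max (-1 * f y) 0).
  by apply: testf_max; [exact: testfZ|exact: testf0].
have [|s1 s1P] := maxbump_dense tp _ e4; first by move=> y; rewrite le_max lexx orbT.
have [|s2 s2P] := maxbump_dense tn _ e4; first by move=> y; rewrite le_max lexx orbT.
exists (choice.pickle (s1, s2)) => y; rewrite /D choice.pickleK /=.
have -> : f y = Num.max (f y) 0 - Num.max (-1 * f y) 0.
  rewrite mulN1r; case: (leP 0 (f y)) => h.
    by rewrite max_r ?subr0// oppr_le0.
  by rewrite max_l ?oppr_ge0 ?(ltW h)// opprK add0r.
have := s1P y; have := s2P y; rewrite !ler_norml => /andP[a1 a2] /andP[b1 b2].
by apply/andP; split; lra.
Qed.

End separability.

(** * Empirical measures of the flow and of the walk *)

Section sums_of_measures.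
Context d (T : measurableType d) (R : realType).

(** Reduction to nonnegative functions, whose integrals are additive and homogeneous in the measure
    by monotone approximation. *)
Lemma Rint_shift (m : {measure set T -> \bar R}) f M : (m setT < +oo)%E -> bmeas f ->
  (forall x, `|f x| <= M) -> \int[m]_x f x = \int[m]_x (f x + M) - M * fine (m setT).
Proof.
move=> mT bf fM; rewrite RintD//; last exact: bmeas_cst.
by rewrite Rintegral_cst// addrK.
Qed.

Lemma Rint_msum (m_ : nat -> {measure set T -> \bar R}) N f :
  (forall n, (m_ n setT < +oo)%E) -> bmeas f ->
  \int[msum m_ N]_x f x = \sum_(n < N) \int[m_ n]_x f x.
Proof.
move=> mT bf; have [mf [M fM]] := bf.
have sT : (msum m_ N setT < +oo)%E.
  by rewrite /msum; apply: lte_sum_pinfty => n _; exact: mT.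
have bfM : bmeas (fun x => f x + M) by apply: bmeasD => //; exact: bmeas_cst.
have f0 x : 0 <= f x + M by have := fM x; rewrite ler_norml => /andP[]; lra.
rewrite (Rint_shift sT bf fM).
under eq_bigr => n _ do rewrite (Rint_shift (mT n) bf fM).
rewrite big_split /=; congr (_ + _).
  apply: EFin_inj; rewrite (EFin_Rint sT bfM) -sumEFin.
  under [RHS]eq_bigr => n _ do rewrite (EFin_Rint (mT n) bfM).
  apply: ge0_integral_measure_sum => //.
  - by move=> x _; rewrite lee_fin.
  - by apply/measurable_EFinP; case: bfM.
rewrite sumrN -mulr_sumr; congr (- (_ * _)); rewrite /msum.
by rewrite sum_fine// => n _; rewrite ge0_fin_numE.
Qed.

Lemma Rint_mscale (m : {measure set T -> \bar R}) (c : {nonneg R}) f :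
  (m setT < +oo)%E -> bmeas f -> \int[mscale c m]_x f x = c%:num * \int[m]_x f x.
Proof.
move=> mT bf; have [mf [M fM]] := bf.
have sT : (mscale c m setT < +oo)%E by rewrite /mscale lte_mul_pinfty// lee_fin.
have bfM : bmeas (fun x => f x + M) by apply: bmeasD => //; exact: bmeas_cst.
have f0 x : 0 <= f x + M by have := fM x; rewrite ler_norml => /andP[]; lra.
rewrite (Rint_shift sT bf fM) (Rint_shift mT bf fM) mulrBr; congr (_ - _).
  apply: EFin_inj; rewrite (EFin_Rint sT bfM) EFinM (EFin_Rint mT bfM).
  apply: ge0_integral_mscale => //.
  - by apply/measurable_EFinP; case: bfM.
  - by move=> x _; rewrite lee_fin.
rewrite /mscale fineM//; last by rewrite ge0_fin_numE.
by rewrite mulrCA.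
Qed.

Lemma Rint_dirac (a : T) (f : T -> R) : measurable_fun setT f -> \int[\d_ a]_x f x = f a.
Proof.
move=> mf; rewrite /Rintegral integral_dirac//; last exact/measurable_EFinP.
by rewrite diracT mul1e.
Qed.

End sums_of_measures.

Section intervals.
Context (R : realType).
Local Notation leb := (@lebesgue_measure R).
Implicit Types (a b c : R) (f : measurableTypeR R -> R).

(** Lebesgue measure on a closed interval, as a measure on the whole line: integrals against it are
    integrals of a finite measure.  Endpoints overlap harmlessly in [leb_itvU]. *)
Definition leb_itv a b : {measure set (measurableTypeR R) -> \bar R} :=
  mrestr leb (measurable_itv `[a, b]).

Lemma leb_itv_setT a b : a <= b -> leb_itv a b setT = (b - a)%:E.
Proof.
move=> ab; rewrite /leb_itv /= /mrestr setTI lebesgue_measure_itv /= lte_fin.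
by move: ab; rewrite le_eqVlt => /predU1P[->|->]//; rewrite ltxx subrr.
Qed.

Lemma leb_itv_lty a b : (leb_itv a b setT < +oo)%E.
Proof.
rewrite /leb_itv /= /mrestr setTI lebesgue_measure_itv /=.
by case: ifP => _; rewrite ?ltry// -EFinB ltry.
Qed.

Lemma leb_itvU a b c (A : set (measurableTypeR R)) : a <= b -> b <= c -> measurable A ->
  leb_itv a c A = (leb_itv a b A + leb_itv b c A)%E.
Proof.
move=> ab bc mA; rewrite /leb_itv /= /mrestr.
have m1 : measurable (A `&` `]b, c] : set (measurableTypeR R)) by exact: measurableI.
have -> : leb (A `&` `[b, c]) = leb (A `&` `]b, c]).
  apply/eqP; rewrite eq_le; apply/andP; split; last first.
    apply: le_measure; rewrite ?inE//=; first exact: measurableI.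
    by apply: setIS => t /=; rewrite !in_itv /= => /andP[/ltW -> ->].
  have -> : leb (A `&` `]b, c]) = (leb (A `&` `]b, c]) + leb [set b])%E.
    by rewrite lebesgue_measure_set1 adde0.
  apply: le_trans (measureU2 _ _ _) => //.
  apply: le_measure; rewrite ?inE//=; [exact: measurableI|exact: measurableU|].
  move=> t [At] /=; rewrite in_itv /= le_eqVlt => /andP[/predU1P[->|bt] tc]; [by right|].
  by left; split => //=; rewrite in_itv /= bt.
rewrite -measureU//; first 1 last.
- exact: measurableI.
- apply/seteqP; split=> // t [[_ /=]]; rewrite in_itv /= => /andP[_ tb] [_ /=].
  by rewrite in_itv /= ltNge tb.
congr (leb _); apply/seteqP; split=> t /=; rewrite !in_itv /=.
  move=> [At /andP[at_ tc]]; case: (leP t b) => tb; [left|right]; split => //.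
    by rewrite at_.
move=> [] [At /andP[h1 h2]]; split => //; apply/andP; split => //.
- exact: le_trans bc.
- exact: le_trans ab (ltW h1).
Qed.

Lemma leb_itv_shift s a b (A : set (measurableTypeR R)) : measurable A ->
  leb_itv (a + s) (b + s) A = leb_itv a b ((fun t => t + s) @^-1` A).
Proof.
move=> mA; rewrite /leb_itv /= /mrestr (lebesgue_translate s); last exact: measurableI.
by congr (leb _); apply/seteqP; split=> t /=; rewrite !in_itv /= !lerD2r.
Qed.

Lemma leb_itv_ae a b : {ae leb_itv a b, forall t, a <= t <= b}.
Proof.
exists (~` `[a, b]); split; first exact: measurableC.
  by rewrite /leb_itv /= /mrestr setICl measure0.
by move=> t /= h; apply: contra_not h => /=; rewrite in_itv.
Qed.

Lemma itvint_cat a b c f : a <= b -> b <= c -> bmeas f ->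
  \int[leb_itv a c]_t f t = \int[leb_itv a b]_t f t + \int[leb_itv b c]_t f t.
Proof.
move=> ab bc bf.
pose m_ n := if n is 0%N then leb_itv a b else leb_itv b c.
have mT n : (m_ n setT < +oo)%E by case: n => [|n]; exact: leb_itv_lty.
transitivity (\int[msum m_ 2]_t f t); last by rewrite Rint_msum// !big_ord_recl big_ord0 addr0.
rewrite /Rintegral; congr fine; apply: eq_measure_integral => A mA _.
by rewrite [RHS](_ : _ = \sum_(i < 2) m_ i A)%E//; rewrite !big_ord_recl big_ord0 adde0; exact: leb_itvU.
Qed.

Lemma itvint_le a b f g : bmeas f -> bmeas g -> (forall t, a <= t <= b -> f t <= g t) ->
  \int[leb_itv a b]_t f t <= \int[leb_itv a b]_t g t.
Proof.
move=> bf bg fg; apply: le_Rint_ae_finite => //; first exact: leb_itv_lty.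
have FF : Filter (almost_everywhere (leb_itv a b)) by exact: ae_filter_ringOfSetsType.
by apply: filterS (leb_itv_ae a b) => t; exact: fg.
Qed.

Lemma itvint_cst a b c : a <= b -> \int[leb_itv a b]_t c = c * (b - a).
Proof. by move=> ab; rewrite Rintegral_cst// leb_itv_setT. Qed.

Lemma itvint_mono a b c f : a <= b -> b <= c -> bmeas f -> (forall t, 0 <= f t) ->
  \int[leb_itv a b]_t f t <= \int[leb_itv a c]_t f t.
Proof.
move=> ab bc bf f0; rewrite (itvint_cat ab bc bf) lerDl; exact: Rint_ge0.
Qed.

Lemma itvint_steps (S : nat -> R) f N : {homo S : p q / (p <= q)%N >-> p <= q} -> bmeas f ->
  \int[leb_itv (S 0%N) (S N)]_t f t = \sum_(p < N) \int[leb_itv (S p) (S p.+1)]_t f t.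
Proof.
move=> Smono bf; elim: N => [|N IH].
  rewrite big_ord0; apply/eqP; rewrite eq_le; have [mf [M fM]] := bf.
  have c0 (r : R) : \int[leb_itv (S 0%N) (S 0%N)]_t r = 0 by rewrite itvint_cst// subrr mulr0.
  have fMM t : - M <= f t <= M by rewrite -ler_norml.
  apply/andP; split; [rewrite -[leRHS](c0 M)|rewrite -[leLHS](c0 (- M))].
    by apply: itvint_le => // [|t _]; [exact: bmeas_cst|case/andP: (fMM t)].
  by apply: itvint_le => // [|t _]; [exact: bmeas_cst|case/andP: (fMM t)].
by rewrite big_ord_recr /= -IH -itvint_cat//; exact: Smono.
Qed.

Lemma itvint_shift s a b f : bmeas f ->
  \int[leb_itv (a + s) (b + s)]_t f t = \int[leb_itv a b]_t f (t + s).
Proof.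
move=> bf; apply: (@Rint_image _ _ (measurableTypeR R) (measurableTypeR R) R (leb_itv a b)
  (leb_itv (a + s) (b + s)) (fun t : measurableTypeR R => t + s) f) => //.
- exact: leb_itv_lty.
- by apply: measurable_funD => //; exact: measurable_cst.
- by move=> A mA; exact: leb_itv_shift.
Qed.

End intervals.

Section empirical_measures.
Context (R : realType) (m n : nat) (n_gt0 : (0 < n)%N).
Local Notation X := (SLquo R (m + n)).
Implicit Types (x : X) (f : borel X -> R).

Lemma Rint_walk_average (b : nat -> SLpm R (m + n)) x N f : bmeas f ->
  \int[walk_average b x N]_y f y = (\sum_(p < N) f (act (walk b p.+1) x)) / N%:R.
Proof.
move=> bf; rewrite Rint_mscale//; last first.
  by rewrite /msum /=; apply: lte_sum_pinfty => p _; rewrite /= diracT ltry.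
rewrite mulrC Rint_msum//; last by move=> p; rewrite /= diracT ltry.
by congr (_ * _); apply: eq_bigr => p _; rewrite Rint_dirac//; case: bf.
Qed.

Let walk_average_setTE (b : nat -> SLpm R (m + n)) x N :
  walk_average b x N setT = (N%:R^-1 * N%:R)%:E.
Proof.
rewrite EFinM; congr (_ * _)%E; rewrite -[N in RHS]card_ord -sumr_const -sumEFin.
by apply: eq_bigr => p _; exact: diracT.
Qed.

Lemma walk_average_setT (b : nat -> SLpm R (m + n)) x N : (0 < N)%N ->
  walk_average b x N setT = 1%E.
Proof. by move=> N0; rewrite walk_average_setTE mulVf// pnatr_eq0 -lt0n. Qed.

Lemma walk_average_lty (b : nat -> SLpm R (m + n)) x N : (walk_average b x N setT < +oo)%E.
Proof. by rewrite walk_average_setTE ltry. Qed.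

Lemma bmeas_orbit x f : bmeas f -> bmeas (fun t : measurableTypeR R => f (act (flow m n_gt0 t) x)).
Proof. by apply: bmeas_comp; exact: measurable_orbit_map. Qed.

Lemma Rint_time_average x T f : 0 <= T -> bmeas f ->
  \int[time_average n_gt0 x T]_y f y =
  T^-1 * \int[leb_itv 0 T]_t f (act (flow m n_gt0 t) x).
Proof.
move=> T0 bf; have lT := leb_itv_lty 0 T.
rewrite Rint_mscale//= ger0_norm//; congr (_ * _).
by apply: Rint_image => //; exact: measurable_orbit_map.
Qed.

Lemma time_average_setT x T : 0 < T -> time_average n_gt0 x T setT = 1%E.
Proof.
move=> T0; rewrite /time_average /= /mscale /= ger0_norm ?ltW//.
rewrite [orbit_measure _ _ _ _](_ : _ = leb_itv 0 T setT)//.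
by rewrite leb_itv_setT ?ltW// subr0 -EFinM mulVf// gt_eqF.
Qed.

Lemma time_average_lty x T : (time_average n_gt0 x T setT < +oo)%E.
Proof.
rewrite /time_average /= /mscale /=; apply: lte_mul_pinfty => //; last exact: (leb_itv_lty 0 T).
Qed.

End empirical_measures.

(** * Transfer of equidistribution through nearly constant functions *)

Section transfer.
Context (R : realType) (k : nat).
Local Notation X := (SLquo R k).
Local Notation G := (SLpm R k).
Implicit Types (f F : X -> R) (c dl : R) (g : G).
Variables (J K : Type) (FJ : set_system J) (FK : set_system K).
Context {FF : Filter FJ} {FFK : Filter FK}.
Variables (W : J -> {measure set (borel X) -> \bar R}).
Variables (A : K -> {measure set (borel X) -> \bar R}).
Variable mu : probability (borel X) R.
Hypothesis mu_inv : act_invariant mu.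
Hypothesis WT : forall j, (W j setT < +oo)%E.
Hypothesis W1 : \forall j \near FJ, W j setT = 1%E.
Hypothesis AT : forall i, (A i setT < +oo)%E.
Hypothesis A1 : \forall i \near FK, A i setT = 1%E.
Hypothesis A_mu : weak_star_cvg FK A mu.

Let sq_expand (a b : R) : (a - b) ^+ 2 = (a ^+ 2 + (- (2 * b)) * a) + b ^+ 2.
Proof. by ring. Qed.

Let Rint_sq (m : {measure set (borel X) -> \bar R}) F c : (m setT < +oo)%E -> m setT = 1%E ->
  testf F -> \int[m]_y (F y - c) ^+ 2 = \int[m]_y (F y ^+ 2 + (- (2 * c)) * F y) + c ^+ 2.
Proof.
move=> mT m1 tF.
have tp : testf (fun y => F y ^+ 2 + (- (2 * c)) * F y).
  by apply: testfD; [exact: testfX2|exact: testfZ].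
rewrite -[X in _ + X](Rint_cst m1) -(RintD mT (bmeas_testf tp) (bmeas_cst _ _)).
by apply: eq_Rintegral => y _; exact: sq_expand.
Qed.

(** Expanding the square leaves a test function and a constant, and [mu] is invariant. *)
Lemma cvg_square F c g : testf F ->
  \int[A i]_y (F (act g y) - c) ^+ 2 @[i --> FK] --> \int[mu]_y (F y - c) ^+ 2.
Proof.
move=> tF; have tFg := testf_act g tF.
have tp : testf (fun y => F (act g y) ^+ 2 + (- (2 * c)) * F (act g y)).
  by apply: testfD; [exact: testfX2|exact: testfZ].
have muT := probT_lty mu; have mu1 := probability_setT mu.
have b2 : bmeas (fun y : borel X => (F y - c) ^+ 2).
  by apply: bmeasX2; apply: bmeasB; [exact: bmeas_testf|exact: bmeas_cst].
rewrite -(Rint_act g mu_inv b2) (Rint_sq c muT mu1 tFg).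
apply: (@cvg_trans _ ((fun i => \int[A i]_y (F (act g y) ^+ 2 + (- (2 * c)) * F (act g y)) + c ^+ 2) @ FK)).
  apply: near_eq_cvg; apply: filterS A1 => i i1.
  by rewrite (Rint_sq c (AT i) i1 tFg).
apply: cvgD; last exact: cvg_cst.
by have [tpc tps] := (testfP _).1 tp; exact: A_mu.
Qed.

(** By Cauchy-Schwarz [(W_j F - c)^2 <= W_j ((F - c)^2)], which is dominated by averages [A_i] that
    converge to [\int (F - c)^2 d mu]; and [W_j f] may be replaced by [W_j F].  Both implications of
    the theorem are instances, with the roles of flow and walk exchanged. *)
Lemma transfer_step (kap : J -> K) f F c C eps dl (gs : seq G) :
  kap j @[j --> FJ] --> FK -> testf f -> testf F ->
  \int[W j]_y f y - \int[W j]_y F y @[j --> FJ] --> 0 ->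
  (\forall j \near FJ, \int[W j]_y (F y - c) ^+ 2 <=
     C * (eps ^+ 2 + \sum_(g <- gs) \int[A (kap j)]_y (F (act g y) - c) ^+ 2)) ->
  (size gs)%:R * \int[mu]_y (F y - c) ^+ 2 <= eps ^+ 2 ->
  0 < eps -> 0 <= C -> 0 < dl -> C * (3 * eps ^+ 2) <= (dl / 2) ^+ 2 ->
  \forall j \near FJ, `|\int[W j]_y f y - c| <= dl.
Proof.
move=> kapK tf tF fF dom sml eps0 C0 dl0 Cdl.
have sK : \sum_(g <- gs) \int[A i]_y (F (act g y) - c) ^+ 2 @[i --> FK]
    --> (size gs)%:R * \int[mu]_y (F y - c) ^+ 2.
  elim: gs {dom sml} => [|g gs IH].
    by rewrite mul0r; under eq_fun do rewrite big_nil; exact: cvg_cst.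
  under eq_fun do rewrite big_cons.
  by rewrite /= -natr1 mulrDl mul1r addrC; apply: cvgD => //; exact: cvg_square.
have sJ := cvg_comp kap _ kapK sK.
have e2 : 0 < eps ^+ 2 by rewrite exprn_gt0.
have dl2 : 0 < dl / 2 by rewrite divr_gt0.
have /cvgrPdist_lt/(_ _ e2) near1 := sJ.
have /cvgrPdist_lt/(_ _ dl2) near2 := fF.
have near12 : \forall j \near FJ, `|(size gs)%:R * \int[mu]_y (F y - c) ^+ 2 -
    \sum_(g <- gs) \int[A (kap j)]_y (F (act g y) - c) ^+ 2| < eps ^+ 2 /\
    `|0 - (\int[W j]_y f y - \int[W j]_y F y)| < dl / 2.
  by apply: filterI.
have nearW : \forall j \near FJ, (\int[W j]_y (F y - c) ^+ 2 <=
     C * (eps ^+ 2 + \sum_(g <- gs) \int[A (kap j)]_y (F (act g y) - c) ^+ 2)) /\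
     W j setT = 1%E.
  by apply: filterI.
apply: filterS2 near12 nearW => j [/= h1 h2] [h3 Wj1].
have bF := bmeas_testf tF.
have bFc : bmeas (fun y : borel X => F y - c) by apply: bmeasB => //; exact: bmeas_cst.
have h4 : `|\int[W j]_y F y - c| <= dl / 2.
  rewrite -ler_sqr ?nnegrE ?normr_ge0 ?(ltW dl2)// real_normK ?num_real//.
  rewrite -[X in _ - X](Rint_cst Wj1) -(RintB (WT j) bF (bmeas_cst _ _)).
    apply: le_trans (Rint_sqr_ge Wj1 bFc) _; apply: le_trans h3 _; apply: le_trans _ Cdl.
  apply: ler_wpM2l => //; move: h1; rewrite ltr_norml => /andP[h1 _].
  move: sml h1; rewrite /=; set s := (_ * _); set s' := \sum_(_ <- _) _.
  by move: s s' (eps ^+ 2) => s s' e; lra.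
rewrite sub0r normrN in h2.
rewrite -[X in `|X|](subrKA (\int[W j]_y F y)) (le_trans (ler_normD _ _))//.
rewrite (_ : dl = dl / 2 + dl / 2); last by field.
by apply: lerD => //; exact: ltW.
Qed.

End transfer.

(** * Compactness of conformal blocks *)

Section finite_nets.
Context (R : realType) (m n : nat) (n_gt0 : (0 < n)%N).
Context (Nm : 'cV[R]_m -> R) (Nn : 'cV[R]_n -> R).
Context (Nm_norm : is_norm Nm) (Nn_norm : is_norm Nn).
Local Notation G := (SLpm R (m + n)).
Local Notation X := (SLquo R (m + n)).
Implicit Types (f F : X -> R) (g h : G) (y : X).

Lemma ball_net c d : 0 < d -> exists D : seq G,
  forall g, nrm (SLpm_mx g) <= c -> exists2 g0, g0 \in D & sdist g g0 < d.
Proof.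
move=> d0; have := @compact_SL_ball R (m + n) c; rewrite compact_cover.
move=> /(_ G setT (fun g0 => [set g | sdist g g0 < d])) [||D _ DP].
- move=> g0 _; rewrite openE => g /= gg0; apply/nbhs_SL.
  exists (d - sdist g g0) => [|h hg /=]; first by rewrite subr_gt0.
  by rewrite (le_lt_trans (sdist_tri g _ _))// -ltrBrDr.
- by move=> g _; exists g => //=; rewrite sdistxx.
- exists (enum_fset D) => g gc; have [g0 /= gD gg0] := DP g gc; by exists g0.
Qed.

(** Conformal blocks of bounded time form a bounded, hence totally bounded set.  Closeness of [g]
    and [g'] is inherited by [h g y] and [h g' y] for all conformal [h], by [conformal_conj] and
    uniform continuity. *)
Lemma conformal_net f tau eps : testf f -> 0 < eps -> exists gs : seq G,
  (forall g, g \in gs -> exists s, conformal Nm Nn s g) /\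
  forall s g, conformal Nm Nn s g -> `|s| <= tau -> exists2 g', g' \in gs &
    forall t h y, conformal Nm Nn t h -> `|f (act h (act g y)) - f (act h (act g' y))| <= eps.
Proof.
move=> [uf _] eps0; have [d d0 dP] := uf _ eps0.
have [C C0 CP] := conformal_conj n_gt0 Nm_norm Nn_norm.
have [B B0 BP] := conformal_bounded Nm_norm Nn_norm tau.
have CB : 0 < C * B by rewrite mulr_gt0.
have d2 : 0 < d / (C * B) / 2 by rewrite !divr_gt0.
have [D DP] := ball_net B d2.
pose S g := exists2 s, conformal Nm Nn s g & `|s| <= tau.
(* the centres of a cover of the ball need not be conformal: take a conformal point in each piece *)
have /choice[pick pickP] : forall g0, exists g, (exists2 g1, S g1 & sdist g1 g0 < d / (C * B) / 2) ->
    S g /\ sdist g g0 < d / (C * B) / 2.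
  move=> g0; have [[g Sg gg0]|no] := pselect (exists2 g1, S g1 & sdist g1 g0 < d / (C * B) / 2).
    by exists g.
  by exists g0.
exists [seq pick g0 | g0 <- D & `[< exists2 g1, S g1 & sdist g1 g0 < d / (C * B) / 2 >]]; split.
  move=> g' /mapP[g0 + ->]; rewrite mem_filter => /andP[/asboolP/pickP[[s cs _] _] _].
  by exists s.
move=> s g gs stau; have [g0 g0D gg0] := DP _ (BP _ _ gs stau).
have ex : exists2 g1, S g1 & sdist g1 g0 < d / (C * B) / 2 by exists g => //; exists s.
have [[s' g's s'tau] g'g0] := pickP _ ex; set g' := pick g0 in g's g'g0.
exists g'; first by apply: map_f; rewrite mem_filter g0D andbT; exact/asboolP.
move=> t h y ht; apply/ltW.
have -> : act h (act g y) = act (h * (g * g'^-1) * h^-1)%g (act h (act g' y)).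
  by rewrite -!actM; congr (act _ _); rewrite -!mulgA mulKg mulVg mulg1.
apply: dP; have gg' : conformal Nm Nn (s - s') (g * g'^-1)%g.
  by apply: conformalM => //; exact: conformalV.
rewrite (le_lt_trans (CP _ _ _ _ ht gg'))//.
rewrite -(mulgV g').
have B' : nrm (SLpm_mx (g'^-1)%g) <= B.
  by apply: (BP _ _ (conformalV g's)); rewrite normrN.
have lt1 : sdist g g' < d / (C * B).
  rewrite (le_lt_trans (sdist_tri g0 _ _))//.
  by rewrite [ltRHS](_ : _ = d / (C * B) / 2 + d / (C * B) / 2) ?ltrD// 1?[sdist g0 _]sdistC//; field; rewrite !gt_eqF.
rewrite (@le_lt_trans _ _ (C * (sdist g g' * B)))//.
  rewrite ler_pM2l// (le_trans (sdistMr _ _ _))// ler_wpM2l// sdist_ge0//.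
by rewrite mulrCA -ltr_pdivlMr.
Qed.

(** The property of the pair that survives midpoints and averages, so that one net chosen for [f]
    serves all functions built from [f]. *)
Definition osc_dominated f F := forall t t' g g' e,
  conformal Nm Nn t g -> conformal Nm Nn t' g' ->
  (forall s h y, conformal Nm Nn s h -> `|f (act h (act g y)) - f (act h (act g' y))| <= e) ->
  forall s h y, conformal Nm Nn s h -> `|F (act h (act g y)) - F (act h (act g' y))| <= e.

Lemma osc_dominated_refl f : osc_dominated f f.
Proof. by move=> t t' g g' e _ _; apply. Qed.

Lemma osc_dominated_mid f F F' : osc_dominated f F -> osc_dominated f F' ->
  osc_dominated f (fun y => (F y + F' y) / 2).
Proof.
move=> fF fF' t t' g g' e gt gt' fe s h y hs.
have := fF _ _ _ _ _ gt gt' fe _ _ y hs; have := fF' _ _ _ _ _ gt gt' fe _ _ y hs.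
by rewrite !ler_norml => /andP[a1 a2] /andP[b1 b2]; apply/andP; split; lra.
Qed.

(** An average over conformal [b] only replaces [h] by [b h]. *)
Lemma osc_dominated_avg (nu : probability (borel G) R) (E : set G) f F :
  measurable (E : set (borel G)) -> nu E = 1%E ->
  (forall b, E b -> exists s, conformal Nm Nn s b) -> testf F ->
  osc_dominated f F -> osc_dominated f (avg nu F).
Proof.
move=> mE nuE Econf tF fF t t' g g' e gt gt' fe s h y hs.
have nuT : (nu setT < +oo)%E by exact: probT_lty.
have b1 := bmeas_actl (act h (act g y)) tF; have b2 := bmeas_actl (act h (act g' y)) tF.
rewrite /avg -RintB// (le_trans (le_norm_Rint nuT _))//; first exact: bmeasB.
rewrite -[leRHS](Rint_cst (probability_setT nu)).
apply: le_Rint_ae; [by apply: bmeas_norm; exact: bmeasB|exact: bmeas_cst|].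
have FN : Filter (almost_everywhere nu) by exact: ae_filter_ringOfSetsType.
apply: filterS (prob1_ae mE nuE) => b /Econf[u bu].
rewrite -![act b (act h _)]actM; apply: fF gt gt' fe _ _ _ (conformalM _ _); [exact: bu|exact: hs].
Qed.

(** Replace [g] by a nearby member of the finite net and bound one term of the sum by the sum. *)
Lemma net_square f F c eps (gs : seq G) s g y tau :
  osc_dominated f F ->
  (forall g, g \in gs -> exists s, conformal Nm Nn s g) ->
  (forall s g, conformal Nm Nn s g -> `|s| <= tau -> exists2 g', g' \in gs &
    forall t h y, conformal Nm Nn t h -> `|f (act h (act g y)) - f (act h (act g' y))| <= eps) ->
  conformal Nm Nn s g -> `|s| <= tau ->
  (F (act g y) - c) ^+ 2 <= 2 * (eps ^+ 2 + \sum_(g' <- gs) (F (act g' y) - c) ^+ 2).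
Proof.
move=> fF gsc gsP gs' stau; have [g' g'gs /(fF _ _ _ _ _ gs')] := gsP _ _ gs' stau.
have [s' g's'] := gsc _ g'gs.
move=> /(_ _ g's' _ 1%g y (conformal1 Nm Nn)); rewrite !act1.
have : (F (act g' y) - c) ^+ 2 <= \sum_(g'' <- gs) (F (act g'' y) - c) ^+ 2.
  by rewrite (big_rem g')//= lerDl sumr_ge0// => g'' _; exact: sqr_ge0.
move: (F (act g y)) (F (act g' y)) (\sum_(_ <- _) _) => a b S bS ab.
have eps0 : 0 <= eps by exact: le_trans ab.
have : (a - b) ^+ 2 <= eps ^+ 2 by rewrite -[leLHS]real_normK ?num_real// ler_sqr ?nnegrE.
have : 0 <= (a - 2 * b + c) ^+ 2 by exact: sqr_ge0.
lra.
Qed.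

End finite_nets.

(** * Shadowing of the walk by the flow *)

Section walk_and_flow.
Context (R : realType) (m n : nat) (n_gt0 : (0 < n)%N).
Context (Nm : 'cV[R]_m -> R) (Nn : 'cV[R]_n -> R).
Local Notation G := (SLpm R (m + n)).
Local Notation X := (SLquo R (m + n)).
Local Notation conf := (conformal Nm Nn).
Local Notation fl := (flow m n_gt0).
Variables (tmin tmax : R) (b : nat -> G) (x : X).
Hypothesis tmin_gt0 : 0 < tmin.
Hypothesis b_conf : forall p, exists2 t, tmin <= t <= tmax & conf t (b p).

Lemma flowD (s t : R) : fl (s + t) = (fl s * fl t)%g.
Proof.
apply/val_inj; rewrite /= /flow_mx mulmx_block !(mulmx0, mul0mx, addr0, add0r).
rewrite -!scalar_mxM -!expRD; congr (block_mx _%:M _ _ (expR _)%:M).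
by rewrite mulrDr mulrDl opprD.
Qed.

Lemma walk_times : exists S : nat -> R, S 0%N = 0 /\
  forall p, conf (S p) (walk b p) /\ tmin <= S p.+1 - S p <= tmax.
Proof.
have /choice[t tP] : forall p, exists t, tmin <= t <= tmax /\ conf t (b p).
  by move=> p; have [t] := b_conf p; exists t.
exists (fun p => \sum_(q < p) t q); split=> [|p]; first by rewrite big_ord0.
split; last by rewrite big_ord_recr /= addrAC subrr add0r; case: (tP p).
elim: p => [|p IH]; first by rewrite big_ord0; exact: conformal1.
by rewrite big_ord_recr /= addrC; apply: conformalM => //; case: (tP p).
Qed.

Lemma flow_of_conformal (s t : R) w : conf s w ->
  exists g, conf (s - t) g /\ forall y : X, act w y = act g (act (fl t) y).
Proof.
move=> ws; exists (w * (fl t)^-1)%g; split; last by move=> y; rewrite -actM mulgVK.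
by apply: conformalM => //; apply: conformalV => //; exact: conformal_flow.
Qed.

Lemma conformal_of_flow (s t : R) w : conf s w ->
  exists g, conf (t - s) g /\ forall y : X, act (fl t) y = act g (act w y).
Proof.
move=> ws; exists (fl t * w^-1)%g; split; last by move=> y; rewrite -actM mulgVK.
by apply: conformalM; [exact: conformal_flow|exact: conformalV].
Qed.

Section domination.
Variables (f F : X -> R) (c eps : R) (gs : seq G).
Hypothesis fF : osc_dominated Nm Nn f F.
Hypothesis gsc : forall g, g \in gs -> exists s, conf s g.
Hypothesis gsP : forall s g, conf s g -> `|s| <= tmax -> exists2 g', g' \in gs &
  forall t h y, conf t h -> `|f (act h (act g y)) - f (act h (act g' y))| <= eps.
Hypothesis tF : testf F.

Let u (y : X) : R := (F y - c) ^+ 2.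
Let phi (y : X) : R := 2 * (eps ^+ 2 + \sum_(g <- gs) u (act g y)).

Let bu : bmeas (u : borel X -> R).
Proof. by apply: bmeasX2; apply: bmeasB; [exact: bmeas_testf|exact: bmeas_cst]. Qed.

Let bsum : bmeas ((fun y => \sum_(g <- gs) u (act g y)) : borel X -> R).
Proof. by apply: bmeas_sum => g; exact: (bmeas_act g bu). Qed.

Let bphi : bmeas (phi : borel X -> R).
Proof. by apply: bmeasM; [exact: bmeas_cst|apply: bmeasD => //; exact: bmeas_cst]. Qed.

Let phi0 y : 0 <= phi y.
Proof.
by rewrite /phi mulr_ge0// addr_ge0 ?sqr_ge0// sumr_ge0// => g _; exact: sqr_ge0.
Qed.

Let Rint_phi (M : {measure set (borel X) -> \bar R}) : M setT = 1%E ->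
  \int[M]_y phi y = 2 * (eps ^+ 2 + \sum_(g <- gs) \int[M]_y u (act g y)).
Proof.
move=> M1; have MT : (M setT < +oo)%E by rewrite M1 ltry.
rewrite RintZ//; last by apply: bmeasD => //; exact: bmeas_cst.
rewrite RintD//; last exact: bmeas_cst.
by rewrite (Rint_cst M1) Rint_sum// => g; exact: (bmeas_act g bu).
Qed.

Let near_time (S : nat -> R) p t : tmin <= S p.+1 - S p <= tmax ->
  S p <= t <= S p.+1 -> `|S p.+1 - t| <= tmax /\ `|t - S p.+1| <= tmax.
Proof.
move=> /andP[_ h] /andP[h1 h2]; rewrite [X in _ /\ (X <= _)]distrC ger0_norm ?subr_ge0//.
by split; apply: le_trans h; rewrite lerB.
Qed.

Let nondecreasing_times (S : nat -> R) : (forall p, tmin <= S p.+1 - S p <= tmax) ->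
  {homo S : p q / (p <= q)%N >-> p <= q}.
Proof.
move=> h; apply: homo_leq; [exact: lexx|exact: le_trans|move=> p].
by have /andP[h1 _] := h p; rewrite -subr_ge0 (le_trans (ltW tmin_gt0)).
Qed.

(** For [t] between the walk times [S p] and [S p.+1] the point [b_(p+1) ... b_1 x] is a conformal
    translate of [a_t x] by a time at most [tmax], so that its value is bounded by the net sum at
    [a_t x].  Integrate over [t]; these intervals have length at least [tmin] and are contained in
    [[0, N tmax]]. *)
Lemma walk_dominated N : (0 < N)%N ->
  \int[walk_average b x N]_y u y <= 2 * tmax / tmin *
    (eps ^+ 2 + \sum_(g <- gs) \int[time_average n_gt0 x (N%:R * tmax)]_y u (act g y)).
Proof.
move=> N0; have [S [S0 SP]] := walk_times.
have SP1 p := (SP p).1; have SP2 p := (SP p).2.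
have tmax0 : 0 < tmax.
  by have /andP[h1 h2] := SP2 0%N; exact: lt_le_trans tmin_gt0 (le_trans h1 h2).
have N0' : 0 < N%:R :> R by rewrite ltr0n.
have T0 : 0 < N%:R * tmax by rewrite mulr_gt0.
have Smono := nondecreasing_times SP2.
have SN : S N <= N%:R * tmax.
  elim: (N) => [|p IH]; first by rewrite S0 mul0r.
  have /andP[_ h] := SP2 p; rewrite -natr1 mulrDl mul1r; lra.
have bo := bmeas_orbit n_gt0 x bphi.
have stE := itvint_steps N Smono bo; rewrite S0 in stE.
have step p : tmin * u (act (walk b p.+1) x) <=
    \int[leb_itv (S p) (S p.+1)]_t phi (act (fl t) x).
  have /andP[h1 _] := SP2 p.
  apply: (@le_trans _ _ (u (act (walk b p.+1) x) * (S p.+1 - S p))).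
    by rewrite mulrC ler_wpM2l// sqr_ge0.
  rewrite -itvint_cst; last exact: Smono.
  apply: itvint_le; [exact: bmeas_cst|exact: bo|move=> t /(near_time (SP2 p))[ht _]].
  have [g [gt ->]] := flow_of_conformal t (SP1 p.+1).
  exact: net_square fF gsc gsP gt ht.
have total : tmin * \sum_(p < N) u (act (walk b p.+1) x) <=
    N%:R * tmax * \int[time_average n_gt0 x (N%:R * tmax)]_y phi y.
  rewrite Rint_time_average ?(ltW T0)// mulVKf ?gt_eqF//.
  apply: le_trans (itvint_mono _ SN bo _); last 2 first.
  - by rewrite -S0; exact: Smono.
  - by move=> t; exact: phi0.
  by rewrite stE mulr_sumr; exact: ler_sum.
rewrite Rint_walk_average// ler_pdivrMr// -(ler_pM2l tmin_gt0) (le_trans total)//.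
rewrite Rint_phi; last exact: time_average_setT.
set s := (eps ^+ 2 + _); rewrite le_eqVlt; apply/orP; left; apply/eqP.
by field; rewrite gt_eqF.
Qed.

(** The same comparison read backwards: [a_t x] is a conformal translate of [b_(p+1) ... b_1 x].  As
    the intervals have length at least [tmin], about [T / tmin] steps of the walk cover [[0, T]]. *)
Lemma time_dominated T : tmin <= T ->
  \int[time_average n_gt0 x T]_y u y <= 4 * tmax / tmin *
    (eps ^+ 2 + \sum_(g <- gs) \int[walk_average b x (Num.truncn (T / tmin)).+1]_y u (act g y)).
Proof.
move=> Ttmin; have [S [S0 SP]] := walk_times.
have SP1 p := (SP p).1; have SP2 p := (SP p).2.
have tmax0 : 0 < tmax.
  by have /andP[h1 h2] := SP2 0%N; exact: lt_le_trans tmin_gt0 (le_trans h1 h2).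
have T0 : 0 < T by exact: lt_le_trans Ttmin.
set N := (Num.truncn (T / tmin)).+1.
have Tt0 : 0 <= T / tmin by rewrite divr_ge0// ltW.
have /andP[Nlow Nup] := truncn_itv Tt0.
have Smono := nondecreasing_times SP2.
have SN : N%:R * tmin <= S N.
  elim: (N) => [|p IH]; first by rewrite S0 mul0r.
  have /andP[h _] := SP2 p; rewrite -natr1 mulrDl mul1r; lra.
have TSN : T <= S N by rewrite (le_trans _ SN)// -ler_pdivrMr// ltW.
have bo := bmeas_orbit n_gt0 x bu.
have stE := itvint_steps N Smono bo; rewrite S0 in stE.
have step p : \int[leb_itv (S p) (S p.+1)]_t u (act (fl t) x) <= tmax * phi (act (walk b p.+1) x).
  have /andP[_ h1] := SP2 p.
  apply: (@le_trans _ _ (phi (act (walk b p.+1) x) * (S p.+1 - S p))); last first.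
    by rewrite mulrC ler_wpM2r// phi0.
  rewrite -itvint_cst; last exact: Smono.
  apply: itvint_le; [exact: bo|exact: bmeas_cst|move=> t /(near_time (SP2 p))[_ ht]].
  have [g [gt ->]] := conformal_of_flow t (SP1 p.+1).
  exact: net_square fF gsc gsP gt ht.
have total : \int[leb_itv 0 T]_t u (act (fl t) x) <=
    N%:R * tmax * \int[walk_average b x N]_y phi y.
  apply: le_trans (itvint_mono (ltW T0) TSN bo _) _; first by move=> t; exact: sqr_ge0.
  rewrite stE Rint_walk_average// mulrC mulrA divfK ?pnatr_eq0//.
  by rewrite mulrC mulr_sumr; exact: ler_sum.
rewrite Rint_time_average ?(ltW T0)// mulrC ler_pdivrMr// (le_trans total)//.
rewrite Rint_phi; last exact: walk_average_setT.
set s := (eps ^+ 2 + _).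
have s0 : 0 <= s.
  by rewrite addr_ge0 ?sqr_ge0// sumr_ge0// => g _; apply: Rint_ge0 => y; exact: sqr_ge0.
(* N is at most T / tmin + 1, and T / tmin is at least 1 *)
have NT : N%:R <= 2 * T / tmin.
  rewrite /N -natr1; have : 1 <= T / tmin by rewrite ler_pdivlMr// mul1r.
  by rewrite -mulrA; move: Nlow; lra.
rewrite (_ : 4 * tmax / tmin * s * T = 2 * T / tmin * (tmax * (2 * s))); last first.
  by field; rewrite gt_eqF.
by rewrite -mulrA ler_wpM2r// mulr_ge0 ?mulr_ge0// ltW.
Qed.

End domination.
End walk_and_flow.

(** * From the flow to the walk *)

Section equivalence.
Context (R : realType) (m n : nat) (m_gt0 : (0 < m)%N) (n_gt0 : (0 < n)%N).
Context (Nm : 'cV[R]_m -> R) (Nn : 'cV[R]_n -> R).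
Context (Nm_norm : is_norm Nm) (Nn_norm : is_norm Nn).
Local Notation G := (SLpm R (m + n)).
Local Notation X := (SLquo R (m + n)).
Local Notation conf := (conformal Nm Nn).
Local Notation fl := (flow m n_gt0).
Variable mu : probability (borel X) R.
Hypothesis mu_inv : act_invariant mu.
Implicit Types (f F : X -> R).

Let muT : (mu setT < +oo)%E. Proof. exact: probT_lty. Qed.

Lemma conformal_bounded2 tau : exists B, forall b, (exists2 t, `|t| <= tau & conf t b) ->
  nrm (SLpm_mx b) <= B /\ nrm (SLpm_mx (b^-1)%g) <= B.
Proof.
have [B B0 BP] := conformal_bounded Nm_norm Nn_norm tau; exists B => b [t ttau bt].
split; first exact: BP bt ttau.
by apply: BP (conformalV bt) _; rewrite normrN.
Qed.

Lemma Rint_mid (M : {measure set (borel X) -> \bar R}) F F' : (M setT < +oo)%E ->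
  testf F -> testf F' ->
  \int[M]_y ((F y + F' y) / 2) = 2^-1 * (\int[M]_y F y + \int[M]_y F' y).
Proof.
move=> MT tF tF'; have bF := bmeas_testf tF; have bF' := bmeas_testf tF'.
under eq_Rintegral do rewrite mulrC.
by rewrite (RintZ MT _ (bmeasD bF bF')) (RintD MT bF bF').
Qed.

Lemma mulr_half_sub (a b c : R) : 2^-1 * ((a - b) + (a - c)) = a - 2^-1 * (b + c).
Proof. by field. Qed.

(** [Q] is the statement that [F] has the same limiting averages as [f]; it only has to be stable
    under the operations used to build the convex set. *)
Lemma smoothing (nu : probability (borel G) R) (E : set G) tmin tmax (Q : (X -> R) -> Prop) f e :
  measurable (E : set (borel G)) -> nu E = 1%E -> 0 < tmin ->
  (forall b, E b -> exists2 t, tmin <= t <= tmax & conf t b) ->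
  testf f -> Q f ->
  (forall F F', testf F -> testf F' -> Q F -> Q F' -> Q (fun y => (F y + F' y) / 2)) ->
  (forall F, testf F -> testf (avg nu F) -> Q F -> Q (avg nu F)) -> 0 < e ->
  exists F, [/\ testf F, osc_dominated Nm Nn f F, Q F & \int[mu]_y (F y - \int[mu]_z f z) ^+ 2 <= e].
Proof.
move=> mE nuE tmin0 Econf tf Qf Qmid Qavg e0.
have [B BP] := conformal_bounded2 tmax.
have EB b : E b -> nrm (SLpm_mx b) <= B /\ nrm (SLpm_mx (b^-1)%g) <= B.
  move=> /Econf[t /andP[t1 t2] bt]; apply: BP; exists t => //.
  by rewrite ger0_norm// (le_trans (ltW tmin0)).
have [M fM] := testf_bounded tf; set c := \int[mu]_z f z.
pose V F := [/\ testf F, forall y, `|F y| <= M, \int[mu]_y F y = c & osc_dominated Nm Nn f F /\ Q F].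
have [|||||||F [tF _ _ [fF QF]] Fc] := @mean_ergodic R m n m_gt0 n_gt0 Nm Nn Nm_norm Nn_norm
  mu nu E B tmin mu_inv mE nuE EB tmin0 _ V M c f _ _ _ _ _ _ e e0; last by exists F.
- by move=> b /Econf[t /andP[t1 _] bt]; exists t.
- by split => //; split => //; exact: osc_dominated_refl.
- by move=> F [].
- by move=> F [].
- by move=> F [].
- move=> F F' [tF FM Fc [fF QF]] [tF' FM' Fc' [fF' QF']]; split.
  + under eq_fun do rewrite mulrC; apply: testfZ; exact: testfD.
  + move=> y; have := FM y; have := FM' y; rewrite !ler_norml => /andP[a1 a2] /andP[b1 b2].
    by apply/andP; split; lra.
  + by rewrite (Rint_mid muT tF tF') Fc Fc'; lra.
  + by split; [exact: osc_dominated_mid|exact: Qmid].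
- move=> F [tF FM Fc [fF QF]]; have tA := avg_testf mE nuE EB tF; split => //.
  + exact: avg_bound.
  + by rewrite Rint_avg.
  + split; last exact: Qavg.
    by apply: osc_dominated_avg mE nuE _ tF fF => b /Econf[t _ bt]; exists t.
Qed.

Lemma young_eps (C dl : R) : 0 < C -> 0 < dl ->
  exists2 eps, 0 < eps & C * (3 * eps ^+ 2) <= (dl / 2) ^+ 2.
Proof.
move=> C0 dl0; have K0 : 0 < 3 * C + 1 by lra.
exists (dl / 2 / (3 * C + 1)); first by rewrite !divr_gt0.
rewrite expr_div_n mulrA mulrA ler_pdivrMr ?exprn_gt0// mulrC ler_wpM2l ?sqr_ge0//.
nra.
Qed.

Lemma cvg_bounded_div (u : nat -> R) K : (forall N, `|u N| <= K) ->
  u N / N%:R @[N --> \oo] --> (0 : R).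
Proof.
move=> uK; have K0 : 0 <= K by exact: le_trans (uK 0%N).
apply/cvgrPdist_le => e e0; have := nbhs_infty_ger (K / e); have := nbhs_infty_gt 0%N.
apply: filterS2 => N N0 KN; have N0' : 0 < N%:R :> R by rewrite ltr0n.
rewrite sub0r normrN normrM normfV (gtr0_norm N0') ler_pdivrMr// (le_trans (uK N))//.
by rewrite mulrC -ler_pdivrMr.
Qed.

Section forward.
Variables (nu : probability (borel G) R) (E : set G) (tmin tmax : R).
Hypotheses (mE : measurable (E : set (borel G))) (nuE : nu E = 1%E) (tmin0 : 0 < tmin).
Hypothesis Econf : forall b, E b -> exists2 t, tmin <= t <= tmax & conf t b.
Local Notation Om := (seq_space (borel G)).
Variable P : probability Om R.
Hypothesis P_prod : is_infinite_product nu P.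
Variable x : X.

#[local] Instance P_ae_filter : Filter (almost_everywhere P).
Proof. exact: ae_filter_ringOfSetsType. Qed.

Lemma ae_walk : {ae P, forall b : Om, forall p, exists2 t, tmin <= t <= tmax & conf t (b p)}.
Proof.
suff h p : {ae P, forall b : Om, E (b p)}.
  apply: (filterS (P := fun b : Om => forall p, E (b p))); last exact: ae_foralln.
  by move=> b bE p; exact: Econf.
have mC : measurable [set b : Om | E (b p)] by apply: sub_sigma_algebra; exists p, E.
apply: (prob1_ae mC).
rewrite [X in P X](_ : _ =
    [set b : Om | forall q, (q < p.+1)%N -> (if q == p then E else setT) (b q)]); last first.
  apply/seteqP; split=> b /=; first by move=> bE q _; case: eqP => [->|].
  by move=> /(_ p (ltnSn p)); rewrite eqxx.
rewrite (P_prod p.+1 (A := fun q => if q == p then E else setT)); last by move=> q; case: ifP.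
by rewrite big1// => q _; case: ifP => // _; exact: probability_setT.
Qed.

(** The martingale differences compare [F] at time [p + 1] with its average at time [p]; shifting the
    index of the average costs two bounded terms. *)
Lemma walk_average_avg F : testf F -> testf (avg nu F) -> {ae P, forall b : Om,
  \int[walk_average b x N]_y F y - \int[walk_average b x N]_y avg nu F y @[N --> \oo] --> (0 : R)}.
Proof.
move=> tF tA; have [M FM] := testf_bounded tA.
apply: filterS (martingale_average P_prod x tF) => b bF.
have h : (avg nu F (pos x b 0) - avg nu F (pos x b N)) / N%:R @[N --> \oo] --> (0 : R).
  apply: (@cvg_bounded_div _ (M + M)) => N.
  by rewrite (le_trans (ler_normB _ _))// lerD.
have telescoping N : \sum_(q < N) (F (pos x b q.+1) - avg nu F (pos x b q)) +
    (avg nu F (pos x b 0) - avg nu F (pos x b N)) =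
    \sum_(q < N) F (pos x b q.+1) - \sum_(q < N) avg nu F (pos x b q.+1).
  elim: N => [|N IH]; first by rewrite !big_ord0 !subrr addr0.
  by move: IH; rewrite !big_ord_recr /=; lra.
rewrite -[X in _ --> X](addr0 0).
apply: cvg_trans (cvgD bF h); apply: near_eq_cvg; apply: nearW => N.
rewrite !Rint_walk_average; [|exact: bmeas_testf..].
by rewrite -mulrBl -telescoping mulrDl.
Qed.

Lemma birkhoff_walk_near f dl : birkhoff_generic n_gt0 mu x -> testf f -> 0 < dl ->
  {ae P, forall b : Om, \forall N \near \oo, `|\int[walk_average b x N]_y f y - \int[mu]_y f y| <= dl}.
Proof.
move=> xgen tf dl0.
have [b0 b0P] : exists b0, E b0.
  apply: contrapT => nE; have : nu set0 = 1%E.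
    by rewrite -nuE; congr (nu _); apply/seteqP; split=> b //= Eb; apply: nE; exists b.
  by rewrite measure0 => /eqP; rewrite eqe eq_sym oner_eq0.
have tmax0 : 0 < tmax.
  by have [t /andP[t1 t2] _] := Econf b0P; rewrite (lt_le_trans tmin0)// (le_trans t1).
have C0 : 0 < 2 * tmax / tmin by rewrite divr_gt0// mulr_gt0.
have [eps eps0 Ceps] := young_eps C0 dl0.
have [gs [gsc gsP]] := conformal_net n_gt0 Nm_norm Nn_norm tmax tf eps0.
pose Q F := {ae P, forall b : Om,
  \int[walk_average b x N]_y f y - \int[walk_average b x N]_y F y @[N --> \oo] --> (0 : R)}.
have e'0 : 0 < eps ^+ 2 / (size gs).+1%:R by rewrite divr_gt0// exprn_gt0.
have [|||F [tF fF QF Fe]] := @smoothing nu E tmin tmax Q f _ mE nuE tmin0 Econf tf _ _ _ e'0.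
- apply: (filterS (P := fun=> True)); last exact: filterT.
  by move=> b _; under eq_fun do rewrite subrr; exact: cvg_cst.
- move=> F F' tF tF' QF QF'; apply: filterS2 QF QF' => b bF bF'.
  rewrite (_ : 0 = 2^-1 * (0 + 0)); last by rewrite addr0 mulr0.
  apply: cvg_trans (cvgM (cvg_cst (2^-1 : R)) (cvgD bF bF')).
  apply: near_eq_cvg; apply: nearW => N /=.
  by rewrite (Rint_mid (walk_average_lty b x N) tF tF') mulr_half_sub.
- move=> F tF tA QF; have h := walk_average_avg tF tA.
  apply: filterS2 QF h => b bF bA; rewrite -[X in _ --> X](addr0 0).
  apply: cvg_trans (cvgD bF bA); apply: near_eq_cvg; apply: nearW => N /=.
  by rewrite addrA subrK.
apply: filterS2 QF ae_walk => b bF bconf.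
apply: (@transfer_step R (m + n) nat R \oo +oo _ _ (walk_average b x) (time_average n_gt0 x) mu
  mu_inv _ _ _ _ xgen (fun N => N%:R * tmax) f F _ (2 * tmax / tmin) eps dl gs) => //.
- exact: walk_average_lty.
- by have := nbhs_infty_gt 0%N; apply: filterS => N; exact: walk_average_setT.
- exact: time_average_lty.
- by have := nbhs_pinfty_gt (num_real (0 : R)); apply: filterS => T; exact: time_average_setT.
- apply/cvgryPge => A; have := nbhs_infty_ger (A / tmax); apply: filterS => N.
  by rewrite ler_pdivrMr.
- have := nbhs_infty_gt 0%N; apply: filterS => N N0.
  exact: (walk_dominated n_gt0 x tmin0 bconf _ fF gsc gsP tF N0).
- rewrite (le_trans (ler_wpM2l _ Fe))// mulrCA -[leRHS]mulr1 ler_wpM2l ?sqr_ge0//.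
  by rewrite ler_pdivrMr// mul1r ler_nat.
- exact: ltW.
Qed.

Let three_thirds (e a b c d : R) : `|a - b| <= e / 3 -> `|c - d| <= e / 3 ->
  `|b - d| <= e / 3 -> `|c - a| <= e.
Proof.
rewrite !ler_norml => /andP[a1 a2] /andP[b1 b2] /andP[d1 d2].
by apply/andP; split; lra.
Qed.

(** Countably many test functions and tolerances, then uniform approximation. *)
Lemma birkhoff_walk : birkhoff_generic n_gt0 mu x ->
  {ae P, forall b : Om, weak_star_cvg \oo (walk_average b x) mu}.
Proof.
move=> xgen; have [D [tD Ddense]] := @testf_separable R (m + n).
have h : {ae P, forall b : Om, forall i j, \forall N \near \oo,
    `|\int[walk_average b x N]_y D i y - \int[mu]_y D i y| <= j.+1%:R^-1}.
  apply: (ae_foralln (mu := P)) => i; apply: (ae_foralln (mu := P)) => j.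
  by apply: birkhoff_walk_near => //; rewrite invr_gt0.
apply: filterS h => b bD f fc fK; have tf : testf f by apply/testfP.
apply/cvgrPdist_le => e e0; have e3 : 0 < e / 3 by rewrite divr_gt0.
have [i iP] := Ddense f _ tf e3.
have [j jP] : exists j, j.+1%:R^-1 <= e / 3.
  exists (Num.bound (e / 3)^-1); rewrite invf_ple ?posrE//.
  have := @archi_boundP R (e / 3)^-1; rewrite invr_ge0 (ltW e3) => /(_ isT)/ltW h.
  by apply: le_trans h _; rewrite ler_nat.
have close (M : {measure set (borel X) -> \bar R}) : M setT = 1%E ->
    `|\int[M]_y f y - \int[M]_y D i y| <= e / 3.
  move=> M1; have MT : (M setT < +oo)%E by rewrite M1 ltry.
  have bB : bmeas (fun y : borel X => f y - D i y) by apply: bmeasB; exact: bmeas_testf.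
  rewrite -(RintB MT (bmeas_testf tf) (bmeas_testf (tD i))) (le_trans (le_norm_Rint MT bB))//.
  rewrite -[leRHS](Rint_cst M1); apply: le_Rint => //; first exact: bmeas_norm.
  exact: bmeas_cst.
have := nbhs_infty_gt 0%N; apply: filterS2 (bD i j) => N Nj N0.
have c1 := close _ (walk_average_setT b x N0); have c2 := close _ (probability_setT mu).
exact: three_thirds c1 c2 (le_trans Nj jP).
Qed.

End forward.
End equivalence.

(** * From the walk to the flow *)

Section backward.
Context (R : realType) (m n : nat) (m_gt0 : (0 < m)%N) (n_gt0 : (0 < n)%N).
Context (Nm : 'cV[R]_m -> R) (Nn : 'cV[R]_n -> R).
Context (Nm_norm : is_norm Nm) (Nn_norm : is_norm Nn).
Local Notation G := (SLpm R (m + n)).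
Local Notation X := (SLquo R (m + n)).
Local Notation conf := (conformal Nm Nn).
Local Notation fl := (flow m n_gt0).
Variable mu : probability (borel X) R.
Hypothesis mu_inv : act_invariant mu.
Implicit Types (f F : X -> R).
Variables (tmin tmax : R) (b : nat -> G) (x : X).
Hypothesis tmin_gt0 : 0 < tmin.
Hypothesis b_conf : forall p, exists2 t, tmin <= t <= tmax & conf t (b p).

(** The two time averages differ by integrals over two intervals of length 1, divided by [T]. *)
Lemma time_average_flow1 F : testf F ->
  \int[time_average n_gt0 x T]_y F y - \int[time_average n_gt0 x T]_y F (act (fl 1) y)
    @[T --> +oo] --> (0 : R).
Proof.
move=> tF; have [M FM] := testf_bounded tF.
have M0 : 0 <= M by exact: le_trans (FM x).
have bF := bmeas_testf tF; have bF1 := bmeas_testf (testf_act (fl 1) tF).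
have bo := bmeas_orbit n_gt0 x bF.
have step (a : R) : `|\int[leb_itv a (a + 1)]_t F (act (fl t) x)| <= M.
  have lt := leb_itv_lty a (a + 1); have a1 : a <= a + 1 by rewrite lerDl.
  rewrite (le_trans (le_norm_Rint lt bo))//.
  apply: (@le_trans _ _ (\int[leb_itv a (a + 1)]_t M)).
    by apply: itvint_le; [exact: bmeas_norm|exact: bmeas_cst|move=> t _; exact: FM].
  by rewrite itvint_cst// addrAC subrr add0r mulr1.
apply/cvgrPdist_le => e e0; have := nbhs_pinfty_ge (num_real (2 * M / e)).
have := nbhs_pinfty_gt (num_real (0 : R)).
apply: filterS2 => T T0 TM.
rewrite !Rint_time_average ?(ltW T0)//.
have -> : \int[leb_itv 0 T]_t F (act (fl 1) (act (fl t) x)) =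
    \int[leb_itv 1 (T + 1)]_t F (act (fl t) x).
  have sh := itvint_shift 1 0 T bo; rewrite add0r in sh; apply: etrans (esym sh).
  by apply: eq_Rintegral => t _; rewrite -actM -flowD addrC.
have T1 : T <= T + 1 by rewrite lerDl.
have c1 := itvint_cat ler01 (_ : 1 <= T + 1) bo; rewrite lerDr (ltW T0) in c1.
have c2 := itvint_cat (ltW T0) T1 bo.
have s0 := step 0; rewrite add0r in s0; have sT := step T.
rewrite sub0r normrN -mulrBr normrM ger0_norm ?invr_ge0 ?(ltW T0)//.
rewrite mulrC ler_pdivrMr// mulrC -ler_pdivrMr//; apply: le_trans TM.
rewrite ler_pM2r ?invr_gt0//; move: (c1 isT) c2 s0 sT.
move: (\int[leb_itv 0 T]_t _) (\int[leb_itv 1 (T + 1)]_t _) (\int[leb_itv 0 1]_t _)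
  (\int[leb_itv T (T + 1)]_t _) (\int[leb_itv 0 (T + 1)]_t _) => i1 i2 i3 i4 i5 -> h.
rewrite !ler_norml => /andP[a1 a2] /andP[b1 b2]; apply/andP; split; lra.
Qed.

(** No randomness is left: [b] is one sequence with equidistributed walk.  The averaging measure is
    the point mass at [a_1], so that the convex set consists of averages of [f] over the flow. *)
Lemma walk_birkhoff : weak_star_cvg \oo (walk_average b x) mu -> birkhoff_generic n_gt0 mu x.
Proof.
move=> bgen f fc fK; have tf : testf f by apply/testfP.
pose nu : probability (borel G) R := \d_(fl 1 : borel G).
have mE : measurable ([set fl 1] : set (borel G)).
  have c1 : closed ([set fl 1] : set G).
    by apply: compact_closed; [exact: SL_hausdorff|exact: compact_set1].
  exact: borel_closed c1.
have nuE : nu [set fl 1] = 1%E by rewrite /nu /= diracE mem_set.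
have Econf g : [set fl 1] g -> exists2 t, 1 <= t <= 1 & conf t g.
  by move=> ->; exists 1; [rewrite lexx|exact: conformal_flow].
have avgE F : testf F -> avg nu F = fun y => F (act (fl 1) y).
  move=> tF; apply/funext => y; rewrite /avg Rint_dirac//.
  by case: (bmeas_actl y tF).
have tmax0 : 0 < tmax.
  by have [t /andP[t1 t2] _] := b_conf 0; rewrite (lt_le_trans tmin_gt0)// (le_trans t1).
have C0 : 0 < 4 * tmax / tmin by rewrite divr_gt0// mulr_gt0.
apply/cvgrPdist_le => dl dl0.
have [eps eps0 Ceps] := young_eps C0 dl0.
have [gs [gsc gsP]] := conformal_net n_gt0 Nm_norm Nn_norm tmax tf eps0.
pose Q F := \int[time_average n_gt0 x T]_y f y - \int[time_average n_gt0 x T]_y F y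
  @[T --> +oo] --> (0 : R).
have e'0 : 0 < eps ^+ 2 / (size gs).+1%:R by rewrite divr_gt0// exprn_gt0.
have [|||F [tF fF QF Fe]] := @smoothing R m n m_gt0 n_gt0 Nm Nn Nm_norm Nn_norm mu mu_inv
  nu [set fl 1] 1 1 Q f _ mE nuE ltr01 Econf tf _ _ _ e'0.
- by rewrite /Q; under eq_fun do rewrite subrr; exact: cvg_cst.
- move=> F F' tF tF' QF QF'; rewrite /Q (_ : 0 = 2^-1 * (0 + 0)); last by rewrite addr0 mulr0.
  apply: cvg_trans (cvgM (cvg_cst (2^-1 : R)) (cvgD QF QF')).
  apply: near_eq_cvg; apply: nearW => T /=.
  by rewrite (Rint_mid (time_average_lty n_gt0 x T) tF tF') mulr_half_sub.
- move=> F tF tA QF; rewrite /Q (avgE _ tF) -[X in _ --> X](addr0 0).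
  apply: cvg_trans (cvgD QF (time_average_flow1 tF)).
  apply: near_eq_cvg; apply: nearW => T.
  by rewrite -[LHS]/(_ + _) addrA subrK.
have := @transfer_step R (m + n) R nat +oo \oo _ _ (time_average n_gt0 x) (walk_average b x) mu
  mu_inv _ _ _ _ bgen (fun T => (Num.truncn (T / tmin)).+1) f F (\int[mu]_y f y) (4 * tmax / tmin)
  eps dl gs.
move=> h; have : \forall T \near +oo, `|\int[time_average n_gt0 x T]_y f y - \int[mu]_y f y| <= dl; last first.
  by apply: filterS => T; rewrite distrC.
apply: h => //.
- exact: time_average_lty.
- by have := nbhs_pinfty_gt (num_real (0 : R)); apply: filterS => T; exact: time_average_setT.
- exact: walk_average_lty.
- by have := nbhs_infty_gt 0%N; apply: filterS => N; exact: walk_average_setT.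
- apply/cvgnyPge => A; have := nbhs_pinfty_ge (num_real (A%:R * tmin)).
  have := nbhs_pinfty_ge (num_real tmin); apply: filterS2 => T Tt AT.
  have T0 : 0 <= T / tmin by rewrite divr_ge0 ?(ltW tmin_gt0)// (le_trans _ Tt)// ltW.
  by rewrite leqW// truncn_ge_nat// ler_pdivlMr.
- have := nbhs_pinfty_ge (num_real tmin); apply: filterS => T Tt.
  exact: (time_dominated n_gt0 x tmin_gt0 b_conf _ fF gsc gsP tF Tt).
- rewrite (le_trans (ler_wpM2l _ Fe))// mulrCA -[leRHS]mulr1 ler_wpM2l ?sqr_ge0//.
  by rewrite ler_pdivrMr// mul1r ler_nat.
- exact: ltW.
Qed.

End backward.

Theorem theorem1p7 (R : realType) (m n : nat)
  (m_gt0 : (0 < m)%N) (n_gt0 : (0 < n)%N)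
  (Nm : 'cV[R]_m -> R) (Nn : 'cV[R]_n -> R)
  (Nm_norm : is_norm Nm) (Nn_norm : is_norm Nn)
  (mu : probability (borel (SLquo R (m + n))) R)
  (mu_haar : is_haar_probability mu)
  (nu : probability (borel (SLpm R (m + n))) R)
  (E : set (SLpm R (m + n)))
  (E_compact : compact E)
  (nu_supp : nu E = 1%E)
  (E_form : forall e : SLpm R (m + n), E e ->
    exists (rho : R) (O : 'M[R]_m) (O' : 'M[R]_n),
      [/\ 0 < rho < 1,
          orthogonal_group Nm O,
          orthogonal_group Nn O' &
          SLpm_mx (e^-1)%g =
            block_mx (rho *: O) 0 0 (rho `^ (- (m%:R / n%:R)) *: O')])
  (P : probability (seq_space (borel (SLpm R (m + n)))) R)
  (P_prod : is_infinite_product nu P)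
  (x : SLquo R (m + n)) :
  birkhoff_generic n_gt0 mu x <->
  {ae P, forall b : nat -> SLpm R (m + n),
    weak_star_cvg \oo (walk_average b x) mu}.
Proof.
have [mu_inv _] := mu_haar.
have [tmin [tmax [tmin0 Econf]]] := contraction_times m_gt0 Nm_norm E_compact E_form.
have mE : measurable (E : set (borel (SLpm R (m + n)))).
  by apply: borel_closed; apply: compact_closed => //; exact: SL_hausdorff.
split=> [xgen|xae].
  exact: (birkhoff_walk m_gt0 Nm_norm Nn_norm mu_inv mE nu_supp tmin0 Econf P_prod xgen).
have FP : Filter (almost_everywhere P) by exact: ae_filter_ringOfSetsType.
have both : {ae P, forall b : seq_space (borel (SLpm R (m + n))),
    weak_star_cvg \oo (walk_average b x) mu /\
    forall p, exists2 t, tmin <= t <= tmax & conformal Nm Nn t (b p)}.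
  by have := ae_walk mE nu_supp Econf P_prod; apply: filterS2 xae => b.
have [b [bgen bconf]] : exists b : nat -> SLpm R (m + n),
    weak_star_cvg \oo (walk_average b x) mu /\
    forall p, exists2 t, tmin <= t <= tmax & conformal Nm Nn t (b p).
  apply: contrapT => nb; have [S [mS S0 SP]] := both.
  have ST : S = setT by apply/seteqP; split=> b // _; apply: SP => /= h; apply: nb; exists b.
  by have := probability_setT P; rewrite -ST S0 => /esym/eqP; rewrite eqe oner_eq0.
exact: (walk_birkhoff m_gt0 n_gt0 Nm_norm Nn_norm mu_inv tmin0 bconf bgen).
Qed.
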